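(* Define integers $\lambda_i^{(m,a)}$, where $0\le i\le n$, $0\le a\le n-2$ and $m\ge0$, by \[ \lambda_0^{(0,a)}=1,\quad \lambda_1^{(0,a)}=\frac{2t_{n-1}}{y_a},\quad \lambda_2^{(0,a)}=1,\quad \lambda_i^{(0,a)}=\frac{2t_{n-1}}{y_{k_i}}\ (3\le i\le n), \] where $\{k_3,\ldots,k_n\}$ is $\{0,1,\ldots,n-2\}$ with $a$ omitted, and, for $m\ge1$, \[ \lambda_0^{(m,a)}=\lambda_2^{(m-1,a)},\qquad \lambda_1^{(m,a)}=\lambda_1^{(m-1,a)},\qquad \lambda_2^{(m,a)}=\frac{\big(\lambda_1^{(m-1,a)}+\lambda_2^{(m-1,a)}\big)^2}{\lambda_0^{(m-1,a)}}, \] \[ \lambda_i^{(m,a)}=\frac{\lambda_i^{(m-1,a)}\big(\lambda_1^{(m-1,a)}+\lambda_2^{(m-1,a)}\big)}{\lambda_0^{(m-1,a)}}\quad(3\le i\le n). \] Set $X_n^{(m,a)}:=\mathbb{P}\big(\lambda_0^{(m,a)},\lambda_1^{(m,a)},\ldots,\lambda_n^{(m,a)}\big)$. Then: (i) $X_n^{(0,a)}=X_n$ for all $a$; (ii) if $m>0$ and if $X$ is a weighted projective space with a non-trivial mutation to $X_n^{(m,a)}$, then either $X=X_n^{(m-1,a)}$ or $X=X_n^{(m+1,a)}$; (iii) $X_n^{(m,a)}$ is not canonical for any $m\ge1$. In other words, the graph of mutations between weighted projective spaces starting at $X_n$ is a subtree of the tree with root $X_n$ and, for each $a\in\{0,\ldots,n-2\}$,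 one infinite branch $X_n - X_n^{(1,a)} - X_n^{(2,a)} - X_n^{(3,a)} - \cdots$, and the only canonical weighted projective space in this graph is $X_n$.
   Context: Sylvester numbers: $y_0=2$, $y_n=1+\prod_{i=0}^{n-1}y_i$ for $n\ge1$; $t_n:=y_n-1$. Define $X_n:=\mathbb{P}\big(1,1,\tfrac{2t_{n-1}}{y_{n-2}},\ldots,\tfrac{2t_{n-1}}{y_0}\big)$, an $n$-dimensional weighted projective space. $N\cong\mathbb{Z}^n$ is a lattice, $M=\mathrm{Hom}(N,\mathbb{Z})$, $N_{\mathbb{Q}}=N\otimes_{\mathbb{Z}}\mathbb{Q}$. A convex lattice polytope $P\subset N_{\mathbb{Q}}$ is Fano if $\dim P=n$, the origin lies in the strict interior of $P$, and the vertices of $P$ are primitive lattice points. $P\cong P'$ means there is a change of basis of $N$ sending $P$ to $P'$. For a Fano $n$-simplex $P=\mathrm{conv}\{v_0,\ldots,v_n\}$, its weights are the unique coprime positive integers $\lambda_0,\ldots,\lambda_n$ with $\sum\lambda_iv_i=\mathbf{0}$, its multiplicity is $[N:\sum\mathbb{Z}v_i]$, and $X_P$, the toric variety of the fan spanned by the faces of $P$, is called a fake weighted projective space. $X_P$ is the weighted projective space $\mathbb{P}(\lambda_0,\ldots,\lambda_n)$ exactly when the multiplicity is $1$, i.e. the $v_i$ generate $N$. Weighted projective spaces are considered up to isomorphism (reordering the weights). Mutation: let $w\in M$ be primitive. Put $H_{w,h}=\{v\in N_{\mathbb{Q}}: w(v)=h\}$, $w_h(P)=\mathrm{conv}(H_{w,h}\cap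 P\cap N)$ (possibly empty), $h_{\min}=\min_{v\in P}w(v)$, $h_{\max}=\max_{v\in P}w(v)$. A factor of $P$ with respect to $w$ is a lattice polytope $F\subset N_{\mathbb{Q}}$ with $w(F)=0$ such that for every integer $h$ with $h_{\min}\le h<0$ there is a (possibly empty) lattice polytope $G_h$ with $H_{w,h}\cap\mathrm{vert}(P)\subseteq G_h+(-h)F\subseteq w_h(P)$, where $\mathrm{vert}(P)$ is the set of vertices of $P$. The mutation is \[\mathrm{mut}_w(P,F)=\mathrm{conv}\Big(\bigcup_{h=h_{\min}}^{-1}G_h\cup\bigcup_{h=0}^{h_{\max}}\big(w_h(P)+hF\big)\Big),\] known to be independent of the $G_h$. There is a non-trivial mutation from $X_P$ to $X_Q$ if $Q\cong\mathrm{mut}_w(P,F)$ for some $w,F$ and $P\not\cong Q$. (Mutations are invertible.) The graph of mutations between weighted projective spaces starting at $X_n$ has as vertices the weighted projective spaces reachable from $X_n$ by a sequence of non-trivial mutations through weighted projective spaces, and as edges the non-trivial mutations between them. A (fake) weighted projective space is canonical if it has at worst canonical singularities, i.e. every cone $\sigma$ of its fan is canonical: the primitive generators of the rays of $\sigma$ lie in an affine hyperplane $\{v: u(v)=1\}$ for some $u\in M\otimes\mathbb{Q}$, and $N\cap\sigma\cap\{v: u(v)<1\}=\{\mathbf{0}\}$.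
   Formalization: Part (ii) and the description of the mutation graph (including that X_n is its only canonical space) are stated for n ≥ 4, since they fail for n = 2 (P(1,2,9) mutates to P(1,9,50)) and n = 3 (P(1,1,4,6) mutates to canonical P(1,1,1,3)); the rest is for n ≥ 2. *)

(* Defs.v *)
From HB Require Import structures.
From mathcomp Require Import all_boot all_order all_algebra.
From mathcomp Require Import classical_sets.

Set Implicit Arguments.
Unset Strict Implicit.
Unset Printing Implicit Defensive.

Import Order.TTheory GRing.Theory Num.Theory.
Local Open Scope classical_set_scope.
Local Open Scope ring_scope.

(** * Sylvester numbers *)

(* [sylv_prod n] is the product of the first n Sylvester numbers; the recursion
   y_n = 1 + y_0 * ... * y_(n-1) is [sylvE]. *)
Fixpoint sylv_prod (n : nat) : nat :=
  if n is m.+1 then (sylv_prod m * (sylv_prod m).+1)%N else 1%N.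

Definition sylv (n : nat) : nat := (sylv_prod n).+1.

Definition sylv_t (n : nat) : nat := (sylv n).-1.

Lemma sylv0 : sylv 0 = 2%N.
Proof. by []. Qed.

Lemma sylvE (n : nat) : sylv n = (1 + \prod_(i < n) sylv i)%N.
Proof.
have prodE k : sylv_prod k = (\prod_(i < k) sylv i)%N.
  by elim: k => [|k IHk]; rewrite ?big_ord0 // big_ord_recr /= -IHk.
by rewrite -prodE add1n.
Qed.

(** * Lattice and convex geometry

    N = Z^n is ['rV[int]_n], N_Q is ['rV[rat]_n], and M, M_Q are the
    corresponding column vectors, paired with N, N_Q by the matrix product. *)

Definition toQ m n (A : 'M[int]_(m, n)) : 'M[rat]_(m, n) := map_mx intr A.

Definition ev n (u : 'cV[rat]_n) (x : 'rV[rat]_n) : rat := (x *m u) 0 0.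

Definition primitive m n (A : 'M[int]_(m, n)) : Prop :=
  forall (k : int) (B : 'M[int]_(m, n)), A = k *: B -> `|k| = 1.

Definition lattice n : set 'rV[rat]_n := range (@toQ 1 n).

Definition conv n (A : set 'rV[rat]_n) : set 'rV[rat]_n :=
  [set x | exists k (p : 'I_k -> 'rV[rat]_n) (c : 'I_k -> rat),
    [/\ forall i, A (p i), forall i, 0 <= c i, \sum_i c i = 1
      & x = \sum_i c i *: p i]].

Definition cone n (A : set 'rV[rat]_n) : set 'rV[rat]_n :=
  [set x | exists k (p : 'I_k -> 'rV[rat]_n) (c : 'I_k -> rat),
    [/\ forall i, A (p i), forall i, 0 <= c i & x = \sum_i c i *: p i]].

Definition msum n (A B : set 'rV[rat]_n) : set 'rV[rat]_n :=
  [set x + y | x in A & y in B].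

Definition dilate n (c : int) (A : set 'rV[rat]_n) : set 'rV[rat]_n :=
  [set c%:~R *: x | x in A].

(* The empty set is included, as the hull of the empty sequence. *)
Definition lattice_polytope n (P : set 'rV[rat]_n) : Prop :=
  exists s : seq 'rV[int]_n, P = conv [set toQ v | v in [set` s]].

Definition vert n (P : set 'rV[rat]_n) : set 'rV[rat]_n :=
  [set x | P x /\ forall y z (c : rat), P y -> P z -> 0 < c < 1 ->
                    x = c *: y + (1 - c) *: z -> y = x /\ z = x].

Definition interior n (P : set 'rV[rat]_n) : set 'rV[rat]_n :=
  [set x : 'rV[rat]_n | exists2 e : rat, 0 < e &
             forall y : 'rV[rat]_n, (forall j, `|y 0 j - x 0 j| < e) -> P y].

(* [interior P 0] forces dim P = n. *)
Definition fano n (P : set 'rV[rat]_n) : Prop :=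
  [/\ lattice_polytope P, interior P 0
    & forall v : 'rV[int]_n, vert P (toQ v) -> primitive v].

Definition poly_iso n (P P' : set 'rV[rat]_n) : Prop :=
  exists2 A : 'M[int]_n, A \in unitmx & P' = [set x *m toQ A | x in P].

(** * Weighted projective spaces

    A toric variety X_P is represented by its Fano polytope P; equality of two
    such varieties is [poly_iso]. *)

(* "X_P is the weighted projective space P(l_0, ..., l_n)". The weights are
   given as rationals; part of the assertion is that they are coprime positive
   integers. Existential quantification over the labelling v of the vertices
   makes the predicate insensitive to the order of the weights. The hull of
   n + 1 points has a nonempty interior only if they are the vertices of a
   simplex, and generation of N by the v_i is multiplicity 1. *)
Definition is_wps_of n (l : 'I_n.+1 -> rat) (P : set 'rV[rat]_n) : Prop :=
  fano P /\
  exists (v : 'I_n.+1 -> 'rV[int]_n) (k : 'I_n.+1 -> nat),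
    [/\ P = conv (range (fun i => toQ (v i))),
        forall i, l i = (k i)%:R,
        (forall i, (0 < k i)%N) /\ (\big[gcdn/0]_i k i)%N = 1%N,
        \sum_i (v i *+ k i) = 0
      & forall x : 'rV[int]_n, exists c : 'I_n.+1 -> int,
          x = \sum_i c i *: v i].

Definition is_wps n (P : set 'rV[rat]_n) : Prop :=
  exists l : 'I_n.+1 -> rat, is_wps_of l P.

(** * Canonical singularities *)

(* Proper faces, including the empty one (u = 0, c = 1). *)
Definition proper_face n (P F : set 'rV[rat]_n) : Prop :=
  F <> P /\
  exists (u : 'cV[rat]_n) (c : rat),
    (forall x, P x -> ev u x <= c) /\ F = P `&` [set x | ev u x = c].

Definition fan_cone n (P s : set 'rV[rat]_n) : Prop :=
  exists2 F, proper_face P F & s = cone F.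

(* v is the primitive generator of a ray (one-dimensional face) of the strictly
   convex cone s. *)
Definition ray_generator n (s : set 'rV[rat]_n) (v : 'rV[int]_n) : Prop :=
  [/\ s (toQ v), primitive v
    & forall x y, s x -> s y -> x + y = toQ v ->
        exists2 c : rat, 0 <= c & x = c *: toQ v].

Definition canonical_cone n (s : set 'rV[rat]_n) : Prop :=
  exists u : 'cV[rat]_n,
    (forall v, ray_generator s v -> ev u (toQ v) = 1) /\
    @lattice n `&` s `&` [set x | ev u x < 1] = [set 0].

Definition canonical n (P : set 'rV[rat]_n) : Prop :=
  forall s, fan_cone P s -> canonical_cone s.

(** * Mutations *)

Definition level n (w : 'cV[int]_n) (h : int) : set 'rV[rat]_n :=
  [set v | ev (toQ w) v = h%:~R].

Definition slice n (w : 'cV[int]_n) (h : int) (P : set 'rV[rat]_n) :=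
  conv (level w h `&` P `&` @lattice n).

Definition is_hmin n (w : 'cV[int]_n) (P : set 'rV[rat]_n) (m : rat) : Prop :=
  (exists2 v, P v & ev (toQ w) v = m) /\ forall v, P v -> m <= ev (toQ w) v.

Definition is_hmax n (w : 'cV[int]_n) (P : set 'rV[rat]_n) (m : rat) : Prop :=
  (exists2 v, P v & ev (toQ w) v = m) /\ forall v, P v -> ev (toQ w) v <= m.

(* "F is a factor of P with respect to w, with witnesses G_h". *)
Definition factor_with n (w : 'cV[int]_n) (P F : set 'rV[rat]_n) (hmin : rat)
    (G : int -> set 'rV[rat]_n) : Prop :=
  [/\ lattice_polytope F, F !=set0, F `<=` level w 0
    & forall h : int, hmin <= h%:~R -> h < 0 ->
        [/\ lattice_polytope (G h),
            level w h `&` vert P `<=` msum (G h) (dilate (- h) F)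
          & msum (G h) (dilate (- h) F) `<=` slice w h P]].

(* "F is a factor of P with respect to w, and R = mut_w(P, F)". *)
Definition is_mutation n (w : 'cV[int]_n) (P F R : set 'rV[rat]_n) : Prop :=
  exists (hmin hmax : rat) (G : int -> set 'rV[rat]_n),
    [/\ is_hmin w P hmin, is_hmax w P hmax, factor_with w P F hmin G
      & R = conv
         ([set x | exists h : int, [/\ hmin <= h%:~R, h < 0 & G h x]] `|`
          [set x | exists h : int, [/\ 0 <= h, h%:~R <= hmax &
                     msum (slice w h P) (dilate h F) x]])].

(* There is a non-trivial mutation from X_P to X_Q. *)
Definition nontrivial_mutation n (P Q : set 'rV[rat]_n) : Prop :=
  (exists (w : 'cV[int]_n) (F R : set 'rV[rat]_n),
     [/\ primitive w, is_mutation w P F R & poly_iso Q R]) /\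
  ~ poly_iso P Q.

(** * The spaces X_n and X_n^(m,a) *)

(* 2 t_(n-1) / y_k *)
Definition base_weight (n k : nat) : rat :=
  (2 * sylv_t n.-1)%N%:R / (sylv k)%:R.

Definition X_weight (n i : nat) : rat :=
  if (i < 2)%N then 1 else base_weight n (n - i)%N.

Definition is_X n (P : set 'rV[rat]_n) : Prop :=
  is_wps_of (fun i => X_weight n i) P.

(* k_i = bump a (i - 3) enumerates {0, ..., n - 2} \ {a} increasingly. *)
Definition lam0 (n a i : nat) : rat :=
  match i with
  | 0 => 1
  | 1 => base_weight n a
  | 2 => 1
  | j.+3 => base_weight n (bump a j)
  end.

Definition lam_step (l : nat -> rat) (i : nat) : rat :=
  match i with
  | 0 => l 2%N
  | 1 => l 1%N
  | 2 => (l 1%N + l 2%N) ^+ 2 / l 0%N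
  | _ => l i * (l 1%N + l 2%N) / l 0%N
  end.

Definition lam (n m a : nat) : nat -> rat := iter m lam_step (lam0 n a).

Definition is_Xma n (m a : nat) (P : set 'rV[rat]_n) : Prop :=
  is_wps_of (fun i => lam n m a i) P.

(** * The graph of mutations starting at X_n *)

(* P represents a vertex of the graph. *)
Inductive reachable n : set 'rV[rat]_n -> Prop :=
| reachable_X P : is_X P -> reachable P
| reachable_mut P Q :
    reachable P -> is_wps Q -> nontrivial_mutation P Q -> reachable Q.

(* The tree with a root [None] and, for each a in {0, ..., n - 2}, an infinite
   branch None - Some (a, 0) - Some (a, 1) - ... ; the node [Some (a, m)]
   carries X_n^(m+1,a). *)
Definition node (n : nat) : Type := option ('I_n.-1 * nat).

Definition tree_adj n (x y : node n) : bool :=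
  match x, y with
  | None, Some (_, m) | Some (_, m), None => m == 0%N
  | Some (a, m), Some (b, k) => (a == b) && ((k == m.+1) || (m == k.+1))
  | None, None => false
  end.

Definition node_space n (x : node n) (P : set 'rV[rat]_n) : Prop :=
  if x is Some (a, m) then is_Xma m.+1 a P else is_X P.

(* Labelling embeds the graph of mutations, as a subgraph, in the tree above.
   It is connected and contains the root by construction, hence a subtree. *)
Definition mutation_graph_is_subtree (n : nat) : Prop :=
  [/\ forall P : set 'rV[rat]_n, reachable P -> exists! x, node_space x P,
      forall (x : node n) P Q,
        node_space x P -> node_space x Q -> poly_iso P Q
    & forall (x y : node n) P Q, reachable P -> reachable Q ->
        node_space x P -> node_space y Q ->
        nontrivial_mutation P Q -> tree_adj x y].

(* Main.v *)
(* Let P = conv(v_0, ..., v_n) be a simplex with weights k and R its mutation with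
   respect to w and F. A functional u exposing a vertex v_t of P, and minimal on F at
   f only, gives the exposed point v_t + w(v_t) f of R. A vertex v_i of negative height
   lies in a translate of |w(v_i)| F contained in P, and so picks out a vertex f_i of F.
   If all f_i are equal, then F is a point and R is a shear of P. Otherwise the v_i of
   negative height lie at one height - h, F is homothetic to the face they span, and
   since R has only n + 1 vertices, that face is contracted to a point and there is a
   single vertex v_z of positive height h'. Divisibility of
   v_i - v_j by h in the lattice N, which is generated by the vertices of P, and by
   those of R, forces h = h' = 1 (and R isomorphic to P) when the face has three or
   more vertices; for an edge {i, j} it yields the weight formula
   k_z -> (k_i + k_j)^2 / k_z.

   With L = 2 t_(n-1) / y_a and x_0 = x_1 = 1, x_(m+2) = (L + 2) x_(m+1) - x_m, the
   weights of X_n^(m,a) are x_m^2, L, x_(m+1)^2 and x_m x_(m+1) 2 t_(n-1) / y_k for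
   k <> a, with x_m^2 + x_(m+1)^2 + L = (L + 2) x_m x_(m+1). Parity and divisibility
   leave only the mutations with {i, j} and z among the first three indices. The
   sum of the weights is 2 t_(n-1) x_m x_(m+1): for X_n every weight divides it, and
   for m >= 1 the cone opposite to the vertex of weight x_(m+1)^2 contains a lattice
   point that is too low. *)

From mathcomp Require Import all_boot all_order all_algebra fingroup perm.
From mathcomp Require Import boolp classical_sets.
From mathcomp Require Import ring lra zify.
(* After boolp, which has a notation [canonical] as well. *)
Require Import Defs.

Set Implicit Arguments.
Unset Strict Implicit.
Unset Printing Implicit Defensive.

Import Order.TTheory GRing.Theory Num.Theory.
Local Open Scope classical_set_scope.
Local Open Scope ring_scope.

(** * Convex hulls and barycentric coordinates *)

(** [R] is a hull of slices whose lattice points are never listed. It is accessible only through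
    functionals: a point of a hull exposed by one belongs to every generating set ([exposed_mem]),
    so counting distinct exposed points of [R] against n + 1 labels replaces any description of its
    faces. N is used only through relations. The weights generate all integral relations between the
    v_l; hence if v_i - v_j = h g with g in N, expanding g in the vertices gives a multiple of the
    weights, and reduction modulo h shows that h divides every weight except possibly k_i and k_j.
    In a face with three vertices every index is avoided by some pair, and coprimality of the
    weights gives h = 1. The bound n >= 4 ensures that no 2 t_(n-1) / y_k divides 4. Otherwise a
    vertex of even weight may be mutated against the edge of the two odd weights: for n = 3 the
    weight formula permits (1, 1, 4, 6) -> (1, 1, 1, 3). *)

Lemma evD n (u : 'cV[rat]_n) x y : ev u (x + y) = ev u x + ev u y.
Proof. by rewrite /ev mulmxDl mxE. Qed.

Lemma evB n (u : 'cV[rat]_n) x y : ev u (x - y) = ev u x - ev u y.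
Proof. by rewrite /ev mulmxBl !mxE. Qed.

Lemma evZ n (u : 'cV[rat]_n) c x : ev u (c *: x) = c * ev u x.
Proof. by rewrite /ev -scalemxAl mxE. Qed.

Lemma ev0 n (u : 'cV[rat]_n) : ev u 0 = 0.
Proof. by rewrite /ev mul0mx mxE. Qed.

Lemma ev_sum n (u : 'cV[rat]_n) I (r : seq I) (p : pred I) (F : I -> 'rV_n) :
  ev u (\sum_(i <- r | p i) F i) = \sum_(i <- r | p i) ev u (F i).
Proof. by rewrite /ev mulmx_suml summxE. Qed.

Lemma evDl n (u w : 'cV[rat]_n) x : ev (u + w) x = ev u x + ev w x.
Proof. by rewrite /ev mulmxDr mxE. Qed.

Lemma evBl n (u w : 'cV[rat]_n) x : ev (u - w) x = ev u x - ev w x.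
Proof. by rewrite /ev mulmxBr !mxE. Qed.

Lemma evZl n (u : 'cV[rat]_n) c x : ev (c *: u) x = c * ev u x.
Proof. by rewrite /ev -scalemxAr mxE. Qed.

Lemma ev_suml n I (r : seq I) (p : pred I) (F : I -> 'cV_n) (x : 'rV[rat]_n) :
  ev (\sum_(i <- r | p i) F i) x = \sum_(i <- r | p i) ev (F i) x.
Proof. by rewrite /ev mulmx_sumr summxE. Qed.

Lemma toQ_inj m n : injective (@toQ m n).
Proof.
move=> A B /matrixP eqAB; apply/matrixP => i j.
by have := eqAB i j; rewrite !mxE => /intr_inj.
Qed.

Lemma toQM m n p (A : 'M_(m, n)) (B : 'M_(n, p)) : toQ (A *m B) = toQ A *m toQ B.
Proof. exact: map_mxM. Qed.

Lemma toQD m n (A B : 'M_(m, n)) : toQ (A + B) = toQ A + toQ B.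
Proof. exact: map_mxD. Qed.

Lemma toQB m n (A B : 'M_(m, n)) : toQ (A - B) = toQ A - toQ B.
Proof. exact: map_mxB. Qed.

Lemma toQ0 m n : toQ (0 : 'M_(m, n)) = 0.
Proof. exact: map_mx0. Qed.

Lemma toQZ m n c (A : 'M_(m, n)) : toQ (c *: A) = c%:~R *: toQ A.
Proof. exact: map_mxZ. Qed.

Lemma toQ_sum m n I (r : seq I) (p : pred I) (F : I -> 'M_(m, n)) :
  toQ (\sum_(i <- r | p i) F i) = \sum_(i <- r | p i) toQ (F i).
Proof. exact: raddf_sum. Qed.

Lemma toQMn m n (A : 'M_(m, n)) k : toQ (A *+ k) = k%:R *: toQ A.
Proof. by rewrite scaler_nat; exact: raddfMn. Qed.

Definition lev n (w : 'cV[int]_n) (x : 'rV[int]_n) : int := (x *m w) 0 0.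

Lemma ev_toQ n (w : 'cV[int]_n) x : ev (toQ w) (toQ x) = (lev w x)%:~R.
Proof. by rewrite /ev -toQM mxE. Qed.

Lemma conv_self n (A : set 'rV[rat]_n) x : A x -> conv A x.
Proof.
move=> Ax; exists 1%N, (fun=> x), (fun=> 1).
by split=> //; rewrite big_ord1 // scale1r.
Qed.

(** The excess of the combination over [c] is a sum of non-negative terms, so it vanishes only if
    each term does. *)
Lemma conv_face n (A : set 'rV[rat]_n) u c k (p : 'I_k -> 'rV_n) (a : 'I_k -> rat) :
  (forall y, A y -> c <= ev u y) -> (forall i, A (p i)) -> (forall i, 0 <= a i) ->
  \sum_i a i = 1 ->
  c <= ev u (\sum_i a i *: p i) /\
  (ev u (\sum_i a i *: p i) = c -> forall i, 0 < a i -> ev u (p i) = c).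
Proof.
move=> cu Ap a0 a1.
have E : ev u (\sum_i a i *: p i) - c = \sum_i a i * (ev u (p i) - c).
  rewrite ev_sum -[c in LHS]mulr1 -a1 mulr_sumr -sumrB.
  by apply: eq_bigr => i _; rewrite evZ; ring.
have ge0 i : 0 <= a i * (ev u (p i) - c).
  by rewrite mulr_ge0 // subr_ge0 cu.
split; first by rewrite -subr_ge0 E sumr_ge0.
move=> Ec i ai; have /eqP := E; rewrite Ec subrr eq_sym psumr_eq0 // => /allP/(_ i).
rewrite mem_index_enum => /(_ isT) /=; rewrite mulf_eq0 gt_eqF //= subr_eq0.
by move=> /eqP.
Qed.

Lemma conv_ge n (A : set 'rV[rat]_n) u c x :
  (forall y, A y -> c <= ev u y) -> conv A x -> c <= ev u x.
Proof.
by move=> cu [k [p [a [Ap a0 a1 ->]]]]; case: (conv_face cu Ap a0 a1).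
Qed.

Lemma conv_le n (A : set 'rV[rat]_n) u c x :
  (forall y, A y -> ev u y <= c) -> conv A x -> ev u x <= c.
Proof.
move=> cu Ax; rewrite -lerN2; have -> : - ev u x = ev (-1 *: u) x.
  by rewrite evZl mulN1r.
by apply: conv_ge Ax => y Ay; rewrite evZl mulN1r lerN2 cu.
Qed.

Lemma conv_eq n (A : set 'rV[rat]_n) u c x :
  (forall y, A y -> ev u y = c) -> conv A x -> ev u x = c.
Proof.
move=> uc Ax; apply/le_anti/andP; split.
  by apply: conv_le Ax => y /uc ->.
by apply: conv_ge Ax => y /uc ->.
Qed.

Lemma convex_pos k (a : 'I_k -> rat) :
  (forall i, 0 <= a i) -> \sum_i a i = 1 -> exists i, 0 < a i.
Proof.
move=> a0 a1; apply: contrapT => na.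
suff : \sum_i a i = 0 by rewrite a1 => /eqP; rewrite oner_eq0.
apply: big1 => i _; apply/eqP; rewrite eq_le a0 andbT leNgt.
by apply/negP => ai; apply: na; exists i.
Qed.

(** The point [p] need not lie in [A]; exposedness can thus pass from generators to a hull before
    membership is known. *)
Definition exposes n (u : 'cV[rat]_n) (A : set 'rV[rat]_n) p :=
  forall y, A y -> ev u p <= ev u y /\ (ev u y = ev u p -> y = p).

Lemma exposes_conv n (u : 'cV[rat]_n) A p : exposes u A p -> exposes u (conv A) p.
Proof.
move=> ex y [k [q [a [Aq a0 a1 ->]]]].
have cu z : A z -> ev u p <= ev u z by move=> /ex[].
have [? eqc] := conv_face cu Aq a0 a1; split=> // /eqc {}eqc.
rewrite -[RHS]scale1r -a1 scaler_suml; apply: eq_bigr => i _.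
have [ai|] := ltP 0 (a i); last first.
  by move=> ai; have/eqP -> : a i == 0 by [rewrite eq_le ai a0]; rewrite !scale0r.
by congr (_ *: _); apply: (proj2 (ex _ (Aq i))); apply: eqc.
Qed.

(** In a convex combination equal to [p] some point has a positive coefficient; its value is
    minimal, so it is [p] itself. *)
Lemma exposed_mem n (u : 'cV[rat]_n) A p : exposes u (conv A) p -> conv A p -> A p.
Proof.
move=> ex [k [q [a [Aq a0 a1 pE]]]].
have cu z : A z -> ev u p <= ev u z by move=> Az; have [] := ex z (conv_self Az).
have [_] := conv_face cu Aq a0 a1; rewrite -pE => /(_ erefl) eqc.
have [i ai] := convex_pos a0 a1.
by have [_ /(_ (eqc i ai)) <-] := ex _ (conv_self (Aq i)).
Qed.

Lemma exposed_vert n (u : 'cV[rat]_n) A p : exposes u A p -> A p -> vert A p.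
Proof.
move=> ex Ap; split=> // y z c Ay Az /andP[c0 c1] pE.
have [uy eqy] := ex _ Ay; have [uz eqz] := ex _ Az.
have : ev u p = c * ev u y + (1 - c) * ev u z by rewrite {1}pE evD !evZ.
by move=> E; split; [apply: eqy | apply: eqz]; nra.
Qed.

(** * Labelled simplices and the weight relation *)

Definition wvec n (v : 'I_n.+1 -> 'rV[int]_n) (k : 'I_n.+1 -> nat) : Prop :=
  [/\ forall i, (0 < k i)%N, \big[gcdn/0%N]_i k i = 1%N, \sum_i (v i *+ k i) = 0
    & forall x : 'rV[int]_n, exists c : 'I_n.+1 -> int, x = \sum_i c i *: v i].

Definition simplex n (v : 'I_n.+1 -> 'rV[int]_n) : set 'rV[rat]_n :=
  conv (range (fun i => toQ (v i))).

Lemma is_wps_ofP n l (P : set 'rV[rat]_n) :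
  is_wps_of l P <-> fano P /\ exists v k,
    [/\ P = simplex v, wvec v k & forall i, l i = (k i)%:R].
Proof.
split=> [[fP [v [k [PE lk [k0 k1] vk gv]]]]|[fP [v [k [PE [k0 k1 vk gv] lk]]]]].
  by split=> //; exists v, k.
by split=> //; exists v, k.
Qed.

Section Frame.
Variables (n : nat) (v : 'I_n.+1 -> 'rV[int]_n) (k : 'I_n.+1 -> nat).
Hypothesis vk : wvec v k.

(** Barycentric coordinates of the origin. *)
Definition eps (i : 'I_n.+1) : rat := (k i)%:R / (\sum_j k j)%:R.

Lemma wsum_gt0 : 0 < (\sum_j k j)%:R :> rat.
Proof.
case: vk => k0 _ _ _; rewrite ltr0n (bigD1 ord0) //=.
by rewrite ltn_addr.
Qed.

Lemma eps_gt0 i : 0 < eps i.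
Proof. by case: vk => k0 _ _ _; rewrite divr_gt0 ?wsum_gt0 // ltr0n. Qed.

Lemma sum_eps : \sum_i eps i = 1.
Proof. by rewrite -mulr_suml -natr_sum divff // gt_eqF // wsum_gt0. Qed.

Lemma sum_wvec : \sum_i (k i)%:R *: toQ (v i) = 0.
Proof.
case: vk => _ _ vk0 _; transitivity (toQ (\sum_i (v i *+ k i))).
  by rewrite toQ_sum; apply: eq_bigr => i _; rewrite toQMn.
by rewrite vk0 toQ0.
Qed.

Lemma sum_eps_v : \sum_i eps i *: toQ (v i) = 0.
Proof.
transitivity ((\sum_j k j)%:R^-1 *: \sum_i (k i)%:R *: toQ (v i)).
  by rewrite scaler_sumr; apply: eq_bigr => i _; rewrite scalerA mulrC.
by rewrite sum_wvec scaler0.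
Qed.

(** Since the vertices generate N, the map from Z^(n+1) to N has an integral section [C]. *)
Lemma wvec_coord : exists C : 'M[int]_(n, n.+1), C *m (\matrix_i v i) = 1%:M.
Proof.
case: vk => _ _ _ gv.
have [c cE] := fin_all_exists (fun j => gv (delta_mx 0 j)).
exists (\matrix_(j, i) c j i); apply/row_matrixP => j.
rewrite row_mul row1 cE mulmx_sum_row; apply: eq_bigr => i _.
by rewrite !mxE rowK.
Qed.

(** The section forces rank n, so the rational relations form a line, spanned by the weights. *)
Lemma wvec_rel (r : 'I_n.+1 -> rat) :
  \sum_i r i *: toQ (v i) = 0 -> exists q, forall i, r i = q * (k i)%:R.
Proof.
move=> r0; pose V := toQ (\matrix_i v i).
have relE (s : 'I_n.+1 -> rat) : (\row_i s i) *m V = \sum_i s i *: toQ (v i).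
  rewrite mulmx_sum_row; apply: eq_bigr => i _.
  by rewrite mxE -map_row rowK.
pose kv : 'rV[rat]_n.+1 := \row_i (k i)%:R.
have kvk : (kv <= kermx V)%MS by apply/sub_kermxP; rewrite relE sum_wvec.
have kv0 : kv != 0.
  apply/eqP => /rowP/(_ ord0); rewrite !mxE => /eqP; rewrite pnatr_eq0.
  by case: vk => /(_ ord0); case: (k ord0).
have rV : \rank V = n.
  apply/eqP; rewrite eqn_leq rank_leq_col /=.
  have [C /(congr1 (@toQ _ _))] := wvec_coord; rewrite toQM -/V => CV.
  rewrite -{1}(mxrank1 rat n) -(map_mx1 (intr : int -> rat)) -[map_mx _ _]/(toQ _).
  by rewrite -CV mxrankM_maxr.
have kerkv : (kermx V <= kv)%MS.
  by rewrite -(mxrank_leqif_sup kvk) mxrank_ker rV rank_rV kv0 subSnn.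
have /sub_rVP[q rE] : (\row_i r i <= kv)%MS.
  by apply: submx_trans kerkv; apply/sub_kermxP; rewrite relE.
exists q => i; have /rowP/(_ i) := rE.
by rewrite !mxE.
Qed.

(* [ev (b m) x + eps m] is the m-th barycentric coordinate of [x]. *)
Lemma wvec_frame : exists b : 'I_n.+1 -> 'cV[rat]_n,
  [/\ \sum_m b m = 0, forall x, x = \sum_m ev (b m) x *: toQ (v m)
    & forall m l, ev (b m) (toQ (v l)) = (m == l)%:R - eps m].
Proof.
have [C CV] := wvec_coord.
(* Coordinates read off from a section are determined only up to multiples of the weights; this
   multiple of [eps] normalises their sum to 0. *)
pose b m : 'cV[rat]_n := col m (toQ C) - eps m *: (\sum_j col j (toQ C)).
have b0 : \sum_m b m = 0.
  by rewrite sumrB -scaler_suml sum_eps scale1r subrr.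
have bE x : x = \sum_m ev (b m) x *: toQ (v m).
  have -> : \sum_m ev (b m) x *: toQ (v m) =
     \sum_m ev (col m (toQ C)) x *: toQ (v m)
     - ev (\sum_j col j (toQ C)) x *: \sum_m eps m *: toQ (v m).
    rewrite scaler_sumr -sumrB; apply: eq_bigr => m _.
    by rewrite evBl evZl scalerBl scalerA mulrC.
  rewrite sum_eps_v scaler0 subr0 -{1}[x]mulmx1 -(map_mx1 (intr : int -> rat)).
  rewrite -[map_mx _ _]/(toQ _) -CV toQM mulmxA mulmx_sum_row.
  apply: eq_bigr => m _; rewrite -map_row rowK; congr (_ *: _).
  by rewrite /ev colE mulmxA -colE [RHS]mxE.
exists b; split=> // m l.
have /wvec_rel[q qE] : \sum_m (ev (b m) (toQ (v l)) - (m == l)%:R) *: toQ (v m) = 0.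
  under eq_bigr do rewrite scalerBl.
  rewrite sumrB -bE (bigD1 l) //= eqxx scale1r big1 ?addr0 ?subrr // => i /negPf ->.
  by rewrite scale0r.
have sq : -1 = q * (\sum_j k j)%:R.
  rewrite natr_sum mulr_sumr; under eq_bigr do rewrite -qE.
  rewrite sumrB -ev_suml b0 /ev mulmx0 mxE (bigD1 l) //= eqxx big1 => [|i /negPf->//].
  by rewrite addr0 sub0r.
have -> : ev (b m) (toQ (v l)) = (m == l)%:R + q * (k m)%:R.
  by rewrite -qE addrC subrK.
congr (_ + _); rewrite /eps -[- _]mulN1r sq.
by have := wsum_gt0 => ?; field; rewrite gt_eqF.
Qed.

End Frame.

Section Simplex.
Variables (n : nat) (v : 'I_n.+1 -> 'rV[int]_n) (k : 'I_n.+1 -> nat).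
Hypothesis vk : wvec v k.
Variable b : 'I_n.+1 -> 'cV[rat]_n.
Hypothesis b0 : \sum_m b m = 0.
Hypothesis bE : forall x, x = \sum_m ev (b m) x *: toQ (v m).
Hypothesis bv : forall m l, ev (b m) (toQ (v l)) = (m == l)%:R - eps k m.

Lemma sum_frame x : \sum_m ev (b m) x = 0.
Proof. by rewrite -ev_suml b0 /ev mulmx0 mxE. Qed.

Lemma frame_inj x y : (forall m, ev (b m) x = ev (b m) y) -> x = y.
Proof. by move=> xy; rewrite [x]bE [y]bE; apply: eq_bigr => m _; rewrite xy. Qed.

Lemma frame_inj1 i x y : (forall m, m != i -> ev (b m) x = ev (b m) y) -> x = y.
Proof.
move=> xy; apply: frame_inj => m; have [->|/xy//] := eqVneq m i.
have := etrans (sum_frame x) (esym (sum_frame y)).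
by rewrite (bigD1 i) //= [RHS](bigD1 i) //= (eq_bigr _ xy) => /addIr.
Qed.

Lemma frame_comb (c : 'I_n.+1 -> rat) x :
  x = \sum_m c m *: toQ (v m) -> forall m, ev (b m) x = c m - (\sum_l c l) * eps k m.
Proof.
move=> -> m; rewrite ev_sum mulr_suml; under eq_bigr do rewrite evZ bv mulrBr.
rewrite sumrB; congr (_ - _); rewrite (bigD1 m) //= eqxx mulr1 big1 ?addr0 //.
by move=> i; rewrite eq_sym => /negPf ->; rewrite mulr0.
Qed.

Lemma simplexP x : simplex v x <-> forall m, - eps k m <= ev (b m) x.
Proof.
split=> [Px m|bx].
  apply: conv_ge Px => _ [l _ <-]; rewrite bv.
  by have := ler0n rat (m == l); have := eps_gt0 vk m; lra.
exists n.+1, (fun i => toQ (v i)), (fun i => ev (b i) x + eps k i); split.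
- by move=> i; exists i.
- by move=> i; have := bx i; lra.
- by rewrite big_split /= sum_frame (sum_eps vk) add0r.
by under eq_bigr do rewrite scalerDl; rewrite big_split /= -bE (sum_eps_v vk) addr0.
Qed.

Lemma ev_comb (c : 'I_n.+1 -> rat) l :
  ev (\sum_m c m *: b m) (toQ (v l)) = c l - \sum_m c m * eps k m.
Proof.
rewrite ev_suml; under eq_bigr do rewrite evZl bv mulrBr.
rewrite sumrB; congr (_ - _); rewrite (bigD1 l) //= eqxx mulr1 big1 ?addr0 //.
by move=> i /negPf ->; rewrite mulr0.
Qed.

Lemma simplex_exposes (c : 'I_n.+1 -> rat) t : (forall m, m != t -> c t < c m) ->
  exposes (\sum_m c m *: b m) (simplex v) (toQ (v t)).
Proof.
move=> ct; apply: exposes_conv => _ [l _ <-]; rewrite !ev_comb.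
have [->|lt] := eqVneq l t; first by split.
by have := ct l lt; split; [lra | move=> E; exfalso; lra].
Qed.

End Simplex.

Lemma simplex_self n (v : 'I_n.+1 -> 'rV[int]_n) t : simplex v (toQ (v t)).
Proof. by apply: conv_self; exists t. Qed.

Lemma simplex_exposed n (v : 'I_n.+1 -> 'rV[int]_n) k t : wvec v k ->
  exists u, exposes u (simplex v) (toQ (v t)).
Proof.
move=> vk; have [b [b0 bE bv]] := wvec_frame vk.
exists (\sum_m (m != t)%:R *: b m).
apply: (simplex_exposes bv) => m mt; by rewrite eqxx mt.
Qed.

Lemma vert_simplex n (v : 'I_n.+1 -> 'rV[int]_n) k t : wvec v k ->
  vert (simplex v) (toQ (v t)).
Proof.
move=> /simplex_exposed-/(_ t)[u ex].
by apply: exposed_vert ex _; apply: simplex_self.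
Qed.

Lemma wvec_inj n (v : 'I_n.+1 -> 'rV[int]_n) k : wvec v k -> injective v.
Proof.
move=> vk i j vij; have [b [_ _ bv]] := wvec_frame vk.
have : (i == j)%:R = 1 :> rat by apply: (addIr (- eps k i)); rewrite -bv -vij bv eqxx.
by have [//|_ /eqP] := eqVneq i j; rewrite eq_sym oner_eq0.
Qed.

(** The denominator of [q] divides every [k i], hence their gcd. *)
Lemma coprime_int_scale n (k : 'I_n -> nat) (q : rat) :
  \big[gcdn/0%N]_i k i = 1%N -> (forall i, q * (k i)%:R \is a Num.int) ->
  q \is a Num.int.
Proof.
move=> k1 qk; rewrite Qint_def; have : (`|denq q| %| \big[gcdn/0]_i k i)%N.
  apply/dvdn_biggcdP => i _; have /intrP[z zE] := qk i.
  have qz : (numq q * (k i)%:Z = z * denq q)%R.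
    apply: (@intr_inj rat); rewrite !intrM -zE -{2}(divq_num_den q).
    by have := denq_neq0 q; rewrite -(intr_eq0 rat) => ?; field.
  have : (denq q %| numq q * (k i)%:Z)%Z by rewrite qz dvdz_mull.
  rewrite Gauss_dvdzr; first by rewrite /dvdz.
  by rewrite coprimez_sym; exact: coprime_num_den.
rewrite k1 dvdn1 => /eqP dq.
by rewrite -[denq q]gez0_abs ?denq_ge0 // dq.
Qed.

Lemma coprime_scale1 n (k l : 'I_n -> nat) (q : rat) :
  \big[gcdn/0%N]_i k i = 1%N -> \big[gcdn/0%N]_i l i = 1%N ->
  0 < q -> (forall i, q * (k i)%:R \is a Num.int) ->
  (forall i, q^-1 * (l i)%:R \is a Num.int) -> q = 1.
Proof.
have int_ge1 x : 0 < x -> (x : rat) \is a Num.int -> 1 <= x.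
  by move=> + /intrP[z zE]; rewrite zE ltr0z ler1z.
move=> k1 l1 q0 /(coprime_int_scale k1) qi /(coprime_int_scale l1) qVi.
have q1 := int_ge1 _ q0 qi; have := int_ge1 _ _ qVi; rewrite invr_gt0 => /(_ q0).
by rewrite invf_ge1 // => q1'; apply/le_anti; rewrite q1 q1'.
Qed.

(** * Weights determine the simplex *)

(** By coprimality the weights generate the integral relations, not only the rational line. *)
Lemma wvec_relz n (v : 'I_n.+1 -> 'rV[int]_n) k (r : 'I_n.+1 -> int) : wvec v k ->
  \sum_i r i *: v i = 0 -> exists t : int, forall i, r i = t * (k i)%:Z.
Proof.
move=> vk r0; have [q qE] : exists q : rat, forall i, (r i)%:~R = q * (k i)%:R.
  apply: (wvec_rel vk); transitivity (toQ (\sum_i r i *: v i)); last by rewrite r0 toQ0.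
  by rewrite toQ_sum; apply: eq_bigr => i _; rewrite toQZ.
have /intrP[t tE] : q \is a Num.int.
  by case: vk => _ k1 _ _; apply: (coprime_int_scale k1) => i; rewrite -qE intr_int.
by exists t => i; apply: (@intr_inj rat); rewrite qE tE intrM.
Qed.

Lemma wvec_weights n (v : 'I_n.+1 -> 'rV[int]_n) k k' : wvec v k -> wvec v k' -> k =1 k'.
Proof.
move=> vk vk'; have [k0 k1 _ _] := vk; have [k0' k1' _ _] := vk'.
have [q qE] := wvec_rel vk (sum_wvec vk').
have q0 : 0 < q.
  by have := qE ord0; have := k0 ord0; have := k0' ord0; rewrite -!(ltr0n rat); nra.
have q1 : q = 1.
  apply: (coprime_scale1 k1 k1' q0) => i; first by rewrite -qE natr_int.
  by rewrite qE mulKf ?gt_eqF // natr_int.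
by move=> i; apply/eqP; rewrite -(eqr_nat rat) qE q1 mul1r.
Qed.

Lemma simplex_perm n (v : 'I_n.+1 -> 'rV[int]_n) (s : 'S_n.+1) :
  simplex (v \o s) = simplex v.
Proof.
congr conv; apply/seteqP; split=> [_ [i _ <-]|_ [i _ <-]]; first by exists (s i).
by exists (s^-1%g i) => //=; rewrite permKV.
Qed.

Lemma wvec_perm n (v : 'I_n.+1 -> 'rV[int]_n) k (s : 'S_n.+1) :
  wvec v k -> wvec (v \o s) (k \o s).
Proof.
case=> k0 k1 vk gv; split=> [i /=|||x]; first exact: k0.
- by rewrite -[RHS]k1 [RHS](reindex_inj (@perm_inj _ s)).
- by rewrite -[RHS]vk [RHS](reindex_inj (@perm_inj _ s)).
have [c ->] := gv x; exists (c \o s).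
by rewrite [LHS](reindex_inj (@perm_inj _ s)).
Qed.

Lemma label_perm m n (r : 'I_m -> 'rV[int]_n) (p : 'I_m -> 'rV[rat]_n) :
  injective p -> (forall t, range (fun i => toQ (r i)) (p t)) ->
  exists s : 'S_m, forall t, p t = toQ (r (s t)).
Proof.
move=> p_inj pr; have [s sE] : exists s, forall t, toQ (r (s t)) = p t.
  by apply: (@fin_all_exists _ _ (fun t i => toQ (r i) = p t)) => t; have [i] := pr t; exists i.
have s_inj : injective s by move=> i j sij; apply: p_inj; rewrite -!sE sij.
by exists (perm s_inj) => t; rewrite permE sE.
Qed.

Lemma simplex_weights n (v v' : 'I_n.+1 -> 'rV[int]_n) k k' :
  wvec v k -> wvec v' k' -> simplex v = simplex v' ->
  exists s : 'S_n.+1, forall i, k' i = k (s i).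
Proof.
move=> vk vk' vv'; have [s sE] : exists s : 'S_n.+1, forall t, toQ (v' t) = toQ (v (s t)).
  apply: label_perm => [i j /toQ_inj/(wvec_inj vk')//|t].
  have [u ex] := simplex_exposed t vk'; apply: exposed_mem.
    by rewrite -[conv _]/(simplex v) vv'; exact: ex.
  by rewrite -[conv _]/(simplex v) vv'; exact: simplex_self.
exists s; apply: (wvec_weights vk'); have := wvec_perm s vk.
suff -> : v' = v \o s by [].
by apply/funext => t; apply: toQ_inj; rewrite sE.
Qed.

(** The map expands a vector by the section of [v] and substitutes [v']. The expansion of v_i
    differs from the i-th unit vector by a multiple of the weights, and [v'] satisfies the same
    weight relation. *)
Lemma wvec_iso n (v v' : 'I_n.+1 -> 'rV[int]_n) k : wvec v k -> wvec v' k ->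
  exists2 A : 'M[int]_n, A \in unitmx & forall i, v' i = v i *m A.
Proof.
move=> vk vk'; have [C CV] := wvec_coord vk; have [C' CV'] := wvec_coord vk'.
have relE (x : 'I_n.+1 -> 'rV[int]_n) (r : 'rV_n.+1) :
    r *m (\matrix_i x i) = \sum_i r 0 i *: x i.
  by rewrite mulmx_sum_row; apply: eq_bigr => i _; rewrite rowK.
have rel x y i (D : 'M_(n, n.+1)) : wvec x k -> wvec y k -> D *m (\matrix_i x i) = 1%:M ->
    y i = x i *m (D *m (\matrix_i y i)).
  move=> xk yk DX; have [t tE] : exists t : int,
      forall j, (x i *m D - delta_mx 0 i) 0 j = t * (k j)%:Z.
    apply: (wvec_relz xk); rewrite -relE mulmxBl -mulmxA DX mulmx1.
    by rewrite -rowE rowK subrr.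
  apply/esym/eqP; rewrite mulmxA -subr_eq0; have <- : row i (\matrix_i y i) = y i by rewrite rowK.
  rewrite rowE -mulmxBl relE; under eq_bigr do rewrite tE -scalerA.
  case: yk => _ _ yk _; rewrite -scaler_sumr -[X in _ *: X]/(\sum_j _).
  by under eq_bigr do rewrite -natz scaler_nat; rewrite yk scaler0.
have inv x y D E : wvec x k -> wvec y k -> D *m (\matrix_i x i) = 1%:M ->
    E *m (\matrix_i y i) = 1%:M ->
    (D *m \matrix_i y i) *m (E *m \matrix_i x i) = 1%:M.
  move=> xk yk DX EY; rewrite -mulmxA -[in RHS]DX; congr (_ *m _).
  apply/row_matrixP => i; rewrite row_mul !rowK; exact/esym/rel.
exists (C *m \matrix_i v' i); last by move=> i; apply: rel.
by have /mulmx1_unit[] := inv _ _ _ _ vk vk' CV CV'.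
Qed.

Lemma simplex_mul n (v : 'I_n.+1 -> 'rV[int]_n) (A : 'M[int]_n) :
  [set x *m toQ A | x in simplex v] = simplex (fun i => v i *m A).
Proof.
apply/seteqP; split=> [_ [_ [k [p [c [pv c0 c1 ->]]]] <-]|_ [k [p [c [pv c0 c1 ->]]]]].
  exists k, (fun i => p i *m toQ A), c; split=> // [i|].
    by have [j _ <-] := pv i; exists j => //; rewrite toQM.
  by rewrite mulmx_suml; apply: eq_bigr => i _; rewrite scalemxAl.
have [j jE] : exists j, forall i, toQ (v (j i) *m A) = p i.
  apply: (@fin_all_exists _ _ (fun i j => toQ (v j *m A) = p i)) => i.
  by have [j] := pv i; exists j.
exists (\sum_i c i *: toQ (v (j i))).
  by exists k, (fun i => toQ (v (j i))), c; split=> // i; exists (j i).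
by rewrite mulmx_suml; apply: eq_bigr => i _; rewrite -scalemxAl -toQM jE.
Qed.

Lemma wvec_mul n (v : 'I_n.+1 -> 'rV[int]_n) k (A : 'M[int]_n) :
  wvec v k -> A \in unitmx -> wvec (fun i => v i *m A) k.
Proof.
case=> k0 k1 vk gv uA; split=> // [|x].
  under eq_bigr do rewrite -scaler_nat scalemxAl scaler_nat.
  by rewrite -mulmx_suml vk mul0mx.
have [c cE] := gv (x *m invmx A); exists c; rewrite -[LHS](mulmxKV uA) cE mulmx_suml.
by apply: eq_bigr => i _; rewrite scalemxAl.
Qed.

Lemma simplex_iso n (v v' : 'I_n.+1 -> 'rV[int]_n) k :
  wvec v k -> wvec v' k -> poly_iso (simplex v) (simplex v').
Proof.
move=> vk vk'; have [A uA vA] := wvec_iso vk vk'; exists A => //.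
by rewrite simplex_mul; congr simplex; apply/funext.
Qed.

Lemma vert_simplex_label n (v : 'I_n.+1 -> 'rV[int]_n) k x :
  wvec v k -> vert (simplex v) x -> exists i, x = toQ (v i).
Proof.
move=> vk [Px xv]; have [b [b0 bE bv]] := wvec_frame vk.
pose be m : rat := ev (b m) x + eps k m.
have be0 m : 0 <= be m by have := (simplexP vk b0 bE bv x).1 Px m; rewrite /be; lra.
have be1 : \sum_m be m = 1 by rewrite big_split /= (sum_frame b0) (sum_eps vk) add0r.
have [m bem] := convex_pos be0 be1; exists m; apply/esym.
(* If [be m] is positive, x lies strictly between v_m and the point reached by going on from v_m
   through x by the factor [be m]. That point is still in the simplex: its m-th barycentric
   coordinate is the square of [be m]. *)
have [||||_] := xv (x + be m *: (x - toQ (v m))) (toQ (v m)) (1 + be m)^-1 => //.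
- apply/(simplexP vk b0 bE bv) => l; rewrite evD evZ evB bv.
  have := be0 l; have := be0 m; rewrite -/(be l).
  have : ev (b l) x = be l - eps k l by rewrite /be addrK.
  by move=> ->; case: eqVneq => [->|_] /=; nra.
- exact: simplex_self.
- by rewrite invr_gt0 invf_lt1; lra.
apply: (frame_inj bE) => l; rewrite evD !evZ evD evZ evB.
by field; rewrite gt_eqF // addr_gt0.
Qed.

(** N is Z^(n+1) modulo the weight vector, and the Smith form of the weight row supplies an adapted
    basis. The coprime pair away from i makes v_i primitive: if v_i = c B, then c divides t k_j and
    t k_l for some t with t k_i congruent to 1 modulo c, so c divides t and then 1. *)
Lemma wps_exists n (k : 'I_n.+1 -> nat) : (forall i, 0 < k i)%N ->
  (forall i, exists j l, [/\ j != i, l != i & coprime (k j) (k l)]) ->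
  exists2 v, wvec v k & fano (simplex v).
Proof.
move=> k0 kc; pose kv : 'M[int]_(1, 1 + n) := \row_i (k i)%:Z.
have [L _ [R uR [d _ kvE]]] := int_Smith_normal_form kv.
have kR : exists c, kv *m invmx R = c *: delta_mx 0 0.
  exists (L 0 0 * d`_0); apply/rowP => j; rewrite kvE mulmxK // !mxE big_ord1 !mxE -mulrA.
  by congr (_ * _); case: j => [[|j] lj]; rewrite ?mulr1 ?mulr0.
pose V : 'M[int]_(1 + n, n) := rsubmx (invmx R).
pose v (i : 'I_n.+1) : 'rV[int]_n := row i V.
have relE (r : 'rV_n.+1) : \sum_i r 0 i *: v i = r *m V by rewrite mulmx_sum_row.
have vk : wvec v k.
  split=> //.
  - apply/eqP; rewrite -dvdn1; have [j [l [_ _ /eqP <-]]] := kc ord0.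
    by rewrite dvdn_gcd !(dvdn_biggcdP _ _ _ (dvdnn _)).
  - transitivity (kv *m V).
      by rewrite -relE; apply: eq_bigr => i _; rewrite mxE -natz scaler_nat.
    have [c cE] := kR; rewrite /V mulmx_rsub cE; apply/rowP => j; rewrite !mxE.
    by rewrite mulr0.
  - move=> x; exists (fun i => (row_mx 0 x *m R) 0 i).
    by rewrite relE /V mulmx_rsub mulmxK // row_mxKr.
exists v => //; split.
- exists [seq v i | i <- enum 'I_n.+1]; congr conv; apply/seteqP; split.
    by move=> _ [i _ <-]; exists (v i) => //=; apply/mapP; exists i; rewrite ?mem_enum.
  by move=> _ [_ /= /mapP[i _ ->] <-]; exists i.
- have [b [b0 bE bv]] := wvec_frame vk.
  pose D := 1 + \sum_m \sum_j `|b m j 0|.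
  have sum0 m : 0 <= \sum_j `|b m j 0| by rewrite sumr_ge0.
  have D0 : 0 < D by rewrite ltr_pwDl // sumr_ge0.
  have K0 := wsum_gt0 vk.
  (* [D] bounds the entries of all [b m], so on this box each |ev (b m) y| is at most the reciprocal
     of the sum of the weights; as weights are at least 1, this is at most [eps k m]. *)
  exists ((\sum_j k j)%:R * D)^-1 => [|y yx]; first by rewrite invr_gt0 mulr_gt0.
  apply/(simplexP vk b0 bE bv) => m.
  suff : `|ev (b m) y| <= eps k m by rewrite ler_norml => /andP[].
  apply: (@le_trans _ _ (((\sum_j k j)%:R * D)^-1 * D)); last first.
    rewrite invfM mulfVK ?gt_eqF // -[X in X <= _]mul1r ler_pM2r ?invr_gt0 //.
    by rewrite ler1n.
  rewrite /ev mxE; apply: le_trans (ler_norm_sum _ _ _) _.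
  apply: (@le_trans _ _ (\sum_j ((\sum_j k j)%:R * D)^-1 * `|b m j 0|)).
    apply: ler_sum => j _; rewrite normrM ler_wpM2r //.
    by have := yx j; rewrite mxE subr0 => /ltW.
  rewrite -mulr_sumr ler_wpM2l ?invr_ge0 ?mulr_ge0 ?ltW //.
  rewrite /D (bigD1 m) //= addrCA ltrDl ltr_pwDl // sumr_ge0 // => i _; exact: sum0.
- move=> u /(vert_simplex_label vk)[i /toQ_inj ->] c B vE.
  have [j [l [ji li jl]]] := kc i; have [_ _ _ /(_ B)[x xE]] := vk.
  have [t tE] : exists t : int, forall m, (m == i)%:R - c * x m = t * (k m)%:Z.
    apply: (wvec_relz vk); under eq_bigr do rewrite scalerBl -scalerA.
    rewrite sumrB -scaler_sumr -xE -vE (bigD1 i) //= eqxx scale1r big1 ?addr0 ?subrr //.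
    by move=> m /negPf ->; rewrite scale0r.
  have cd m : m != i -> (`|c| %| `|t| * k m)%N.
    move=> mi; have := tE m; rewrite (negPf mi) sub0r => /(congr1 absz).
    by rewrite !abszM absz_nat abszN abszM => <-; rewrite dvdn_mulr.
  have ct : (`|c| %| `|t|)%N.
    by rewrite -(muln1 `|t|%N) -(eqP jl) muln_gcdr dvdn_gcd !cd.
  have E : t * (k i)%:Z + c * x i = 1 by rewrite -tE eqxx subrK.
  have : (c %| t * (k i)%:Z + c * x i)%Z by rewrite rpredD ?dvdz_mulr ?dvdzz.
  by rewrite E dvdz1 => /eqP cE; rewrite -abszE cE.
Qed.

(** * Mutations of a simplex *)

Lemma conv_mono n (A B : set 'rV[rat]_n) : A `<=` B -> conv A `<=` conv B.
Proof.
move=> AB _ [k [p [c [Ap c0 c1 ->]]]]; exists k, p, c; split=> // i.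
exact: AB.
Qed.

Lemma simplex_convex n (v : 'I_n.+1 -> 'rV[int]_n) k : wvec v k ->
  conv (simplex v) `<=` simplex v.
Proof.
move=> vk x Px; have [b [b0 bE bv]] := wvec_frame vk.
apply/(simplexP vk b0 bE bv) => m; apply: conv_ge Px => y.
by move/(simplexP vk b0 bE bv).
Qed.

Lemma poly_iso_sym n (P Q : set 'rV[rat]_n) : poly_iso P Q -> poly_iso Q P.
Proof.
move=> [A uA ->]; exists (invmx A); rewrite ?unitmx_inv //.
have AK : toQ A *m toQ (invmx A) = 1%:M by rewrite -toQM mulmxV // /toQ map_mx1.
apply/seteqP; split=> [x Px|_ [_ [x Px <-] <-]]; last by rewrite -mulmxA AK mulmx1.
by exists (x *m toQ A); [exists x | rewrite -mulmxA AK mulmx1].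
Qed.

Lemma poly_iso_trans n (P Q S : set 'rV[rat]_n) :
  poly_iso P Q -> poly_iso Q S -> poly_iso P S.
Proof.
move=> [A uA ->] [B uB ->]; exists (A *m B); first by rewrite unitmx_mul uA.
apply/seteqP; split=> [_ [_ [x Px <-] <-]|_ [x Px <-]].
  by exists x; rewrite // toQM mulmxA.
by exists (x *m toQ A); [exists x | rewrite toQM mulmxA].
Qed.

(** * Exposed points of a mutation *)

Section Mutation.
Variables (n : nat) (v : 'I_n.+1 -> 'rV[int]_n) (k : 'I_n.+1 -> nat).
Hypothesis vk : wvec v k.
Variable b : 'I_n.+1 -> 'cV[rat]_n.
Hypothesis b0 : \sum_m b m = 0.
Hypothesis bE : forall x, x = \sum_m ev (b m) x *: toQ (v m).
Hypothesis bv : forall m l, ev (b m) (toQ (v l)) = (m == l)%:R - eps k m.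
Variables (w : 'cV[int]_n) (F R : set 'rV[rat]_n) (hmin hmax : rat).
Variable G : int -> set 'rV[rat]_n.
Hypothesis w_prim : primitive w.
Hypothesis hminP : is_hmin w (simplex v) hmin.
Hypothesis hmaxP : is_hmax w (simplex v) hmax.
Hypothesis FG : factor_with w (simplex v) F hmin G.
Hypothesis RE : R = conv
  ([set x | exists h : int, [/\ hmin <= h%:~R, h < 0 & G h x]] `|`
   [set x | exists h : int, [/\ 0 <= h, h%:~R <= hmax &
              msum (slice w h (simplex v)) (dilate h F) x]]).

Notation ht t := (lev w (v t)).
Notation htQ t := ((lev w (v t))%:~R : rat).
Notation vQ t := (toQ (v t)).


(** The integral section recovers [w] from the heights of the vertices, so a common divisor of these
    divides the primitive [w]. *)
Lemma height_dvd (c : int) : (forall i, (c %| ht i)%Z) -> `|c|%N = 1%N.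
Proof.
move=> cw; have [B wB] : exists B, w = c *: B.
  have [C CV] := wvec_coord vk; exists (C *m \col_i (ht i %/ c)%Z).
  rewrite -[LHS]mul1mx -CV -mulmxA scalemxAr; congr (_ *m _).
  apply/colP => i; rewrite !mxE mulrC divzK //.
  by rewrite /lev !mxE; apply: eq_bigr => j _; rewrite !mxE.
by have := w_prim wB; rewrite -abszE => -[].
Qed.

Lemma ev_height x : ev (toQ w) x = \sum_l ev (b l) x * htQ l.
Proof. by rewrite {1}[x]bE ev_sum; apply: eq_bigr => l _; rewrite evZ ev_toQ. Qed.

Lemma sum_eps_height : \sum_l eps k l * htQ l = 0.
Proof.
transitivity (ev (toQ w) (\sum_l eps k l *: vQ l)); last by rewrite (sum_eps_v vk) ev0.
by rewrite ev_sum; apply: eq_bigr => l _; rewrite evZ ev_toQ.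
Qed.

Lemma exists_height : (exists i, ht i < 0) /\ (exists j, 0 < ht j).
Proof.
have [i wi] : exists i, ht i != 0.
  apply: contrapT => nw; suff : `|0 : int|%N = 1%N by [].
  apply: height_dvd => i; rewrite dvd0z.
  by apply/negPn/negP => wi; apply: nw; exists i.
split; apply: contrapT => nw.
  have ge0 l : 0 <= eps k l * htQ l.
    rewrite mulr_ge0 ?(ltW (eps_gt0 vk l)) // ler0z leNgt.
    by apply/negP => wl; apply: nw; exists l.
  have /eqP := sum_eps_height; rewrite psumr_eq0 // => /allP/(_ i).
  rewrite mem_index_enum => /(_ isT) /=; rewrite mulf_eq0 gt_eqF ?(eps_gt0 vk) //=.
  by rewrite intr_eq0 (negPf wi).
have ge0 l : 0 <= eps k l * - htQ l.
  rewrite mulr_ge0 ?(ltW (eps_gt0 vk l)) // oppr_ge0 lerz0 leNgt.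
  by apply/negP => wl; apply: nw; exists l.
have /eqP : \sum_l eps k l * - htQ l = 0.
  by under eq_bigr do rewrite mulrN; rewrite sumrN sum_eps_height oppr0.
rewrite psumr_eq0 // => /allP/(_ i).
rewrite mem_index_enum => /(_ isT) /=; rewrite mulf_eq0 gt_eqF ?(eps_gt0 vk) //=.
by rewrite oppr_eq0 intr_eq0 (negPf wi).
Qed.

Lemma hmin_le t : hmin <= htQ t.
Proof. by case: hminP => _; rewrite -ev_toQ; apply; exact: simplex_self. Qed.

Lemma le_hmax t : htQ t <= hmax.
Proof. by case: hmaxP => _; rewrite -ev_toQ; apply; exact: simplex_self. Qed.

Lemma slice_sub h x : slice w h (simplex v) x -> simplex v x /\ ev (toQ w) x = h%:~R.
Proof.
move=> sx; split.
  apply: (simplex_convex vk); apply: conv_mono sx => y; by case=> -[].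
by apply: conv_eq sx => y [[]].
Qed.

Lemma factor_height f : F f -> ev (toQ w) f = 0.
Proof. by case: FG => _ _ + _ => /[apply]. Qed.

(** Every coordinate except the i-th is minimal on the simplex at v_i. Once v_i is split as g + (-
    h) f, replacing f by f' stays inside the simplex and so cannot lower such a coordinate. *)
Lemma neg_split i : ht i < 0 -> exists f, [/\ F f,
  G (ht i) (vQ i + htQ i *: f)
  & forall f' l, F f' -> l != i -> ev (b l) f <= ev (b l) f'].
Proof.
move=> wi; case: FG => _ _ _ /(_ _ (hmin_le i) wi)[_ vG Gs].
have [|g Gg [_ [f Ff <-] gf]] := vG (vQ i).
  by split; [exact: ev_toQ | exact: (vert_simplex _ vk)].
have c0 : 0 < (- ht i)%:~R :> rat by rewrite ltr0z oppr_gt0.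
exists f; split=> // [|f' l Ff' li].
  by rewrite -gf intrN scaleNr subrK.
have [|/(simplexP vk b0 bE bv) Pgf' _] := slice_sub (Gs (g + (- ht i)%:~R *: f') _).
  by exists g => //; exists ((- ht i)%:~R *: f') => //; exists f'.
have := Pgf' l; have := bv l i; rewrite -gf (negPf li) !evD !evZ => E.
rewrite mulr0n in E; rewrite -(ler_pM2l c0 (ev (b l) f)); move: E; lra.
Qed.

Lemma neg_gen t x : ht t < 0 -> G (ht t) x -> R x.
Proof.
by move=> wt Gx; rewrite RE; apply: conv_self; left; exists (ht t); rewrite hmin_le.
Qed.

Lemma nonneg_gen t f : 0 <= ht t -> F f -> R (vQ t + htQ t *: f).
Proof.
move=> wt Ff; rewrite RE; apply: conv_self; right; exists (ht t); rewrite le_hmax.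
split=> //; exists (vQ t); last by exists (htQ t *: f) => //; exists f.
apply: conv_self; split; last by exists (v t).
by split; [exact: ev_toQ | exact: simplex_self].
Qed.

(* In terms of polar duals, the mutation is the piecewise linear map
   [u |-> u - (min_F u) w]: a vertex of [simplex v] exposed by [u] yields a vertex
   of [R] exposed by the image of [u]. *)
Lemma mut_exposes u t f : F f -> exposes u (simplex v) (vQ t) ->
  (forall f', F f' -> ev u f <= ev u f' /\ (ht t != 0 -> ev u f' = ev u f -> f' = f)) ->
  exposes (u - ev u f *: toQ w) R (vQ t + htQ t *: f).
Proof.
move=> Ff ut uf; rewrite RE; apply: exposes_conv => x.
rewrite !(evBl, evZl) !evD !evZ ev_toQ (factor_height Ff) mulr0 addr0.
rewrite [_ + htQ t * _]addrC [htQ t * _]mulrC addrAC subrr add0r.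
case=> [[h [hh h0 Gx]]|[h [h0 hh [y sy [_ [f' Ff' <-] <-]]]]].
  case: FG => _ _ _ /(_ _ hh h0)[_ _ Gs].
  have /Gs/slice_sub[Py wy] : msum (G h) (dilate (- h) F) (x + (- h)%:~R *: f).
    by exists x => //; exists ((- h)%:~R *: f) => //; exists f.
  have wx : ev (toQ w) x = h%:~R by rewrite -wy evD evZ (factor_height Ff) mulr0 addr0.
  have [+ eqy] := ut _ Py; rewrite evD evZ wx intrN; split; first by lra.
  move=> E; have {}eqy : x + (- h)%:~R *: f = vQ t.
    by apply: eqy; rewrite evD evZ intrN; move: E; lra.
  have -> : ht t = h by apply: (@intr_inj rat); rewrite -wy eqy ev_toQ.
  by rewrite -eqy intrN scaleNr subrK.
have [Py wy] := slice_sub sy; have [uy eqy] := ut _ Py; have [uff' eqf] := uf _ Ff'.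
rewrite !evD !evZ wy (factor_height Ff') mulr0 addr0.
have h0' : 0 <= h%:~R :> rat by rewrite ler0z.
have uh : h%:~R * ev u f <= h%:~R * ev u f' by rewrite ler_wpM2l.
split; first by move: uy uh; lra.
move=> E; have {}eqy : y = vQ t by apply: eqy; move: uy uh E; lra.
have ht_h : ht t = h by apply: (@intr_inj rat); rewrite -wy eqy ev_toQ.
rewrite eqy ht_h; have [->|hn] := eqVneq h 0; first by rewrite !scale0r.
rewrite eqf // ?ht_h //; apply: (mulfI (_ : h%:~R != 0)); first by rewrite intr_eq0.
by move: E; rewrite eqy; lra.
Qed.

(** The sum of the coordinates other than the i-th is minimal on F at f only, because these
    coordinates determine a point; and an exposed point of a lattice polytope is a lattice point. *)
Lemma factor_lattice i f : ht i < 0 -> F f ->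
  (forall f' l, F f' -> l != i -> ev (b l) f <= ev (b l) f') -> exists f0, f = toQ f0.
Proof.
move=> wi Ff fmin; case: FG => -[s FE] _ _ _.
have ex : exposes (\sum_m (m != i)%:R *: b m) F f.
  move=> y Fy; have E x : ev (\sum_m (m != i)%:R *: b m) x = \sum_(m | m != i) ev (b m) x.
    rewrite ev_suml [RHS]big_mkcond; apply: eq_bigr => m _; rewrite evZl.
    by case: ifP; rewrite ?mul1r ?mul0r.
  rewrite !E; split; first by apply: ler_sum => m mi; apply: fmin.
  move/eqP; rewrite -subr_eq0 -sumrB psumr_eq0 => [/allP eq0|m mi]; last first.
    by rewrite subr_ge0; apply: fmin.
  apply: (frame_inj1 b0 bE (i := i)) => m mi; have := eq0 m.
  by rewrite mem_index_enum mi subr_eq0 => /(_ isT)/eqP.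
rewrite FE in ex Ff; have [f0 _ <-] := exposed_mem ex Ff.
by exists f0.
Qed.

Section Choice.
Variable f : 'I_n.+1 -> 'rV[rat]_n.
Hypothesis fF : forall i, ht i < 0 -> F (f i).
Hypothesis fG : forall i, ht i < 0 -> G (ht i) (vQ i + htQ i *: f i).
Hypothesis fmin : forall i, ht i < 0 ->
  forall f' l, F f' -> l != i -> ev (b l) (f i) <= ev (b l) f'.

(** The coordinate differences between a point of F and g sum to 0, so it is enough that none is
    negative. Minimality at i leaves out the i-th one: a second vertex of negative height covers it,
    and if there is none, the vanishing height of F does. *)
Lemma factor_trivial g : (forall i, ht i < 0 -> f i = g) -> F = [set g].
Proof.
move=> fg; have [[i wi] _] := exists_height.
have Fg : F g by rewrite -(fg i wi); apply: fF.
apply/seteqP; split=> [f' Ff' /=|_ ->//].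
pose d l := ev (b l) f' - ev (b l) g.
have d0 l : l != i -> 0 <= d l.
  by move=> li; rewrite subr_ge0 -(fg i wi); apply: fmin.
have ds : \sum_l d l = 0 by rewrite sumrB !(sum_frame b0) subrr.
have dw : \sum_l d l * htQ l = 0.
  under eq_bigr do rewrite mulrBl.
  by rewrite sumrB -!ev_height !factor_height // subrr.
have di : 0 <= d i.
  have [[j [ji wj]]|nj] := pselect (exists j, j != i /\ ht j < 0).
    by rewrite subr_ge0 -(fg j wj); apply: fmin => //; rewrite eq_sym.
  have wi' : htQ i < 0 by rewrite ltrz0.
  have : 0 <= \sum_(l | l != i) d l * htQ l.
    apply: sumr_ge0 => l li; rewrite mulr_ge0 ?d0 // ler0z leNgt.
    by apply/negP => wl; apply: nj; exists l.
  move: dw; rewrite (bigD1 i) //=; set S := \sum_(l | _) _ => E S0.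
  by rewrite -(nmulr_lle0 _ wi'); move: E S0; lra.
have {}d0 l : 0 <= d l by have [->|/d0] := eqVneq l i.
apply: (frame_inj bE) => m; apply/eqP; rewrite -subr_eq0 -/(d m).
move/eqP: ds; rewrite psumr_eq0 // => /allP/(_ m).
by rewrite mem_index_enum => /(_ isT).
Qed.

Lemma shear_iso g : F = [set g] -> poly_iso (simplex v) R.
Proof.
move=> Fg; have [[i wi] _] := exists_height.
have fg j : ht j < 0 -> f j = g by move=> /fF; rewrite Fg.
have Fg' : F g by rewrite Fg.
have [|g0 gE] := factor_lattice wi Fg'.
  by move=> f' l; rewrite -(fg i wi); apply: fmin.
have g0w : g0 *m w = 0.
  apply/rowP => j; rewrite ord1 [RHS]mxE; apply: (@intr_inj rat).
  by rewrite -[LHS]ev_toQ -gE factor_height.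
(* The shear x -> x + w(x) g, unimodular because w(g) = 0. *)
pose A : 'M[int]_n := 1%:M + w *m g0.
have uA : A \in unitmx.
  have AB : A *m (1%:M - w *m g0) = 1%:M.
    rewrite mulmxBr mulmx1 mulmxDl mul1mx mulmxA -[w *m g0 *m w]mulmxA g0w.
    by rewrite mulmx0 mul0mx addr0 addrK.
  by have [] := mulmx1_unit AB.
have AE x : x *m toQ A = x + ev (toQ w) x *: g.
  rewrite toQD toQM mulmxDr /toQ map_mx1 mulmx1 mulmxA gE; congr (_ + _).
  by rewrite [x *m _]mx11_scalar mul_scalar_mx.
exists A => //; rewrite RE simplex_mul; apply/seteqP; split; last first.
  apply: conv_mono => _ [t _ <-]; rewrite toQM AE ev_toQ.
  have [wt|wt] := ltP (ht t) 0.
    left; exists (ht t); rewrite hmin_le; split=> //.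
    by have := fG wt; rewrite fg.
  right; exists (ht t); rewrite le_hmax; split=> //; exists (vQ t).
    apply: conv_self; split; last by exists (v t).
    by split; [exact: ev_toQ | exact: simplex_self].
  by exists (htQ t *: g) => //; exists g.
move=> x Cx; apply: (simplex_convex (wvec_mul vk uA)).
apply: conv_mono Cx => {}x [[h [hh h0 Gx]]|[h [h0 hh [y sy [_ [f' Ff' <-] <-]]]]].
  have [_ _ _ /(_ _ hh h0)[_ _ Gs]] := FG.
  have /Gs/slice_sub[Py wy] : msum (G h) (dilate (- h) F) (x + (- h)%:~R *: g).
    by exists x => //; exists ((- h)%:~R *: g) => //; exists g.
  rewrite -simplex_mul; exists (x + (- h)%:~R *: g) => //.
  by rewrite AE wy intrN scaleNr subrK.
move: Ff'; rewrite Fg => ->; have [Py wy] := slice_sub sy.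
by rewrite -simplex_mul; exists y => //; rewrite AE wy.
Qed.

(* The factor is homothetic to the face spanned by the vertices of negative height. *)
Lemma factor_structure i0 i1 : ht i0 < 0 -> ht i1 < 0 -> f i0 != f i1 ->
  exists O s, 0 < s /\ forall i, ht i < 0 -> f i = O + s *: vQ i.
Proof.
move=> w0 w1 f01; have i01 : i0 != i1 by apply: contraNneq f01 => ->.
(* The minimum of the l-th coordinate on F, read off at whichever of i0, i1 differs from l. All
   coordinates of f_i except the i-th take this minimum; since coordinates sum to 0, the i-th
   exceeds it by s. *)
pose m l := ev (b l) (f (if l == i0 then i1 else i0)); pose s := - \sum_l m l.
have mE i l : ht i < 0 -> l != i -> ev (b l) (f i) = m l.
  move=> wi li; apply/le_anti/andP; split.
    by apply: fmin => //; apply: fF; case: ifP.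
  have li' : l != (if l == i0 then i1 else i0) by have [->|] := eqVneq l i0.
  by apply: fmin => //; [case: ifP | apply: fF].
have fE i : ht i < 0 -> f i = \sum_l m l *: vQ l + s *: vQ i.
  move=> wi; apply: (frame_inj1 b0 bE (i := i)) => l li; rewrite mE // evD evZ bv (negPf li).
  by rewrite (frame_comb bv (c := m)) // /s mulr0n; ring.
exists (\sum_l m l *: vQ l), s; split=> //.
have s0 : s != 0.
  by apply: contraNneq f01 => s0; rewrite !fE // s0 !scale0r.
rewrite lt_neqAle eq_sym s0 /=.
have := fmin w1 (fF w0) (i01 : i0 != i1); rewrite -subr_ge0 -evB !fE //.
by rewrite opprD addrACA subrr add0r -scalerBr evZ evB !bv eqxx (negPf i01) mulr1n mulr0n; lra.
Qed.

Section Structure.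
Variables (i0 i1 : 'I_n.+1) (O : 'rV[rat]_n) (s : rat).
Hypothesis w0 : ht i0 < 0.
Hypothesis s_gt0 : 0 < s.
Hypothesis fE : forall i, ht i < 0 -> f i = O + s *: vQ i.

Lemma height_O i : ht i < 0 -> ev (toQ w) O = - s * htQ i.
Proof.
move=> wi; have := factor_height (fF wi); rewrite fE // evD evZ ev_toQ.
by move=> ?; lra.
Qed.

Lemma neg_height i : ht i < 0 -> ht i = ht i0.
Proof.
move=> wi; apply: (@intr_inj rat); have := height_O w0; rewrite (height_O wi).
by move=> /mulfI; apply; rewrite oppr_eq0 gt_eqF.
Qed.

(** As the differences d sum to 0, heights may be measured from the lowest one, [ht i0]. Then all
    products of a difference and a height are non-negative with sum 0, and the height of t so
    measured is positive. *)
Lemma factor_flat f' t : F f' -> 0 <= ht t -> ev (b t) f' = ev (b t) (f i0).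
Proof.
move=> Ff' wt; pose d l := ev (b l) f' - ev (b l) (f i0).
have d0 l : l != i0 -> 0 <= d l by move=> li; rewrite subr_ge0; apply: fmin.
have ds : \sum_l d l = 0 by rewrite sumrB !(sum_frame b0) subrr.
have dw : \sum_l d l * (htQ l - htQ i0) = 0.
  under eq_bigr do rewrite mulrBr mulrBl.
  rewrite sumrB -mulr_suml ds mul0r subr0 sumrB -!ev_height !factor_height ?subrr //.
  exact: fF.
have h0 l : 0 <= htQ l - htQ i0.
  rewrite subr_ge0 ler_int; have [wl|wl] := ltP (ht l) 0; first by rewrite neg_height.
  by apply: le_trans wl; apply: ltW.
have dh l : 0 <= d l * (htQ l - htQ i0).
  have [->|li] := eqVneq l i0; first by rewrite subrr mulr0.
  by rewrite mulr_ge0 ?d0.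
move/eqP: dw; rewrite psumr_eq0 // => /allP/(_ t).
rewrite mem_index_enum => /(_ isT) /=; rewrite mulf_eq0 !subr_eq0 eqr_int.
case/orP=> [/eqP//|/eqP E]; move: wt; rewrite E leNgt w0; by [].
Qed.

Definition mut_pt t i := vQ t + htQ t *: f i.

Lemma mut_pt_exposed t i : ht i < 0 -> (ht t < 0 -> t = i) ->
  R (mut_pt t i) /\ exists u, exposes u R (mut_pt t i).
Proof.
move=> wi ti; split.
  have [wt|wt] := ltP (ht t) 0; last by apply: nonneg_gen => //; apply: fF.
  by apply: (neg_gen wt); rewrite -(ti wt); apply: fG.
(* The value is least at t, so that v_t is exposed; i comes next, so that f_i is the only minimum on
   F, where for t <> i the t-th coordinate is constant. *)
pose c m : rat := if m == t then 0 else if m == i then 1 else 2.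
pose u := \sum_m c m *: b m.
exists (u - ev u (f i) *: toQ w); apply: mut_exposes; first exact: fF.
  apply: (simplex_exposes bv) => m mt; rewrite /c eqxx (negPf mt).
  by case: ifP.
move=> f' Ff'; pose d l := ev (b l) f' - ev (b l) (f i).
have d0 l : l != i -> 0 <= d l by move=> li; rewrite subr_ge0; apply: fmin.
have ds : \sum_l d l = 0 by rewrite sumrB !(sum_frame b0) subrr.
have dt : t != i -> d t = 0.
  move=> t_i; have wt : 0 <= ht t.
    by rewrite leNgt; apply/negP => /ti E; rewrite E eqxx in t_i.
  by rewrite /d !factor_flat ?subrr //; apply: fF.
have uE : ev u f' - ev u (f i) = \sum_m (c m - c i) * d m.
  under [RHS]eq_bigr do rewrite mulrBl.
  rewrite sumrB -mulr_sumr ds mulr0 subr0 !ev_suml -sumrB.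
  by apply: eq_bigr => m _; rewrite !evZl mulrBr.
have term l : 0 <= (c l - c i) * d l.
  have [->|li] := eqVneq l i; first by rewrite subrr mul0r.
  have [E|lt] := eqVneq l t; first by rewrite E dt ?mulr0 // -E.
  rewrite mulr_ge0 ?d0 // /c (negPf li) (negPf lt) eqxx.
  by case: ifP; lra.
split; first by rewrite -subr_ge0 uE sumr_ge0.
move=> _ /eqP; rewrite -subr_eq0 uE psumr_eq0 // => /allP eq0.
apply: (frame_inj1 b0 bE (i := i)) => l li; apply/eqP; rewrite -subr_eq0 -/(d l).
have [E|lt] := eqVneq l t; first by rewrite E dt // -E.
have := eq0 l; rewrite mem_index_enum => /(_ isT) /=; rewrite mulf_eq0.
case/orP=> //; rewrite /c (negPf li) (negPf lt) eqxx.
by case: ifP.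
Qed.

End Structure.

End Choice.
End Mutation.

(** * Matching the exposed points with n + 1 labels *)

Section Labels.
Variables (n : nat) (v : 'I_n.+1 -> 'rV[int]_n) (k : 'I_n.+1 -> nat).
Variable b : 'I_n.+1 -> 'cV[rat]_n.
Hypothesis bv : forall m l, ev (b m) (toQ (v l)) = (m == l)%:R - eps k m.
Variables (w : 'cV[int]_n) (i0 i1 z : 'I_n.+1) (O : 'rV[rat]_n) (s : rat).

Notation ht t := (lev w (v t)).
Notation htQ t := ((lev w (v t))%:~R : rat).
Notation vQ t := (toQ (v t)).

Hypothesis s_gt0 : 0 < s.
Hypothesis i01 : i0 != i1.
Hypothesis w0 : ht i0 < 0.
Hypothesis w1 : ht i1 < 0.
Hypothesis wz : 0 < ht z.
Hypothesis neg_height0 : forall i, ht i < 0 -> ht i = ht i0.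
Hypothesis O_height : ev (toQ w) O = - s * htQ i0.

(** [mut_pt] with the vertex of the factor in its homothetic form. *)
Definition pt t i := vQ t + htQ t *: (O + s *: vQ i).

Lemma pt_height t i : ht i < 0 -> ev (toQ w) (pt t i) = htQ t.
Proof.
move=> /neg_height0 wi; rewrite evD evZ evD evZ O_height !ev_toQ wi.
by ring.
Qed.

Lemma pt_height_eq t i t' i' : ht i < 0 -> ht i' < 0 -> pt t i = pt t' i' -> ht t = ht t'.
Proof.
move=> wi wi' /(congr1 (ev (toQ w))); rewrite !pt_height //.
exact: intr_inj.
Qed.

Lemma frame_delta (i j : 'I_n.+1) (c : rat) (x : 'rV[rat]_n) :
  x + c *: vQ i = x + c *: vQ j -> c != 0 -> i = j.
Proof.
move=> /addrI/(congr1 (ev (b i))); rewrite !evZ !bv eqxx => E c0.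
move: E => /(mulfI c0)/addIr; have [//|_ /eqP] := eqVneq i j.
by rewrite oner_eq0.
Qed.

Lemma pt_inj t i t' i' : 0 <= ht t -> ht i < 0 -> ht i' < 0 -> pt t i = pt t' i' ->
  t = t' /\ (0 < ht t -> i = i').
Proof.
move=> wt wi wi' E; have wtt := pt_height_eq wi wi' E.
have tN j : ht j < 0 -> (t == j) = false.
  by move=> wj; apply/eqP => tj; move: wj; rewrite -tj ltNge wt.
have tt' : t = t'.
  have := congr1 (ev (b t)) E; rewrite /pt !evD !evZ !evD !evZ !bv (tN i) // (tN i') // -wtt eqxx.
  by case: eqVneq => [//|_] /addIr/addIr/eqP; rewrite oner_eq0.
split=> // wt'; move: E; rewrite /pt -tt' => /addrI/scalerI.
rewrite intr_eq0 gt_eqF // => /(_ isT) E.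
by apply: (frame_delta E); rewrite gt_eqF.
Qed.

(** The points [pt i i] over the negative face form a copy of it scaled by 1 + s [ht i0]; two of
    them coincide only if the copy collapses. *)
Lemma pt_neg_inj i i' : ht i < 0 -> ht i' < 0 -> i != i' -> pt i i = pt i' i' ->
  1 + s * htQ i0 = 0.
Proof.
move=> wi wi' ii' /(congr1 (ev (b i))); rewrite /pt !evD !evZ !evD !evZ !bv.
rewrite (neg_height0 wi) (neg_height0 wi') eqxx (negPf ii') mulr1n mulr0n.
by move=> ?; lra.
Qed.

(* n + 1 of the exposed points of the mutation, hence all its vertices when it is a
   simplex; any further exposed point gives a contradiction. *)
Definition mut_vertex t : 'rV[rat]_n :=
  if ht t < 0 then pt z t else if t == z then pt i0 i0 else pt t i0.

Lemma mut_vertex_inj : injective mut_vertex.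
Proof.
have wz0 := ltW wz; have h t i : ht i < 0 -> 0 <= ht t -> pt t i <> pt i0 i0.
  move=> wi wt /(pt_height_eq wi w0) E.
  by move: wt; rewrite E leNgt w0.
move=> t t'; rewrite /mut_vertex.
have [wt|wt] := ltP (ht t) 0; have [wt'|wt'] := ltP (ht t') 0.
- by move=> /pt_inj[] // _; apply.
- case: (eqVneq t' z) => [_ /(h _ _ wt wz0)//|t'z /pt_inj[]// zt' _].
  by rewrite zt' eqxx in t'z.
- case: (eqVneq t z) => [_ /esym/(h _ _ wt' wz0)//|tz /esym/pt_inj[]// zt _].
  by rewrite zt eqxx in tz.
case: (eqVneq t z) => [->|tz]; case: (eqVneq t' z) => [->//|t'z].
- by move=> /esym/(h _ _ w0 wt').
- by move=> /(h _ _ w0 wt).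
by move=> /pt_inj[].
Qed.

Variable r : 'I_n.+1 -> 'rV[int]_n.
Hypothesis ptR : forall t i, ht i < 0 -> (ht t < 0 -> t = i) ->
  range (fun i => toQ (r i)) (pt t i).

(** Among the n + 1 labels only [pt i0 i0] has negative height, so [pt i1 i1] must equal it and the
    face collapses. For a positive vertex j other than z only [pt j i0] is a label, and [pt j i1]
    would be a surplus vertex. *)
Lemma mut_labels : [/\ s * htQ i0 = -1, forall j, 0 < ht j -> j = z
  & exists p : 'S_n.+1, forall t, toQ (r (p t)) =
      if ht t < 0 then vQ z + htQ z *: (O + s *: vQ t) else if t == z then htQ i0 *: O else vQ t].
Proof.
have [t|p pE] := label_perm mut_vertex_inj (r := r).
  rewrite /mut_vertex; have [wt|wt] := ltP (ht t) 0.
    by apply: ptR => //; rewrite ltNge ltW.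
  case: ifP => _; first exact: ptR.
  by apply: ptR => //; rewrite ltNge wt.
have ptE t i : ht i < 0 -> (ht t < 0 -> t = i) -> exists t', pt t i = mut_vertex t'.
  by move=> wi ti; have [m _ <-] := ptR wi ti; exists (p^-1%g m); rewrite pE permKV.
have s1 : s * htQ i0 = -1.
  have [//|t' E] := ptE i1 i1 w1; apply: (addrI 1); rewrite subrr.
  have wE i t : ht i < 0 -> pt i1 i1 = pt t i -> ht t < 0.
    by move=> wi /(pt_height_eq w1 wi) <-.
  move: E; rewrite /mut_vertex; have [wt|wt] := ltP (ht t') 0.
    by move=> /wE-/(_ wt); rewrite ltNge ltW.
  case: ifP => _; last by move=> /wE-/(_ w0); rewrite ltNge wt.
  by move=> /esym/pt_neg_inj; apply.
have uniq_z j : 0 < ht j -> j = z.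
  move=> wj; have [|t' +] := ptE j i1 w1; first by rewrite ltNge ltW.
  rewrite /mut_vertex; have [wt|wt] := ltP (ht t') 0.
    by case/pt_inj => //; apply: ltW.
  case: ifP => _.
    by move=> /(pt_height_eq w1 w0) E; move: wj; rewrite E ltNge ltW.
  by case/pt_inj => // [|_ /(_ wj) E]; [apply: ltW | move: i01; rewrite E eqxx].
split=> //; exists p => t; rewrite -pE /mut_vertex.
have [wt|wt] := ltP (ht t) 0; first by [].
case: ifP => tz.
  rewrite /pt scalerDr scalerA [htQ i0 * s]mulrC s1 scaleN1r.
  by rewrite [_ *: O + _]addrC addrA subrr add0r.
suff E : ht t = 0 by rewrite /pt E scale0r addr0.
apply/le_anti; rewrite wt andbT leNgt.
by apply/negP => /uniq_z E; rewrite E eqxx in tz.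
Qed.

End Labels.

(** * Effect of a mutation on the weights *)

(* The vertex z has height h', the edge {i, j} has height - h and all other vertices
   have height 0. The relation is symmetric under exchange of (k, h) and (m, h'). *)
Definition mutation_data n (k m : 'I_n.+1 -> nat) (z i j : 'I_n.+1) (h h' e : nat)
    (d : 'I_n.+1 -> nat) : Prop :=
  [/\ [/\ z != i, z != j & i != j], coprime h h' /\ \big[gcdn/0%N]_l m l = 1%N,
      [/\ m i = k i, m j = k j & (k i + k j = h * h' * e)%N],
      k z = (h ^ 2 * e)%N /\ m z = (h' ^ 2 * e)%N
    & forall l, l != z -> l != i -> l != j -> k l = (h * d l)%N /\ m l = (h' * d l)%N].

Definition weight_mutation n (k m : 'I_n.+1 -> nat) : Prop :=
  exists z i j h h' e d, mutation_data k m z i j h h' e d.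

Lemma height_rel n (v : 'I_n.+1 -> 'rV[int]_n) k (w : 'cV[int]_n) : wvec v k ->
  \sum_t (k t)%:Z * lev w (v t) = 0.
Proof.
case=> _ _ vk0 _; transitivity (lev w (\sum_t v t *+ k t)); last by rewrite vk0 /lev mul0mx mxE.
rewrite /lev mulmx_suml summxE; apply: eq_bigr => t _.
by rewrite -scaler_nat -scalemxAl [RHS]mxE natz.
Qed.

Lemma edge_dvd n (v : 'I_n.+1 -> 'rV[int]_n) k i j (h : nat) f : wvec v k ->
  i != j -> v i - v j = h%:Z *: f ->
  (forall l, l != i -> l != j -> (h %| k l)%N) /\ (h %| k i + k j)%N.
Proof.
move=> vk ij vij; have [_ _ _ /(_ f)[x xE]] := vk.
have [t tE] : exists t : int, forall l,
    h%:Z * x l - (l == i)%:R + (l == j)%:R = t * (k l)%:Z.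
  apply: (wvec_relz vk); under eq_bigr do rewrite scalerDl scalerBl -scalerA.
  rewrite big_split sumrB /= -scaler_sumr -xE -vij.
  have dE l : \sum_m (m == l)%:R *: v m = v l.
    rewrite (bigD1 l) //= eqxx scale1r big1 ?addr0 // => m /negPf ->.
    by rewrite scale0r.
  by rewrite !dE addrAC subrK subrr.
(* The coefficient of [v i] reads h x_i - t k_i = 1. *)
have ht : coprime h `|t|.
  rewrite -[h]/(`|h%:Z|%N) -coprimezE; apply/coprimezP; exists (x i, - (k i)%:Z) => /=.
  have := tE i; rewrite eqxx (negPf ij) mulr1n mulr0n addr0 => E.
  by rewrite mulNr [_ * t]mulrC -E mulrC; ring.
have hd c : (h%:Z %| t * c%:Z)%Z -> (h %| c)%N.
  by rewrite dvdzE abszM !absz_nat Gauss_dvdr.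
split=> [l li lj|]; apply: hd.
  by rewrite -tE (negPf li) (negPf lj) subr0 addr0 dvdz_mulr.
rewrite PoszD mulrDr -!tE !eqxx (negPf ij) eq_sym (negPf ij).
have -> : h%:Z * x i - 1%:R + 0%:R + (h%:Z * x j - 0%:R + 1%:R) = h%:Z * (x i + x j).
  by rewrite mulr1n mulr0n; ring.
by rewrite dvdz_mulr.
Qed.

Lemma edge_quotient n (k : 'I_n -> nat) (i j z : 'I_n) h h' : coprime h h' -> (0 < h)%N ->
  (h %| k z)%N -> (h %| k i + k j)%N -> (h' * k z = h * (k i + k j))%N ->
  exists e, (k i + k j = h * h' * e)%N /\ (k z = h ^ 2 * e)%N.
Proof.
move=> hh h0 /dvdnP[a aE] hij E.
have aE' : (h' * a = k i + k j)%N.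
  by apply/eqP; rewrite -(eqn_pmul2l h0) -E aE; apply/eqP; ring.
have /dvdnP[e eE] : (h %| a)%N by rewrite -(Gauss_dvdr _ hh) aE'.
by exists e; rewrite -aE' aE eE; split; ring.
Qed.

(** * Comparison of the weights of a simplex and of its mutation *)

Section Weights.
Variables (n : nat) (v r : 'I_n.+1 -> 'rV[int]_n) (k m : 'I_n.+1 -> nat).
Hypotheses (vk : wvec v k) (rm : wvec r m).
Variables (w : 'cV[int]_n) (i0 i1 z : 'I_n.+1) (h h' : nat).
Variables (O : 'rV[rat]_n) (s : rat) (g : 'I_n.+1 -> 'rV[int]_n).

Notation ht t := (lev w (v t)).
Notation vQ t := (toQ (v t)).
Notation N t := (ht t < 0).

Hypothesis w_gcd : forall c : int, (forall t, (c %| ht t)%Z) -> `|c|%N = 1%N.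
Hypotheses (i01 : i0 != i1) (w0 : N i0) (w1 : N i1).
Hypotheses (h0 : (0 < h)%N) (h0' : (0 < h')%N).
Hypothesis htN : forall t, N t -> ht t = - h%:Z.
Hypothesis htz : ht z = h'%:Z.
Hypothesis ht0 : forall t, ~~ N t -> t != z -> ht t = 0.
Hypothesis sh : s * h%:R = 1.
Hypothesis Oht : ev (toQ w) O = 1.
Hypothesis gE : forall t, N t -> O + s *: vQ t = toQ (g t).
Hypothesis rE : forall t, toQ (r t) =
  if N t then vQ z + h'%:R *: (O + s *: vQ t) else if t == z then - h%:R *: O else vQ t.

Let zN : N z = false.
Proof. by rewrite htz. Qed.

Lemma coprime_heights : coprime h h'.
Proof.
apply/eqP; rewrite -[gcdn _ _]absz_nat; apply: w_gcd => t.
have [tN|tN] := boolP (N t); first by rewrite htN // dvdzE abszN !absz_nat dvdn_gcdl.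
have [->|tz] := eqVneq t z; first by rewrite htz dvdzE !absz_nat dvdn_gcdr.
by rewrite ht0 // dvdz0.
Qed.

Lemma r_height t : lev w (r t) = if N t then h'%:Z else if t == z then - h%:Z else 0.
Proof.
apply: (@intr_inj rat); rewrite -ev_toQ rE; case: ifP => tN.
  rewrite evD evZ evD evZ !ev_toQ Oht htz htN // intrN.
  by rewrite mulrN [X in 1 - X]sh subrr mulr0 addr0.
case: ifP => tz; first by rewrite evZ Oht mulr1 intrN.
by rewrite ev_toQ ht0 ?tN ?tz.
Qed.

Lemma height_balance : (h' * k z = h * \sum_(t | N t) k t)%N.
Proof.
have := height_rel w vk; rewrite (bigID (fun t => N t)) /= [X in _ + X](bigD1 z) ?zN //=.
rewrite [X in _ + (_ + X)]big1 => [|t /andP[tN tz]]; last by rewrite ht0 ?mulr0.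
under eq_bigr => t tN do rewrite (htN tN) mulrN.
rewrite sumrN -mulr_suml addr0 htz => /eqP; rewrite addrC subr_eq0 => /eqP E.
apply/eqP; rewrite -eqz_nat !PoszM mulrC E mulrC; apply/eqP; congr (_ * _).
by rewrite (big_morph Posz PoszD (erefl _)).
Qed.

Lemma height_balance' : (h * m z = h' * \sum_(t | N t) m t)%N.
Proof.
have := height_rel w rm; rewrite (eq_bigr _ (fun t _ => congr1 _ (r_height t))).
rewrite (bigID (fun t => N t)) /= [X in _ + X](bigD1 z) ?zN //= eqxx.
rewrite [X in _ + (_ + X)]big1 => [|t /andP[/negPf-> /negPf->]]; last by rewrite mulr0.
under eq_bigr => t tN do rewrite tN.
rewrite -mulr_suml addr0 mulrN => /eqP; rewrite subr_eq0 => /eqP E.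
apply/eqP; rewrite -eqz_nat !PoszM mulrC -E mulrC; apply/eqP; congr (_ * _).
by rewrite (big_morph Posz PoszD (erefl _)).
Qed.

Let hQ : h%:R != 0 :> rat. Proof. by rewrite pnatr_eq0 -lt0n. Qed.
Let hQ' : h'%:R != 0 :> rat. Proof. by rewrite pnatr_eq0 -lt0n. Qed.
Let sE : s = h%:R^-1. Proof. by apply: (mulIf hQ); rewrite sh mulVf. Qed.

(** The weight relation of [r], rewritten in terms of [v], is a relation [c] of the v_t, hence
    proportional to [k]. The multiples of O cancel by [height_balance']. *)
Lemma weight_ratio : exists sg : rat, 0 < sg /\ forall t, (k t)%:R = sg * (m t)%:R *
  (if N t then 1 else if t == z then (h%:R / h'%:R) ^+ 2 else h%:R / h'%:R).
Proof.
pose S : rat := \sum_(t | N t) (m t)%:R.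
have SE : h%:R * (m z)%:R = h'%:R * S.
  by rewrite /S -natr_sum -!natrM height_balance'.
pose c t : rat := if N t then h'%:R * s * (m t)%:R else if t == z then S else (m t)%:R.
have [q qE] : exists q, forall t, c t = q * (k t)%:R.
  apply: (wvec_rel vk); rewrite -[RHS](sum_wvec rm).
  pose x t := (if N t then (m t)%:R else 0) *: (vQ z + h'%:R *: O).
  pose y t := (if t == z then 1 else 0) *: (S *: vQ z + (h%:R * (m z)%:R) *: O).
  have rxy t : (m t)%:R *: toQ (r t) = c t *: vQ t + x t - y t.
    rewrite rE /c /x /y; have [->|tz] := eqVneq t z.
      by rewrite zN; apply/rowP => j; rewrite !mxE; ring.
    by case: ifP => tN; apply/rowP => j; rewrite !mxE; ring.
  have xS : \sum_t x t = S *: (vQ z + h'%:R *: O).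
    by rewrite -scaler_suml; congr (_ *: _); rewrite -big_mkcond.
  have yS : \sum_t y t = S *: (vQ z + h'%:R *: O).
    rewrite -scaler_suml -big_mkcond big_pred1_eq scale1r SE scalerDr scalerA.
    by rewrite [S * _]mulrC.
  rewrite (eq_bigr _ (fun t _ => rxy t)) sumrB big_split /= xS yS.
  by rewrite addrK.
have [k0 _ _ _] := vk; have [m0 _ _ _] := rm.
have k0Q t : 0 < (k t)%:R :> rat by rewrite ltr0n.
have m0Q t : 0 < (m t)%:R :> rat by rewrite ltr0n.
have q0 : 0 < q.
  rewrite -(pmulr_lgt0 _ (k0Q i0)) -qE /c w0 sE.
  by rewrite !mulr_gt0 ?invr_gt0 ?ltr0n.
exists (h'%:R / h%:R / q); split; first by rewrite !divr_gt0 ?ltr0n.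
move=> t; have -> : (k t)%:R = c t / q by rewrite qE mulrC mulKf ?gt_eqF.
have qn : q != 0 by rewrite gt_eqF.
rewrite /c sE; case: ifP => tN; first by field; rewrite qn hQ.
case: ifP => [/eqP->|_]; last by field; rewrite qn hQ hQ'.
have -> : S = h%:R / h'%:R * (m z)%:R by rewrite mulrAC SE mulrC mulKf.
by field; rewrite qn hQ hQ'.
Qed.

Lemma weight_mutation_or_eq : k =1 m \/ weight_mutation k m.
Proof.
have hh := coprime_heights; have hh' : coprime h' h by rewrite coprime_sym.
have [sg [sg0 kE]] := weight_ratio.
have [k0 k1 _ _] := vk; have [m0 m1 _ _] := rm.
have diff i j : N i -> N j -> v i - v j = h%:Z *: (g i - g j) /\ r i - r j = h'%:Z *: (g i - g j).
  move=> iN jN; split; apply: toQ_inj; rewrite toQZ !toQB -!gE // ?rE ?iN ?jN.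
    rewrite opprD addrACA subrr add0r -scalerBr scalerA mulrC.
    by rewrite [_ * _]sh scale1r.
  by rewrite opprD addrACA subrr add0r -scalerBr.
have kdvd i j := fun iN jN ij => edge_dvd vk (ij : i != j) (proj1 (diff i j iN jN)).
have mdvd i j := fun iN jN ij => edge_dvd rm (ij : i != j) (proj2 (diff i j iN jN)).
have [[i2 [N2 i20 i21]]|no3] := pselect (exists i2, [/\ N i2, i2 != i0 & i2 != i1]).
  left; have one (c : nat) (q : 'I_n.+1 -> nat) : \big[gcdn/0%N]_i q i = 1%N ->
      (forall i j, N i -> N j -> i != j -> (forall l, l != i -> l != j -> (c %| q l)%N) /\
         (c %| q i + q j)%N) -> c = 1%N.
    move=> q1 cq; apply/eqP; rewrite -dvdn1 -q1; apply/dvdn_biggcdP => l _.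
    have [li|li] := eqVneq l i0.
      by rewrite li; apply: (proj1 (cq i1 i2 _ _ _)); rewrite // eq_sym.
    have [lj|lj] := eqVneq l i1.
      by rewrite lj; apply: (proj1 (cq i0 i2 _ _ _)); rewrite // eq_sym.
    exact: (proj1 (cq i0 i1 w0 w1 i01)).
  have h1 : h = 1%N by apply: (one _ _ k1 kdvd).
  have h1' : h' = 1%N by apply: (one _ _ m1 mdvd).
  have {}kE t : (k t)%:R = sg * (m t)%:R.
    by rewrite kE h1 h1' divr1 expr1n !if_same mulr1.
  have sg1 : sg = 1.
    apply: (coprime_scale1 m1 k1 sg0) => i; first by rewrite -kE natr_int.
    by rewrite kE mulKf ?gt_eqF // natr_int.
  by move=> t; apply/eqP; rewrite -(eqr_nat rat) kE sg1 mul1r.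
have NE t : N t = (t == i0) || (t == i1).
  apply/idP/idP => [tN|/orP[] /eqP -> //].
  by apply/negPn; rewrite negb_or; apply/negP => /andP[t0 t1]; apply: no3; exists t.
have [z0 z1] : z != i0 /\ z != i1 by apply/andP; rewrite -negb_or -NE zN.
have sumN (q : 'I_n.+1 -> nat) : (\sum_(t | N t) q t = q i0 + q i1)%N.
  rewrite (bigD1 i0) //= (bigD1 i1) /=; last by rewrite w1 eq_sym.
  rewrite big1 ?addn0 // => t; rewrite NE.
  by case: eqVneq => // _; case: eqVneq.
have [kl ks] := kdvd _ _ w0 w1 i01; have [ml ms] := mdvd _ _ w0 w1 i01.
have hk : (h' * k z = h * (k i0 + k i1))%N by rewrite height_balance sumN.
have hm : (h * m z = h' * (m i0 + m i1))%N by rewrite height_balance' sumN.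
have [e [eE kz]] := edge_quotient hh h0 (kl z z0 z1) ks hk.
have [e' [eE' mz]] := edge_quotient hh' h0' (ml z z0 z1) ms hm.
have int_l l : ~~ N l -> l != z -> (h %| k l)%N /\ (h' %| m l)%N.
  by rewrite NE negb_or => /andP[l0 l1] lz; split; [apply: kl | apply: ml].
(* The factor h / h' and its square are absorbed by the divisibility of the weights off the edge, so
   all sg m_t and all k_t / sg are integers; coprimality on both sides leaves only 1. *)
have sg1 : sg = 1.
  apply: (coprime_scale1 m1 k1 sg0) => t.
    have [tN|tN] := boolP (N t).
      by have := kE t; rewrite tN mulr1 => <-; rewrite natr_int.
    have [->|tz] := eqVneq t z.
      have -> : sg * (m z)%:R = (h' ^ 2 * e)%:R.
        apply: (mulIf (_ : (h%:R / h'%:R) ^+ 2 != 0)).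
          by rewrite expf_neq0 // mulf_neq0 ?invr_eq0.
        have := kE z; rewrite zN eqxx => <-; rewrite kz !natrM ?natrX.
        by field.
      exact: natr_int.
    have [/dvdnP[d dE] _] := int_l t tN tz.
    have -> : sg * (m t)%:R = (d * h')%:R; last exact: natr_int.
    apply: (mulIf (_ : h%:R / h'%:R != 0)); first by rewrite mulf_neq0 ?invr_eq0.
    have := kE t; rewrite (negPf tN) (negPf tz) => <-; rewrite dE !natrM.
    by field.
  have [tN|tN] := boolP (N t).
    have := kE t; rewrite tN mulr1 => ->; rewrite mulKf ?gt_eqF //; exact: natr_int.
  have [->|tz] := eqVneq t z.
    have := kE z; rewrite zN eqxx => ->; rewrite mz !natrM ?natrX.
    have -> : sg^-1 * (sg * (h'%:R ^+ 2 * e'%:R) * (h%:R / h'%:R) ^+ 2) = (h ^ 2 * e')%:R.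
      by rewrite natrM natrX; field; rewrite hQ' gt_eqF.
    exact: natr_int.
  have [_ /dvdnP[d dE]] := int_l t tN tz.
  have := kE t; rewrite (negPf tN) (negPf tz) => ->; rewrite dE natrM.
  have -> : sg^-1 * (sg * (d%:R * h'%:R) * (h%:R / h'%:R)) = (d * h)%:R.
    by rewrite natrM; field; rewrite hQ' gt_eqF.
  exact: natr_int.
have km t : N t -> m t = k t.
  by move=> tN; apply/eqP; rewrite -(eqr_nat rat) kE tN sg1 mul1r mulr1.
have ee : e' = e.
  apply/eqP; rewrite -(eqn_pmul2l h0) -(eqn_pmul2l h0') !mulnA -eE' [(h' * h)%N]mulnC -eE.
  by rewrite !km //.
right; exists z, i0, i1, h, h', e, (fun l => k l %/ h)%N; split=> //.
- by split; rewrite ?km.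
- by rewrite kz mz ee.
move=> l lz l0 l1; have lN : ~~ N l by rewrite NE negb_or l0.
have [hkl _] := int_l l lN lz; rewrite mulnC divnK //; split=> //.
apply/eqP; rewrite -(eqr_nat rat) natrM.
have := kE l; rewrite (negPf lN) (negPf lz) sg1 mul1r => E.
have /dvdnP[d dE] := hkl; rewrite dE mulnK // in E *.
apply/eqP; apply: (mulIf (_ : h%:R / h'%:R != 0)); rewrite ?mulf_neq0 ?invr_eq0 //.
by rewrite -E natrM; field.
Qed.

End Weights.
Theorem wps_mutation n (P Q : set 'rV[rat]_n) v k : wvec v k -> P = simplex v ->
  is_wps Q -> nontrivial_mutation P Q ->
  exists r m, [/\ Q = simplex r, wvec r m & weight_mutation k m].
Proof.
move=> vk -> [l /is_wps_ofP[_ [q [m [-> qm _]]]]] [[w [F [R [wp mut isoR]]]] niso].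
have [b [b0 bE bv]] := wvec_frame vk.
have [hmin [hmax [G [hminP hmaxP FG RE]]]] := mut.
have nisoR : ~ poly_iso (simplex v) R.
  by move=> iso; apply/niso/(poly_iso_trans iso)/poly_iso_sym.
have [f fP] : exists f : 'I_n.+1 -> 'rV[rat]_n, forall i, lev w (v i) < 0 -> [/\ F (f i),
    G (lev w (v i)) (toQ (v i) + (lev w (v i))%:~R *: f i)
  & forall f' l, F f' -> l != i -> ev (b l) (f i) <= ev (b l) f'].
  apply: (@fin_all_exists _ _ (fun i f => lev w (v i) < 0 -> [/\ F f,
    G (lev w (v i)) (toQ (v i) + (lev w (v i))%:~R *: f)
    & forall f' l, F f' -> l != i -> ev (b l) f <= ev (b l) f'])) => i.
  have [wi|_] := boolP (lev w (v i) < 0); last by exists 0.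
  by have [f fP] := neg_split vk b0 bE bv hminP FG wi; exists f.
have fF i : lev w (v i) < 0 -> F (f i) by move=> /fP[].
have fG i : lev w (v i) < 0 ->
  G (lev w (v i)) (toQ (v i) + (lev w (v i))%:~R *: f i) by move=> /fP[].
have fmin i : lev w (v i) < 0 ->
  forall f' l, F f' -> l != i -> ev (b l) (f i) <= ev (b l) f' by move=> /fP[].
have [[i wi] [z wz]] := exists_height vk wp.
have [[i0 [i1 [w0 w1 f01]]]|eqf] :=
    pselect (exists i0 i1, [/\ lev w (v i0) < 0, lev w (v i1) < 0 & f i0 != f i1]); last first.
  exfalso; apply: nisoR; have Fg := factor_trivial vk b0 bE wp FG fF fmin (g := f i).
  apply: (shear_iso vk b0 bE wp hminP hmaxP FG RE fF fG fmin (g := f i)).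
  by apply: Fg => j wj; apply/eqP/negPn/negP => fij; apply: eqf; exists j, i.
have i01 : i0 != i1 by apply: contraNneq f01 => ->.
have [O [s [s0 fE]]] := factor_structure b0 bE bv fF fmin w0 w1 f01.
have Oh := height_O FG fF fE w0; have nh := neg_height FG fF w0 s0 fE.
have [A uA RA] := isoR; rewrite simplex_mul in RA; have rm := wvec_mul qm uA.
have [t j wj tj|sh zuniq [p pE]] :=
    mut_labels bv s0 i01 w0 w1 wz nh Oh (r := fun i => q i *m A).
  have [Rpt [u ex]] := mut_pt_exposed vk b0 bE bv hminP hmaxP FG RE fF fG fmin w0 s0 fE wj tj.
  move: Rpt ex; rewrite RA /mut_pt fE // => Rpt ex.
  exact: exposed_mem ex Rpt.
have fl t : lev w (v t) < 0 -> exists g, f t = toQ g.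
  by move=> wt; apply: (factor_lattice b0 bE FG wt (fF t wt)); apply: fmin.
have [g gE] : exists g : 'I_n.+1 -> 'rV[int]_n, forall t, lev w (v t) < 0 -> f t = toQ (g t).
  apply: (@fin_all_exists _ _ (fun t g => lev w (v t) < 0 -> f t = toQ g)) => t.
  have [/fl[g gE]|_] := boolP (lev w (v t) < 0); first by exists g.
  by exists 0.
have hE : lev w (v i0) = - (`|lev w (v i0)|%N)%:Z by rewrite lez0_abs ?opprK // ltW.
have hE' : lev w (v z) = (`|lev w (v z)|%N)%:Z by rewrite gez0_abs // ltW.
set h := `|lev w (v i0)|%N in hE; set h' := `|lev w (v z)|%N in hE'.
have sh1 : s * h%:R = 1 by move: sh; rewrite hE intrN mulrN => /oppr_inj.
have [||t wt|t wt tz||t wt|t|km|wm] := @weight_mutation_or_eq _ v (fun t => q (p t) *m A) k (m \o p)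
    vk (wvec_perm p rm) w i0 i1 z h h' O s g (height_dvd vk wp) i01 w0 w1 _ _ _ hE' _ sh1 _ _ _.
- by rewrite absz_gt0 lt_eqF.
- by rewrite absz_gt0 gt_eqF.
- by rewrite nh.
- apply/le_anti; rewrite [_ <= lev _ _]leNgt wt andbT leNgt.
  by apply/negP => /zuniq E; rewrite E eqxx in tz.
- by rewrite Oh mulNr sh opprK.
- by rewrite -fE // gE.
- by rewrite pE hE hE' intrN.
- exfalso; apply: niso; rewrite -(simplex_perm q p).
  apply: (simplex_iso vk); have -> : k = m \o p by apply/funext.
  exact: wvec_perm.
exists (q \o p), (m \o p); split=> //; last exact: wvec_perm.
by rewrite simplex_perm.
Qed.
(** * Arithmetic of the neighbours *)

Lemma mutation_data_swap n (k m : 'I_n.+1 -> nat) z i j h h' e d :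
  mutation_data k m z i j h h' e d -> mutation_data k m z j i h h' e d.
Proof.
case=> -[zi zj ij] cop [mi mj kij] kz kl; split=> //.
- by split=> //; rewrite eq_sym.
- by split=> //; rewrite addnC.
by move=> l lz lj li; apply: kl.
Qed.

(** Neighbours are computed outwards from X_n^(m,a), while the theorem has a mutation towards it. *)
Lemma weight_mutation_sym n (k m : 'I_n.+1 -> nat) : \big[gcdn/0%N]_l k l = 1%N ->
  weight_mutation k m -> weight_mutation m k.
Proof.
move=> k1 [z [i [j [h [h' [e [d [dis [hh m1] [mi mj kij] [kz mz] kl]]]]]]]].
exists z, i, j, h', h, e, d; split=> //.
- by rewrite coprime_sym.
- by split=> //; rewrite mi mj kij [(h' * h)%N]mulnC.
by move=> l lz li lj; have [] := kl l lz li lj.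
Qed.

Lemma weight_mutation_perm n (k m : 'I_n.+1 -> nat) (s : 'S_n.+1) :
  weight_mutation k m -> weight_mutation (k \o s) (m \o s).
Proof.
move=> [z [i [j [h [h' [e [d [dis [hh m1] [mi mj kij] [kz mz] kl]]]]]]]].
exists (s^-1%g z), (s^-1%g i), (s^-1%g j), h, h', e, (d \o s).
split; rewrite /= ?permKV //.
- by rewrite !(inj_eq perm_inj).
- by split=> //; rewrite -[RHS]m1 [RHS](reindex_inj (@perm_inj _ s)).
move=> l; have E x : (l != s^-1%g x) = (s l != x).
  by rewrite -[in LHS](inj_eq (@perm_inj _ s)) permKV.
by rewrite !E; apply: kl.
Qed.

Section MutationArithmetic.
Variables (n : nat) (k m : 'I_n.+1 -> nat) (z i j : 'I_n.+1) (h h' e : nat).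
Variable d : 'I_n.+1 -> nat.
Hypothesis km : mutation_data k m z i j h h' e d.

Lemma mutation_gcd c : (1 < c)%N -> ~ (forall l, c %| m l)%N.
Proof.
case: km => _ [_ m1] _ _ _ c1 cm; have : (c %| 1)%N by rewrite -m1; apply/dvdn_biggcdP.
by rewrite dvdn1 => /eqP E; rewrite E in c1.
Qed.

(* Every new weight outside the edge is a multiple of h'. *)
Lemma mutation_common c : (1 < c)%N -> (c %| k i)%N -> (c %| k j)%N -> (c %| h')%N -> False.
Proof.
move=> c1 ci cj ch; apply: (mutation_gcd c1) => l.
case: km => _ _ [mi mj _] [_ mz] kl.
have [->|li] := eqVneq l i; first by rewrite mi.
have [->|lj] := eqVneq l j; first by rewrite mj.
have [->|lz] := eqVneq l z; first by rewrite mz -mulnA dvdn_mulr.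
by have [_ ->] := kl l lz li lj; rewrite dvdn_mulr.
Qed.

(** With k_z = h^2 e odd, an even sum along the edge makes h' even, and then every new weight is
    even. *)
Lemma mutation_parity : odd (k z) -> ~~ odd (k i) -> ~~ odd (k j) -> False.
Proof.
case: km => _ _ [_ _ kij] [kz _] _; rewrite kz oddM oddX /= => /andP[oh oe] ki kj.
apply: (@mutation_common 2); rewrite ?dvdn2 //.
by have := congr1 odd kij; rewrite oddD (negPf ki) (negPf kj) !oddM oh oe andbT /= => <-.
Qed.

Lemma mutation_parity' : ~~ odd (k z) -> odd (k i) = odd (k j).
Proof.
case: km => _ _ [_ _ kij] [kz _] _; rewrite kz oddM oddX /= => hz.
have := congr1 odd kij; rewrite oddD !oddM; move: hz.
by case: (odd (k i)); case: (odd (k j)); case: (odd h); case: (odd e); rewrite ?andbF.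
Qed.

Lemma mutation_dvd l : l != i -> l != j -> (h %| k l)%N.
Proof.
case: km => _ _ _ [kz _] kl li lj.
have [->|lz] := eqVneq l z; first by rewrite kz -mulnA dvdn_mulr.
by have [-> _] := kl l lz li lj; rewrite dvdn_mulr.
Qed.

Lemma mutation_dvd_sum : (h * e %| k i + k j)%N.
Proof. by case: km => _ _ [_ _ ->] _ _; rewrite mulnAC dvdn_mulr. Qed.

(** All new weights depend only on the ratio h' / h = (k_i + k_j) / k_z, which here is y / x; h, h'
    and e need not be found. *)
Lemma mutation_new (x y : nat) : (0 < k z)%N -> (k i + k j = x * y)%N -> k z = (x ^ 2)%N ->
  m z = (y ^ 2)%N /\ forall l c, l != z -> l != i -> l != j -> k l = (x * c)%N -> m l = (y * c)%N.
Proof.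
case: km => _ _ [_ _ kij] [kz mz] kl kz0 E1 E2.
have x0 : (0 < x)%N by move: kz0; rewrite E2 expn_gt0 orbF.
have hexy : (h * h' * e = x * y)%N by rewrite -kij.
have hex : (h ^ 2 * e = x ^ 2)%N by rewrite -kz.
split=> [|l c lz li lj klc].
  apply/eqP; rewrite mz -(eqn_pmul2l kz0) kz.
  have -> : (h ^ 2 * e * (h' ^ 2 * e) = (h * h' * e) ^ 2)%N by ring.
  by rewrite hexy hex; apply/eqP; ring.
have [kl1 ->] := kl l lz li lj; apply/eqP; rewrite -(eqn_pmul2l kz0) kz.
have -> : (h ^ 2 * e * (h' * d l) = (h * h' * e) * (h * d l))%N by ring.
by rewrite hexy -kl1 klc hex; apply/eqP; ring.
Qed.

End MutationArithmetic.

(** * Neighbours of X_n^(m,a) for m >= 1 *)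

Section BranchArithmetic.
Variables (n : nat) (k m : 'I_n.+1 -> nat) (p0 p1 p2 : 'I_n.+1).
Variables (x y x' x'' L q : nat) (c : 'I_n.+1 -> nat).
Notation rest l := [&& l != p0, l != p1 & l != p2].
Hypothesis p01 : p0 != p1.
Hypotheses (k0 : k p0 = (x ^ 2)%N) (k1 : k p1 = L) (k2 : k p2 = (y ^ 2)%N).
Hypothesis kc : forall l, rest l -> k l = (x * y * c l)%N.
Hypotheses (ox : odd x) (oy : odd y) (eL : ~~ odd L).
Hypothesis ec : forall l, rest l -> ~~ odd (c l).
Hypothesis L4 : ~~ (L %| 4)%N.
Hypothesis csum : forall l i j, rest l -> rest i -> rest j ->
  l != i -> l != j -> i != j -> ~~ (c l %| c i + c j)%N.
Hypothesis xyL : (x ^ 2 + y ^ 2 = L * q + 2)%N.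
Hypotheses (xy : coprime x y) (yL : coprime y L) (y1 : (1 < y)%N).
Hypotheses (xx' : (x ^ 2 + L = y * x')%N) (yx'' : (y ^ 2 + L = x * x'')%N).

Lemma branch_odd l : odd (k l) = (l == p0) || (l == p2).
Proof.
have [->|l0] := eqVneq l p0; first by rewrite k0 oddX.
have [->|l2] := eqVneq l p2; first by rewrite k2 oddX oy.
have [->|l1] := eqVneq l p1; first by rewrite k1 (negPf eL).
have rl : rest l by rewrite l0 l1 l2.
by rewrite kc // oddM (negPf (ec rl)) andbF.
Qed.

Lemma branch_rest l : ~~ odd (k l) -> l != p1 -> rest l.
Proof. by rewrite branch_odd negb_or => /andP[-> ->] ->. Qed.

Lemma branch_neighbors : weight_mutation k m ->
  [/\ m p0 = (x'' ^ 2)%N, m p1 = L, m p2 = (y ^ 2)%N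
    & forall l, rest l -> m l = (x'' * y * c l)%N] \/
  [/\ m p0 = (x ^ 2)%N, m p1 = L, m p2 = (x' ^ 2)%N
    & forall l, rest l -> m l = (x * x' * c l)%N].
Proof.
move=> [z [i [j [h [h' [e [d km]]]]]]]; have x_gt0 : (0 < x)%N by case: (x) ox.
have y_gt0 : (0 < y)%N by apply: ltnW.
have ydvd1 : ~~ (y %| 1)%N by rewrite dvdn1; case: (y) y1 => [|[]].
have [oz|ez] := boolP (odd (k z)).
  (* By parity the edge contains the other odd vertex. The two neighbours on the branch arise when
     its second end is the vertex of weight L. *)
  wlog oi : i j km / odd (k i).
    move=> H; have [oi|ei] := boolP (odd (k i)); first exact: H km oi.
    have [oj|ej] := boolP (odd (k j)); first exact: H (mutation_data_swap km) oj.
    by case: (mutation_parity km oz ei ej).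
  have [[zi zj ij] [hh _] [mi mj kij] [kz mz] kl] := km.
  have ej : ~~ odd (k j).
    move: oz oi zi zj ij; rewrite !branch_odd.
    by do 2![case/orP=> /eqP->]; rewrite ?eqxx // => _; rewrite !(eq_sym _ j) => /negPf-> /negPf->.
  have [j1|j1] := eqVneq j p1.
    move: oz oi zi kij mi mj; rewrite !branch_odd j1.
    case/orP=> /eqP zE; case/orP=> /eqP iE; rewrite zE iE ?eqxx // => _ kij mi mj.
      left; have E : (k i + k j = x * x'')%N by rewrite iE j1 k1 k2.
      have kz0 : (0 < k z)%N by rewrite zE k0 expn_gt0 x_gt0.
      have [|mz' ml] := mutation_new km kz0 E; first by rewrite zE k0.
      split=> [|||l /and3P[l0 l1 l2]]; rewrite ?mi ?mj //; first by rewrite -zE.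
      rewrite -mulnA; apply: ml; rewrite ?zE ?iE ?j1 //.
      by rewrite kc ?l0 ?l1 ?l2 // mulnA.
    right; have E : (k i + k j = y * x')%N by rewrite iE j1 k1 k0.
    have kz0 : (0 < k z)%N by rewrite zE k2 expn_gt0 y_gt0.
    have [|mz' ml] := mutation_new km kz0 E; first by rewrite zE k2.
    split=> [|||l /and3P[l0 l1 l2]]; rewrite ?mi ?mj //; first by rewrite -zE.
    rewrite [(x * _)%N]mulnC -mulnA; apply: ml; rewrite ?zE ?iE ?j1 //.
    by rewrite kc ?l0 ?l1 ?l2 //; ring.
  (* The second end has weight x y c_j. If z = p0, then y divides both ends and is coprime to h and
     e, hence divides h' and all new weights. If z = p2, then h divides L and y^2, so h = 1 and e =
     y^2; thus y divides x^2. *)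
  exfalso; have rj := branch_rest ej j1.
  move: oz oi (zi); rewrite !branch_odd.
  case/orP=> /eqP zE; case/orP=> /eqP iE; rewrite zE iE ?eqxx // => _.
    have yh : coprime y (h ^ 2 * e) by rewrite -kz zE k0 coprimeXr // coprime_sym.
    move: yh; rewrite coprimeMr coprime_pexpr // => /andP[yh ye].
    have yi : (y %| k i)%N by rewrite iE k2 dvdn_exp.
    have yj : (y %| k j)%N by rewrite kc // mulnAC dvdn_mull.
    apply: (mutation_common km y1 yi yj).
    by have := dvdn_add yi yj; rewrite kij Gauss_dvdl // Gauss_dvdr.
  have p1i : p1 != i by rewrite iE eq_sym.
  have hL : (h %| L)%N by rewrite -k1; apply: (mutation_dvd km p1i); rewrite eq_sym.
  have hy : (h %| y ^ 2)%N by rewrite -k2 -zE; exact: (mutation_dvd km zi zj).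
  have h1 : h = 1%N.
    have : (h %| gcdn (y ^ 2) L)%N by rewrite dvdn_gcd hy.
    by rewrite (eqP (coprimeXl _ yL)) dvdn1 => /eqP.
  have := mutation_dvd_sum km; rewrite h1 mul1n => esum.
  have ye : (y %| e)%N by have := kz; rewrite h1 mul1n zE k2 => <-; rewrite dvdn_exp.
  have := dvdn_trans ye esum; rewrite iE k0 kc // dvdn_addl; last by rewrite mulnAC dvdn_mull.
  rewrite -[(x ^ 2)%N]mul1n Gauss_dvdl; first by rewrite (negPf ydvd1).
  by rewrite coprimeXr // coprime_sym.
have cyxx : coprime y (x ^ 2 + y ^ 2).
  rewrite addnC -[(y ^ 2)%N]mulnn /coprime.
  by rewrite gcdnMDl; apply: coprimeXr; rewrite coprime_sym.
have sum_pp : odd (k i) -> (k i + k j = x ^ 2 + y ^ 2)%N.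
  have [[_ _ ij] _ _ _ _] := km.
  move=> oi; have oj : odd (k j) by rewrite -(mutation_parity' km ez).
  move: oi oj ij; rewrite !branch_odd.
  by case/orP=> /eqP->; case/orP=> /eqP->; rewrite ?eqxx // k0 k2 // addnC.
have [[zi zj ij] [hh _] [mi mj kij] [kz mz] kl] := km.
have hesum := mutation_dvd_sum km.
exfalso; have [oi|ei] := boolP (odd (k i)).
  move: hesum; rewrite sum_pp // => hesum.
  have odd_j : odd (k j) by rewrite -(mutation_parity' km ez).
  have hL : (h %| L)%N.
    rewrite -k1; apply: (mutation_dvd km).
      by apply: contraTneq oi => <-; rewrite k1.
    by apply: contraTneq odd_j => <-; rewrite k1.
  (* The edge is {p0, p2}, with sum 2 modulo L. For z = p1 the product h e divides L and hence 2, so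
     L = h^2 e divides 4. Otherwise h divides 2, and the odd y > 1 would divide h. *)
  have [zp1|zp1] := eqVneq z p1.
    have heL : (h * e %| L)%N by rewrite -k1 -zp1 kz -mulnA dvdn_mull.
    have he2 : (h * e %| 2)%N by rewrite -(dvdn_addr _ (dvdn_mulr q heL)) -xyL.
    apply: (negP L4); rewrite -k1 -zp1 kz -mulnA -[4%N]/(2 * 2)%N dvdn_mul //.
    exact: dvdn_trans (dvdn_mulr e (dvdnn h)) he2.
  have h2 : (h %| 2)%N.
    rewrite -(dvdn_addr _ (dvdn_mulr q hL)) -xyL.
    exact: dvdn_trans (dvdn_mulr e (dvdnn h)) hesum.
  have yz : (y %| h * (h * e))%N.
    by rewrite mulnA -kz kc ?branch_rest // mulnAC dvdn_mull.
  have yhe : coprime y (h * e) by apply: coprime_dvdr hesum cyxx.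
  rewrite Gauss_dvdl // in yz; have := dvdn_leq (ltn0Sn 1) (dvdn_trans yz h2).
  by move: y1 oy; case: (y) => [|[|[|]]].
have ej : ~~ odd (k j) by rewrite -(mutation_parity' km ez).
have h1 : h = 1%N.
  have hp p : odd (k p) -> (h %| k p)%N.
    by move=> op; apply: (mutation_dvd km); apply: contraTneq op => ->.
  have : (h %| gcdn (x ^ 2) (y ^ 2))%N.
    by rewrite dvdn_gcd -k0 -k2 !hp // branch_odd eqxx ?orbT.
  by rewrite (eqP (coprimeXl _ (coprimeXr _ xy))) dvdn1 => /eqP.
(* For z = p1, e = L is coprime to y, so y divides h' and all new weights. Otherwise e = k_z divides
   the sum along the edge, which [yL] excludes if p1 lies on the edge and [csum] if it does not. *)
have [zp1|zp1] := eqVneq z p1.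
  have ri : rest i by rewrite branch_rest // -zp1 eq_sym.
  have rj : rest j by rewrite branch_rest // -zp1 eq_sym.
  have yd l : rest l -> (y %| k l)%N by move=> rl; rewrite kc // mulnAC dvdn_mull.
  apply: (mutation_common km y1 (yd _ ri) (yd _ rj)).
  have := dvdn_add (yd _ ri) (yd _ rj); rewrite kij h1 mul1n Gauss_dvdl //.
  by have := kz; rewrite h1 mul1n zp1 k1 => <-.
have rz := branch_rest ez zp1.
have ze : e = k z by rewrite kz h1 mul1n.
move: hesum; rewrite h1 mul1n ze.
have contra l : rest l -> ~ (k z %| L + k l)%N.
  move=> rl; have yd t : rest t -> (y %| k t)%N by move=> rt; rewrite kc // mulnAC dvdn_mull.
  move=> /(dvdn_trans (yd _ rz)); rewrite dvdn_addl ?yd // => yL'.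
  by move: ydvd1; rewrite -(eqP yL) dvdn_gcd dvdnn yL'.
have [ip|ip] := eqVneq i p1.
  by rewrite ip k1; apply: contra; apply: branch_rest => //; rewrite -ip eq_sym.
have [jp|jp] := eqVneq j p1.
  by rewrite jp k1 addnC; apply: contra; apply: branch_rest.
have ri := branch_rest ei ip; have rj := branch_rest ej jp.
rewrite !kc // -mulnDr dvdn_pmul2l ?muln_gt0 ?x_gt0 //.
exact/negP/csum.
Qed.
End BranchArithmetic.

(** * Neighbours of X_n *)

Section RootArithmetic.
Variables (n : nat) (k m : 'I_n.+1 -> nat) (p0 p2 : 'I_n.+1).
Notation rest l := ((l != p0) && (l != p2)).
Hypotheses (k0 : k p0 = 1%N) (k2 : k p2 = 1%N).
Hypothesis ek : forall l, rest l -> ~~ odd (k l).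
Hypothesis k4 : forall l, rest l -> ~~ (k l %| 4)%N.
Hypothesis ksum : forall l i j, rest l -> rest i -> rest j ->
  l != i -> l != j -> i != j -> ~~ (k l %| k i + k j)%N.

Lemma root_odd l : odd (k l) = (l == p0) || (l == p2).
Proof.
have [->|l0] := eqVneq l p0; first by rewrite k0.
have [->|l2] := eqVneq l p2; first by rewrite k2.
by apply/negbTE/ek; rewrite l0.
Qed.

(** The two unit weights are interchangeable, so either may be the mutated vertex z; the other one,
    [o], is an end of the edge, by parity. *)
Lemma root_neighbors : weight_mutation k m ->
  exists l z o, [/\ rest l, (z = p0 /\ o = p2) \/ (z = p2 /\ o = p0),
    [/\ m z = ((k l).+1 ^ 2)%N, m o = 1%N & m l = k l]
    & forall t, rest t -> t != l -> m t = ((k l).+1 * k t)%N].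
Proof.
move=> [z [i [j [h [h' [e [d km]]]]]]].
have [oz|ez] := boolP (odd (k z)).
  wlog oi : i j km / odd (k i).
    move=> H; have [oi|ei] := boolP (odd (k i)); first exact: H km oi.
    have [oj|ej] := boolP (odd (k j)); first exact: H (mutation_data_swap km) oj.
    by case: (mutation_parity km oz ei ej).
  have [[zi zj ij] _ [mi mj _] _ _] := km.
  have zio : (z = p0 /\ i = p2) \/ (z = p2 /\ i = p0).
    move: oz oi zi; rewrite !root_odd.
    by case/orP=> /eqP->; case/orP=> /eqP->; rewrite ?eqxx //; [left|right].
  have rj : rest j by case: zio => -[zE iE]; rewrite -?zE -?iE ![j == _]eq_sym ?zj ?ij.
  have [kz ki] : k z = 1%N /\ k i = 1%N by case: zio => -[-> ->].
  have [|||mz ml] := mutation_new km (x := 1) (y := (k j).+1); rewrite ?kz ?ki ?mul1n //.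
  exists j, z, i; split=> // [|t /andP[t0 t2] tj]; first by rewrite mi mj ki.
  by apply: ml; rewrite ?mul1n //; case: zio => -[zE iE]; rewrite ?zE ?iE.
exfalso; have oij := mutation_parity' km ez; have hesum := mutation_dvd_sum km.
have [[zi zj ij] [hh _] [mi mj kij] [kz mz] kl] := km.
have rest_even l : ~~ odd (k l) -> rest l by rewrite root_odd negb_or.
have rz := rest_even _ ez.
have [oi|ei] := boolP (odd (k i)).
  have sum2 : (k i + k j = 2)%N.
    have oj : odd (k j) by rewrite -oij.
    move: oi oj ij; rewrite !root_odd.
    by case/orP=> /eqP->; case/orP=> /eqP->; rewrite ?eqxx // k0 k2.
  rewrite sum2 in hesum; apply: (negP (k4 rz)); rewrite kz -mulnA -[4%N]/(2 * 2)%N dvdn_mul //.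
  exact: dvdn_trans (dvdn_mulr e (dvdnn h)) hesum.
have ej : ~~ odd (k j) by rewrite -oij.
have h1 : h = 1%N.
  apply/eqP; rewrite -dvdn1 -k0; apply: (mutation_dvd km).
    by apply: contraNneq ei => <-; rewrite k0.
  by apply: contraNneq ej => <-; rewrite k0.
have ze : e = k z by rewrite kz h1 mul1n.
by move: hesum; rewrite h1 mul1n ze; apply/negP/ksum; rewrite ?rest_even.
Qed.

End RootArithmetic.

(** * Sylvester numbers and the weights of X_n^(m,a) *)

Lemma sylv_prodS n : sylv_prod n.+1 = (sylv_prod n * sylv n)%N.
Proof. by []. Qed.

Lemma sylv_prod_gt0 n : (0 < sylv_prod n)%N.
Proof. by elim: n => // n IHn; rewrite sylv_prodS muln_gt0 IHn. Qed.

Lemma sylv_prod_dvd i n : (i <= n)%N -> (sylv_prod i %| sylv_prod n)%N.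
Proof.
elim: n => [|n IHn]; first by rewrite leqn0 => /eqP->.
by rewrite leq_eqVlt ltnS => /predU1P[->//|/IHn d]; rewrite sylv_prodS dvdn_mulr.
Qed.

Lemma sylv_dvd_prod i n : (i < n)%N -> (sylv i %| sylv_prod n)%N.
Proof. by move/sylv_prod_dvd; apply: dvdn_trans; rewrite sylv_prodS dvdn_mull. Qed.

Lemma sylv_gt1 i : (1 < sylv i)%N.
Proof. by rewrite ltnS sylv_prod_gt0. Qed.

Lemma coprime_sylv i j : i != j -> coprime (sylv i) (sylv j).
Proof.
wlog ij : i j / (i < j)%N.
  move=> H; rewrite neq_ltn => /orP[ij|ji]; first by rewrite H // ltn_eqF.
  by rewrite coprime_sym H // ltn_eqF.
move=> _; apply: coprime_dvdl (sylv_dvd_prod ij) _.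
exact: coprimenS.
Qed.

Lemma sylv_inj : injective sylv.
Proof.
move=> i j ij; apply/eqP/negPn/negP => /coprime_sylv; rewrite ij /coprime gcdnn.
by rewrite gtn_eqF ?sylv_gt1.
Qed.

(** [base_weight] as a natural number; the division is exact for k < n - 1. *)
Definition bw n k : nat := (2 * sylv_t n.-1 %/ sylv k)%N.

Lemma bwE n k : (k < n.-1)%N -> (bw n k * sylv k = 2 * sylv_t n.-1)%N.
Proof. by move=> kn; rewrite divnK // dvdn_mull // sylv_dvd_prod. Qed.

Lemma bw_gt0 n k : (k < n.-1)%N -> (0 < bw n k)%N.
Proof.
move=> nk; have : (0 < bw n k * sylv k)%N by rewrite bwE // muln_gt0 sylv_prod_gt0.
by rewrite muln_gt0 => /andP[].
Qed.

Lemma base_weightE n k : (k < n.-1)%N -> base_weight n k = (bw n k)%:R.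
Proof.
by move=> kn; rewrite /base_weight -(bwE kn) natrM mulfK // pnatr_eq0.
Qed.

Lemma bw_inj n i j : (i < n.-1)%N -> (j < n.-1)%N -> bw n i = bw n j -> i = j.
Proof.
move=> ni nj ij; apply/sylv_inj/eqP; rewrite -(eqn_pmul2l (bw_gt0 ni)).
by rewrite bwE // ij bwE.
Qed.

Lemma sylv_dvd_bw n j k : (j < n.-1)%N -> (k < n.-1)%N -> j != k -> (sylv j %| bw n k)%N.
Proof.
move=> nj nk jk; rewrite -(Gauss_dvdl _ (coprime_sylv jk)) bwE //.
by rewrite dvdn_mull // sylv_dvd_prod.
Qed.

Lemma bw_even n k : (k < n.-1)%N -> ~~ odd (bw n k).
Proof.
move=> nk; rewrite -dvdn2; have [->|k0] := eqVneq k 0%N; last first.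
  by rewrite -sylv0 sylv_dvd_bw // ?(leq_ltn_trans _ nk) // eq_sym.
have n1 : (0 < n.-1)%N by apply: leq_ltn_trans nk.
by rewrite /bw sylv0 mulKn // -sylv0 sylv_dvd_prod.
Qed.

(** The Sylvester numbers y_1 = 3 and y_2 = 7 both occur in t_(n-1), and cancelling y_k removes at
    most one of them. *)
Lemma bw_ndvd4 n k : (4 <= n)%N -> (k < n.-1)%N -> ~~ (bw n k %| 4)%N.
Proof.
case: n => [|[|[|[|n]]]] // _ nk; apply/negP => b4.
have ndvd j : (1 <= j <= 2)%N -> j != k -> False.
  move=> j12 jk; have jn : (j < n.+4.-1)%N by case/andP: j12 => _ /leq_ltn_trans; apply.
  have := dvdn_trans (sylv_dvd_bw jn nk jk) b4.
  by case: j j12 {jk jn} => [|[|[|j]]].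
have [k1|/ndvd] := eqVneq 1%N k; last exact.
by apply: (ndvd 2%N); rewrite // -k1.
Qed.

(** Clearing denominators in 1 / y_i + 1 / y_j = c / y_l shows that y_i divides y_l (y_i + y_j),
    hence y_j, against coprimality. *)
Lemma bw_sum n l i j : (l < n.-1)%N -> (i < n.-1)%N -> (j < n.-1)%N ->
  l != i -> l != j -> i != j -> ~~ (bw n l %| bw n i + bw n j)%N.
Proof.
move=> nl ni nj li lj ij; apply/negP => /dvdnP[c E].
have : (sylv i %| sylv l * (sylv i + sylv j))%N.
  apply/dvdnP; exists (c * sylv j)%N; apply/eqP.
  rewrite -(@eqn_pmul2l (2 * sylv_t n.-1)); last by rewrite muln_gt0 sylv_prod_gt0.
  apply/eqP; transitivity ((bw n i + bw n j) * sylv i * sylv j * sylv l)%N.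
    have -> : (2 * sylv_t n.-1 * (sylv l * (sylv i + sylv j)) =
      2 * sylv_t n.-1 * sylv l * sylv i + 2 * sylv_t n.-1 * sylv l * sylv j)%N by ring.
    by rewrite -{1}(bwE nj) -(bwE ni); ring.
  by rewrite E -(bwE nl); ring.
rewrite Gauss_dvdr ?coprime_sylv // 1?eq_sym // dvdn_addr // => d.
have := coprime_sylv ij; rewrite /coprime (gcdn_idPl d).
by rewrite gtn_eqF ?sylv_gt1.
Qed.

(** The sum telescopes: 1 / y_N is the difference of the reciprocals of two consecutive products. *)
Lemma sum_inv_sylv N : \sum_(i < N) (sylv i)%:R^-1 = 1 - (sylv_prod N)%:R^-1 :> rat.
Proof.
elim: N => [|N IHN]; first by rewrite big_ord0 subrr.
rewrite big_ord_recr [LHS]/= IHN sylv_prodS natrM -[sylv N]/((sylv_prod N).+1) -natr1.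
have p0 : (sylv_prod N)%:R != 0 :> rat by rewrite pnatr_eq0 -lt0n sylv_prod_gt0.
have p1 : (sylv_prod N)%:R + 1 != 0 :> rat by rewrite natr1 pnatr_eq0.
by field; rewrite p0 p1.
Qed.

(** * The recurrence behind the square weights *)

Section Recurrence.
Variable L : nat.

(* The pair (x_m, x_(m+1) - x_m), where x_0 = x_1 = 1 and
   x_(m+2) = (L + 2) x_(m+1) - x_m; then lambda_0^(m,a) = x_m ^ 2. *)
Fixpoint xd m : nat * nat :=
  if m is m'.+1 then let: (x, d) := xd m' in ((x + d)%N, (d + L * (x + d))%N) else (1%N, 0%N).

Definition xs m : nat := (xd m).1.

Lemma xsS m : xs m.+1 = (xs m + (xd m).2)%N.
Proof. by rewrite /xs /=; case: (xd m). Qed.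

Lemma xdS m : (xd m.+1).2 = ((xd m).2 + L * xs m.+1)%N.
Proof. by rewrite /xs /=; case: (xd m). Qed.

Lemma xs_gt0 m : (0 < xs m)%N.
Proof. by elim: m => // m IHm; rewrite xsS addn_gt0 IHm. Qed.

Lemma xs_rec m : (xs m.+2 + xs m = (L + 2) * xs m.+1)%N.
Proof. by rewrite xsS xdS xsS; ring. Qed.

Lemma xs_markov m : (xs m ^ 2 + xs m.+1 ^ 2 + L = (L + 2) * (xs m * xs m.+1))%N.
Proof.
elim: m => [|m IHm]; first by rewrite /xs /=; ring.
have := xs_rec m; move: (xs m) (xs m.+1) (xs m.+2) IHm => x y z E F.
by nia.
Qed.

(** Vieta: x_m and x_(m+2) are the two roots of the equation of [xs_markov], read as a quadratic
    with x_(m+1) fixed. *)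
Lemma xs_mul m : (xs m.+1 ^ 2 + L = xs m * xs m.+2)%N.
Proof.
have := xs_rec m; have := xs_markov m; have := xs_gt0 m.
move: (xs m) (xs m.+1) (xs m.+2) => x y z; nia.
Qed.

(** The congruence x_m = 1 modulo L is the source of coprimality with L, of oddness, and of the
    value 2 modulo L of x_m^2 + x_(m+1)^2. *)
Lemma xs_mod m : exists q, xs m = (1 + L * q)%N.
Proof.
suff [[q qE] _] : (exists q, xs m = (1 + L * q)%N) /\ (exists q, (xd m).2 = (L * q)%N) by exists q.
elim: m => [|m [[q qE] [q' qE']]]; first by split; exists 0%N; rewrite muln0.
have xE : xs m.+1 = (1 + L * (q + q'))%N by rewrite xsS qE qE'; ring.
split; first by exists (q + q')%N.
by exists (q' + xs m.+1)%N; rewrite xdS qE'; ring.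
Qed.

Lemma coprime_xs_L m : coprime (xs m) L.
Proof. by have [q ->] := xs_mod m; rewrite coprime_sym /coprime addnC mulnC gcdnMDl gcdn1. Qed.

Lemma coprime_xs m : coprime (xs m) (xs m.+1).
Proof.
case: m => [|m]; first exact: coprime1n.
rewrite /coprime -dvdn1 -(eqP (coprime_xs_L m.+1)) dvdn_gcd dvdn_gcdl /=.
rewrite -(dvdn_addr _ (_ : _ %| xs m.+1 ^ 2)%N); first by rewrite xs_mul dvdn_mull ?dvdn_gcdr.
by rewrite -mulnn dvdn_mulr ?dvdn_gcdl.
Qed.

Lemma odd_xs m : ~~ odd L -> odd (xs m).
Proof. by move=> eL; have [q ->] := xs_mod m; rewrite oddD oddM (negPf eL). Qed.

Lemma xs_sq_mod m : exists q, (xs m ^ 2 + xs m.+1 ^ 2 = L * q + 2)%N.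
Proof.
have [q ->] := xs_mod m; have [q' ->] := xs_mod m.+1.
by exists (2 * q + 2 * q' + L * (q ^ 2 + q' ^ 2))%N; ring.
Qed.

Lemma xs_ltS m : (0 < L)%N -> (xs m.+1 < xs m.+2)%N.
Proof.
move=> L0; rewrite [xs m.+2]xsS -[X in (X < _)%N]addn0 ltn_add2l xdS.
by rewrite addn_gt0 muln_gt0 L0 xs_gt0 orbT.
Qed.

Lemma xs2 : xs 2 = L.+1.
Proof. by rewrite /xs /=; ring. Qed.

End Recurrence.

Definition wt n m a i : nat :=
  let L := bw n a in
  match i with
  | 0 => xs L m ^ 2
  | 1 => L
  | 2 => xs L m.+1 ^ 2
  | j.+3 => xs L m * xs L m.+1 * bw n (bump a j)
  end.

Definition wtX n i : nat := if (i < 2)%N then 1%N else bw n (n - i).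

(* The index k with lambda_i^(0,a) = 2 t_(n-1) / y_k, for i <> 0, 2. *)
Definition kap a i : nat := if i is j.+3 then bump a j else a.

Lemma kap_bound n a i : (2 <= n)%N -> (a <= n - 2)%N -> (i <= n)%N -> (kap a i < n.-1)%N.
Proof.
case: i => [|[|[|j]]] n2 an jn /=; try lia.
by rewrite /bump; case: leqP => /=; lia.
Qed.

(** At 0 and 2, where the initial weight is 1, [kap] has the filler value [a]; hence the
    exclusions. *)
Lemma kap_inj a i j : i != 0%N -> i != 2%N -> j != 0%N -> j != 2%N -> kap a i = kap a j -> i = j.
Proof.
case: i => [|[|[|i]]] //; case: j => [|[|[|j]]] // _ _ _ _ /=.
- by move/esym/eqP; rewrite eq_sym (negPf (neq_bump a j)).
- by move/esym/eqP; rewrite (negPf (neq_bump a i)).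
by move/(can_inj (bumpK a)) ->.
Qed.

(** The division by lambda_0 = x_m^2 comes out exactly because x_(m+1)^2 + L = x_m x_(m+2). *)
Lemma lamE n m a i : (2 <= n)%N -> (a <= n - 2)%N -> (i <= n)%N ->
  lam n m a i = (wt n m a i)%:R.
Proof.
move=> n2 an; elim: m i => [|m IHm] i ni.
  have kb := kap_bound n2 an ni.
  by case: i ni kb => [|[|[|j]]] ni kb; rewrite /= /lam /= ?base_weightE // mul1n.
have x0 p : (xs (bw n a) p)%:R != 0 :> rat by rewrite pnatr_eq0 -lt0n xs_gt0.
have xm : (xs (bw n a) m.+1)%:R ^+ 2 + (bw n a)%:R =
    (xs (bw n a) m)%:R * (xs (bw n a) m.+2)%:R :> rat.
  by rewrite -natrX -natrD xs_mul natrM.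
rewrite /lam iterS -/(lam n m a).
case: i ni => [|[|[|j]]] ni.
- by rewrite [LHS]/= IHm.
- by rewrite [LHS]/= IHm // ltnW.
- rewrite [LHS]/= !IHm // 1?ltnW // [RHS]/= !natrX addrC xm.
  by field; apply: x0.
rewrite [LHS]/= !IHm // 1?ltnW // [wt n m a _]/= [wt n m a 1]/= [wt n m a 2]/= [RHS]/=.
rewrite !natrX !natrM [_ + _ ^+ 2]addrC xm.
by field; apply: x0.
Qed.

Lemma XweightE n i : (2 <= n)%N -> (i <= n)%N -> X_weight n i = (wtX n i)%:R.
Proof.
move=> n2 ni; rewrite /X_weight /wtX; case: ltnP => // i2.
by rewrite base_weightE //; lia.
Qed.

Lemma is_wps_natP n (k : 'I_n.+1 -> nat) (P : set 'rV[rat]_n) :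
  is_wps_of (fun i => (k i)%:R) P <-> fano P /\ exists2 v, P = simplex v & wvec v k.
Proof.
rewrite is_wps_ofP; split=> -[fP].
  move=> [v [k' [PE vk kk]]]; split=> //; exists v => //.
  suff -> : k = k' by [].
  by apply/funext => i; apply/eqP; rewrite -(eqr_nat rat) kk.
by move=> [v PE vk]; split=> //; exists v, k.
Qed.

Lemma is_XmaP n m a (P : set 'rV[rat]_n) : (2 <= n)%N -> (a <= n - 2)%N ->
  is_Xma m a P <-> fano P /\ exists2 v, P = simplex v & wvec v (fun i : 'I_n.+1 => wt n m a i).
Proof.
move=> n2 an; rewrite -is_wps_natP /is_Xma.
have -> // : (fun i : 'I_n.+1 => lam n m a i) = (fun i : 'I_n.+1 => (wt n m a i)%:R).
by apply/funext => i; rewrite lamE // -ltnS.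
Qed.

Lemma is_XP n (P : set 'rV[rat]_n) : (2 <= n)%N ->
  is_X P <-> fano P /\ exists2 v, P = simplex v & wvec v (fun i : 'I_n.+1 => wtX n i).
Proof.
move=> n2; rewrite -is_wps_natP /is_X.
have -> // : (fun i : 'I_n.+1 => X_weight n i) = (fun i : 'I_n.+1 => (wtX n i)%:R).
by apply/funext => i; rewrite XweightE // -ltnS.
Qed.

Lemma wvec_perm_inv n (v : 'I_n.+1 -> 'rV[int]_n) (k k' : 'I_n.+1 -> nat) (s : 'S_n.+1) :
  (forall i, k (s i) = k' i) -> wvec v k' -> exists2 v', simplex v' = simplex v & wvec v' k.
Proof.
move=> kk vk'; exists (v \o s^-1%g); first exact: simplex_perm.
have := wvec_perm s^-1%g vk'; congr wvec.
by apply/funext => i /=; rewrite -kk permKV.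
Qed.

(** X_n has its unit weights at 0 and 1 and 2 t_(n-1) / y_k at n - k; X_n^(0,a) has its unit weights
    at 0 and 2. The permutation translates between the two orders. *)
Lemma root_labels n a : (2 <= n)%N -> (a <= n - 2)%N ->
  exists s : 'S_n.+1, [/\ forall i : 'I_n.+1, i = 0%N :> nat -> s i = 0%N :> nat,
    forall i : 'I_n.+1, i = 2%N :> nat -> s i = 1%N :> nat
    & forall i : 'I_n.+1, i != 0%N :> nat -> i != 2%N :> nat -> s i = (n - kap a i)%N :> nat].
Proof.
move=> n2 an; pose f i := if i == 0%N then 0%N else if i == 2%N then 1%N else (n - kap a i)%N.
have fb (i : 'I_n.+1) : (f i < n.+1)%N by rewrite /f; case: ifP => // _; case: ifP => _; lia.
have finj : injective (fun i : 'I_n.+1 => Ordinal (fb i)).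
  move=> i j /(congr1 val) /= fij; apply/ord_inj; move: fij; rewrite /f.
  have bi := kap_bound n2 an (ltn_ord i : i <= n)%N.
  have bj := kap_bound n2 an (ltn_ord j : j <= n)%N.
  case: (eqVneq (i : nat) 0%N) => i0; case: (eqVneq (j : nat) 0%N) => j0;
    case: (eqVneq (i : nat) 2%N) => i2; case: (eqVneq (j : nat) 2%N) => j2; try lia.
  by move=> E; apply: (@kap_inj a) => //; lia.
exists (perm finj); split=> [i i0|i i2|i i0 i2]; rewrite permE /= /f ?i0 ?i2 //.
by rewrite (negPf i0) (negPf i2).
Qed.

Lemma wt0_root n a (s : 'S_n.+1) : (2 <= n)%N -> (a <= n - 2)%N ->
  (forall i : 'I_n.+1, i = 0%N :> nat -> s i = 0%N :> nat) ->
  (forall i : 'I_n.+1, i = 2%N :> nat -> s i = 1%N :> nat) ->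
  (forall i : 'I_n.+1, i != 0%N :> nat -> i != 2%N :> nat -> s i = (n - kap a i)%N :> nat) ->
  forall i, wtX n (s i) = wt n 0 a i.
Proof.
move=> n2 an s0 s2 s1 i; have bi := kap_bound n2 an (ltn_ord i : i <= n)%N.
have [i0|i0] := eqVneq (i : nat) 0%N; first by rewrite s0 // i0.
have [i2|i2] := eqVneq (i : nat) 2%N; first by rewrite s2 // i2.
rewrite s1 // /wtX ifF; last by lia.
rewrite subKn; last by lia.
by move: i0 i2; case: (i : nat) => [|[|[|j]]] //= _ _; rewrite mul1n.
Qed.

Lemma is_Xma0 n a (P : set 'rV[rat]_n) : (2 <= n)%N -> (a <= n - 2)%N ->
  is_Xma 0 a P <-> is_X P.
Proof.
move=> n2 an; have [s [s0 s2 s1]] := root_labels n2 an.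
have sE := wt0_root n2 an s0 s2 s1.
rewrite (is_XmaP _ _ n2 an) (is_XP _ n2); split=> -[fP [v PE vk]]; split=> //.
  have [v' vv' vk'] := wvec_perm_inv (k := fun i : 'I_n.+1 => wtX n i) sE vk.
  by exists v'; rewrite ?vv'.
exists (v \o s); first by rewrite simplex_perm.
have := wvec_perm s vk; congr wvec; apply/funext => i; exact: sE.
Qed.

(** The weights at 0, 1 and 2 are pairwise coprime, and two of these positions avoid any given
    one. *)
Lemma Xma_exists n m a : (2 <= n)%N -> (a <= n - 2)%N -> exists P : set 'rV[rat]_n, is_Xma m a P.
Proof.
move=> n2 an; have an' : (a < n.-1)%N by lia.
have L0 := bw_gt0 an'; have [|i|v vk fv] := @wps_exists n (fun i => wt n m a i).
- move=> i; have bi := kap_bound n2 an (ltn_ord i : i <= n)%N.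
  by case: (i : nat) bi => [|[|[|j]]] bi; rewrite /= ?muln_gt0 ?expn_gt0 ?xs_gt0 ?bw_gt0.
- have o0 : (0 < n.+1)%N by []. have o1 : (1 < n.+1)%N by lia. have o2 : (2 < n.+1)%N by lia.
  have cx p : coprime (xs (bw n a) p ^ 2) (bw n a) by rewrite coprimeXl // coprime_xs_L.
  have [i0|i0] := eqVneq (i : nat) 0%N.
    exists (Ordinal o1), (Ordinal o2); split; rewrite -?val_eqE /= ?i0 //.
    by rewrite coprime_sym.
  have [i1|i1] := eqVneq (i : nat) 1%N.
    exists (Ordinal o0), (Ordinal o2); split; rewrite -?val_eqE /= ?i1 //.
    by rewrite coprimeXl // coprimeXr // coprime_xs.
  by exists (Ordinal o0), (Ordinal o1); split; rewrite -?val_eqE /= 1?eq_sym.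
by exists (simplex v); apply/is_XmaP => //; split=> //; exists v.
Qed.

Lemma wt_neighbors n m a (q : 'I_n.+1 -> nat) : (4 <= n)%N -> (a <= n - 2)%N ->
  weight_mutation (fun i : 'I_n.+1 => wt n m.+1 a i) q ->
  exists s : 'S_n.+1, (forall i, q (s i) = wt n m.+2 a i) \/ (forall i, q (s i) = wt n m a i).
Proof.
move=> n4 an wm; have n2 : (2 <= n)%N by lia.
have an' : (a < n.-1)%N by lia.
pose L := bw n a; have L0 : (0 < L)%N := bw_gt0 an'; have eL : ~~ odd L := bw_even an'.
have o1 : (1 < n.+1)%N by lia. have o2 : (2 < n.+1)%N by lia.
pose p0 : 'I_n.+1 := ord0; pose p1 := Ordinal o1; pose p2 := Ordinal o2.
have kb (l : 'I_n.+1) := kap_bound n2 an (ltn_ord l : l <= n)%N.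
have [r rE] := xs_sq_mod L m.+1.
have restP (l : 'I_n.+1) : [&& l != p0, l != p1 & l != p2] -> (3 <= l)%N.
  by rewrite -!val_eqE /=; lia.
have kc (l : 'I_n.+1) : [&& l != p0, l != p1 & l != p2] ->
    wt n m.+1 a l = (xs L m.+1 * xs L m.+2 * bw n (kap a l))%N.
  by move/restP; case: (l : nat) => [|[|[|j]]].
have := @branch_neighbors n (fun i : 'I_n.+1 => wt n m.+1 a i) q p0 p1 p2
  (xs L m.+1) (xs L m.+2) (xs L m) (xs L m.+3) L r (fun l => bw n (kap a l)).
have csum (l i j : 'I_n.+1) : [&& l != p0, l != p1 & l != p2] ->
    [&& i != p0, i != p1 & i != p2] -> [&& j != p0, j != p1 & j != p2] ->
    l != i -> l != j -> i != j -> ~~ (bw n (kap a l) %| bw n (kap a i) + bw n (kap a j))%N.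
  move=> /restP l3 /restP i3 /restP j3; rewrite -!val_eqE /= => li lj ij.
  by apply: bw_sum; rewrite ?kb //; apply/eqP => /kap_inj E; move: (E); lia.
have y1 : (1 < xs L m.+2)%N := leq_ltn_trans (xs_gt0 L m.+1) (xs_ltS m L0).
move=> /(_ isT erefl erefl erefl kc (odd_xs m.+1 eL) (odd_xs m.+2 eL) eL
  (fun l _ => bw_even (kb l)) (bw_ndvd4 n4 an') csum rE (coprime_xs L m.+1)
  (coprime_xs_L L m.+2) y1).
have e1 : (xs L m.+1 ^ 2 + L = xs L m.+2 * xs L m)%N by rewrite xs_mul mulnC.
move=> /(_ e1 (xs_mul L m.+1) wm) neigh.
have tE (f : nat -> nat) : f 0 = q p2 -> f 1 = q p1 -> f 2 = q p0 ->
    (forall l : 'I_n.+1, [&& l != p0, l != p1 & l != p2] -> f l = q l) ->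
    forall i, q (tperm p0 p2 i) = f i.
  move=> f0 f1 f2 fl i; case: tpermP => [->|->|/eqP i0 /eqP i2] //.
  have [->|i1] := eqVneq i p1; first by rewrite -f1.
  by rewrite fl // i0 i1.
(* One square is replaced in place, whereas the labelling along the branch lists the squares in the
   order x_m, x_(m+1); so in both directions positions 0 and 2 change roles. *)
exists (tperm p0 p2); case: neigh => -[q0 q1 q2 ql]; [left|right]; apply: tE => //.
  move=> l rl; rewrite ql //; move/restP: rl; case: (l : nat) => [|[|[|j]]] //= _.
  by rewrite -/L; congr (_ * _)%N; rewrite mulnC.
move=> l rl; rewrite ql //; move/restP: rl; case: (l : nat) => [|[|[|j]]] //= _.
by rewrite -/L; congr (_ * _)%N; rewrite mulnC.
Qed.

Lemma wtX_neighbors n (q : 'I_n.+1 -> nat) : (4 <= n)%N ->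
  weight_mutation (fun i : 'I_n.+1 => wtX n i) q ->
  exists a, (a <= n - 2)%N /\ exists s : 'S_n.+1, forall i, q (s i) = wt n 1 a i.
Proof.
move=> n4 wm; have n2 : (2 <= n)%N by lia.
have o1 : (1 < n.+1)%N by lia. have o2 : (2 < n.+1)%N by lia.
pose p0 : 'I_n.+1 := ord0; pose p1 := Ordinal o1; pose p2 := Ordinal o2.
have restP (l : 'I_n.+1) : (l != p0) && (l != p1) = (2 <= l)%N.
  by rewrite -!val_eqE /=; lia.
have kE (l : 'I_n.+1) : (2 <= l)%N -> wtX n l = bw n (n - l).
  by move=> l2; rewrite /wtX ltnNge l2.
have kb (l : 'I_n.+1) : (2 <= l)%N -> (n - l < n.-1)%N by have := ltn_ord l; lia.
have := @root_neighbors n (fun i : 'I_n.+1 => wtX n i) q p0 p1 erefl erefl.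
case=> //.
- by move=> l; rewrite restP => l2; rewrite kE // bw_even ?kb.
- by move=> l; rewrite restP => l2; rewrite kE // bw_ndvd4 ?kb.
- move=> l i j; rewrite !restP -!val_eqE /= => l2 i2 j2 li lj ij.
  rewrite !kE //; have := ltn_ord l; have := ltn_ord i; have := ltn_ord j => ? ? ?.
  by apply: bw_sum; lia.
move=> l [z [o [rl zo [qz qo ql] qt]]]; rewrite restP in rl.
(* Position l of X_n carries 2 t_(n-1) / y_(n-l), so the edge through l leads into branch n - l. *)
exists (n - l)%N; have an : (n - l <= n - 2)%N by lia.
split=> //; have [s [s0 s2 s1]] := root_labels n2 an.
pose L := bw n (n - l); have lE : wtX n l = L by rewrite kE.
have x2 : xs L 2 = L.+1 := xs2 L; have x1 : xs L 1 = 1%N by rewrite xsS.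
have wt0 : wt n 1 (n - l) p0 = 1%N by rewrite -[LHS]/(xs L 1 ^ 2)%N x1.
have wt2 : wt n 1 (n - l) p2 = (L.+1 ^ 2)%N by rewrite -[LHS]/(xs L 2 ^ 2)%N x2.
have sl : s p1 = l.
  by apply/ord_inj; rewrite s1 //=; have := ltn_ord l; lia.
have sp0 : s p0 = p0 by apply/ord_inj; rewrite s0.
have sp2 : s p2 = p1 by apply/ord_inj; rewrite s2.
have sq (i : 'I_n.+1) : (3 <= i)%N -> q (s i) = wt n 1 (n - l) i.
  move=> i3; have i0 : (i : nat) != 0%N by lia. have i2 : (i : nat) != 2%N by lia.
  have kbi := kap_bound n2 an (ltn_ord i : i <= n)%N.
  have si : (s i : nat) = (n - kap (n - l) i)%N by rewrite s1.
  have s2' : (2 <= s i)%N by rewrite si; lia.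
  rewrite qt ?restP //; last first.
    by apply: contraTneq i3 => /(congr1 s^-1%g); rewrite permK -sl permK => ->.
  rewrite lE kE // si subKn; last by lia.
  case: (i : nat) i3 => [|[|[|j]]] //= _.
  by rewrite -/L x2 mul1n.
case: zo => -[zE oE].
  exists (tperm p0 p2 * s)%g => i; rewrite permM.
  case: tpermP => [->|->|/eqP i0 /eqP i2].
  - by rewrite wt0 sp2 -oE qo.
  - by rewrite wt2 sp0 -zE qz lE.
  have [->|i1] := eqVneq i p1; first by rewrite sl ql lE.
  by apply: sq; move: i0 i1 i2; rewrite -!val_eqE /=; lia.
exists s => i.
have [->|i0] := eqVneq i p0; first by rewrite wt0 sp0 -oE qo.
have [->|i2] := eqVneq i p2; first by rewrite wt2 sp2 -zE qz lE.
have [->|i1] := eqVneq i p1; first by rewrite sl ql lE.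
by apply: sq; move: i0 i1 i2; rewrite -!val_eqE /=; lia.
Qed.

(** * Canonical singularities *)

Lemma cone_self n (A : set 'rV[rat]_n) x : A x -> cone A x.
Proof. by move=> Ax; exists 1%N, (fun=> x), (fun=> 1); split=> //; rewrite big_ord1 scale1r. Qed.

Section ConeCoordinates.
Variables (n : nat) (v : 'I_n.+1 -> 'rV[int]_n) (k : 'I_n.+1 -> nat).
Hypothesis vk : wvec v k.
Variable b : 'I_n.+1 -> 'cV[rat]_n.
Hypothesis b0 : \sum_m b m = 0.
Hypothesis bE : forall x, x = \sum_m ev (b m) x *: toQ (v m).
Hypothesis bv : forall m l, ev (b m) (toQ (v l)) = (m == l)%:R - eps k m.
Variable l : 'I_n.+1.

Definition facet_normal : 'cV[rat]_n := - (eps k l)^-1 *: b l.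

(** Coordinates in the basis of the v_m with m <> l; the one at l vanishes identically. *)
Definition cone_coord m : 'cV[rat]_n := b m + eps k m *: facet_normal.

Let el : eps k l != 0. Proof. by rewrite gt_eqF ?(eps_gt0 vk). Qed.

Lemma facet_normal_v m : m != l -> ev facet_normal (toQ (v m)) = 1.
Proof.
move=> ml; rewrite evZl bv eq_sym (negPf ml) mulr0n.
by field.
Qed.

Lemma cone_coord_v m j : m != l -> ev (cone_coord j) (toQ (v m)) = (j == m)%:R.
Proof. by move=> ml; rewrite evDl evZl facet_normal_v // bv mulr1 subrK. Qed.

Lemma cone_coordE x : x = \sum_m ev (cone_coord m) x *: toQ (v m).
Proof.
under eq_bigr do rewrite evDl evZl scalerDl [eps _ _ * _]mulrC -scalerA.
by rewrite big_split /= -scaler_sumr (sum_eps_v vk) scaler0 addr0 -bE.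
Qed.

Lemma cone_coord_ge0 F x m : F `<=` simplex v ->
  (forall y, F y -> ev facet_normal y = 1) -> cone F x -> 0 <= ev (cone_coord m) x.
Proof.
move=> FP F1 [r [p [a [Fp a0 ->]]]]; rewrite ev_sum sumr_ge0 // => i _.
rewrite evZ mulr_ge0 // evDl evZl F1 // mulr1.
by have /(simplexP vk b0 bE bv)/(_ m) := FP _ (Fp i); lra.
Qed.

Lemma cone_normal F x : (forall y, F y -> ev facet_normal y = 1) -> cone F x ->
  0 <= ev facet_normal x /\ (ev facet_normal x = 0 -> x = 0).
Proof.
move=> F1 [r [p [a [Fp a0 ->]]]].
have -> : ev facet_normal (\sum_i a i *: p i) = \sum_i a i.
  by rewrite ev_sum; apply: eq_bigr => i _; rewrite evZ F1 // mulr1.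
split; first by rewrite sumr_ge0.
move=> /eqP; rewrite psumr_eq0 // => /allP ai0; apply: big1 => i _.
by have /eqP -> := ai0 i (mem_index_enum i); rewrite scale0r.
Qed.

End ConeCoordinates.

(* If every weight divides the sum of the weights, the functional equal to 1 on
   a facet is integral on N. *)
Lemma gorenstein_canonical n (v : 'I_n.+1 -> 'rV[int]_n) k : wvec v k ->
  (forall i, k i %| \sum_j k j)%N -> canonical (simplex v).
Proof.
move=> vk kd s [F [FnP [u [c [uc FE]]]] ->].
have [b [b0 bE bv]] := wvec_frame vk.
(* For a vertex v_l off the face, F lies in the opposite facet, whose normal serves for the whole
   cone. *)
have [l Fl] : exists l, ~ F (toQ (v l)).
  apply: contrapT => allF; apply: FnP; rewrite FE; apply/seteqP; split=> [x []//|x Px].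
  split=> //=; apply: conv_eq Px => _ [m _ <-].
  have : F (toQ (v m)) by apply: contrapT => Fm; apply: allF; exists m.
  by rewrite FE => -[].
pose U := facet_normal k b l; have FP : F `<=` simplex v by rewrite FE => x [].
have Fz x m : F x -> ~ F (toQ (v m)) -> ev (b m) x = - eps k m.
  move=> Fx Fm; have [_ /= ux] : (simplex v `&` [set x | ev u x = c]) x by rewrite -FE.
  have [q [p [a [pv a0 a1 xE]]]] := FP _ Fx.
  have cu y : range (fun i => toQ (v i)) y -> - c <= ev (-1 *: u) y.
    by move=> [j _ <-]; rewrite evZl mulN1r lerN2; apply: uc; apply: simplex_self.
  have [_] := conv_face cu pv a0 a1; rewrite -xE evZl ux mulN1r => /(_ erefl) pc.
  rewrite xE ev_sum -[RHS]mul1r -a1 mulr_suml; apply: eq_bigr => i _; rewrite evZ.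
  have [ai|ai] := ltP 0 (a i); last first.
    by have/eqP -> : a i == 0 by [rewrite eq_le ai a0]; rewrite !mul0r.
  have := pc i ai; have [j _ <-] := pv i; rewrite evZl mulN1r => /oppr_inj uj.
  rewrite bv; case: eqVneq => [mj|_]; last by rewrite sub0r.
  by case: Fm; rewrite FE mj; split=> //; apply: simplex_self.
have el : eps k l != 0 by rewrite gt_eqF ?(eps_gt0 vk).
have F1 y : F y -> ev U y = 1.
  by move=> Fy; rewrite evZl (Fz _ _ Fy Fl) mulrNN mulVf.
(* At v_l the value is 1 minus the quotient of the sum of the weights by k_l; at the other vertices
   it is 1. *)
have Uint y : ev U (toQ y) \is a Num.int.
  have [_ _ _ /(_ y)[x ->]] := vk; rewrite toQ_sum ev_sum rpred_sum // => m _.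
  rewrite toQZ evZ rpredM ?intr_int //.
  have [->|ml] := eqVneq m l; last by rewrite (facet_normal_v vk bv).
  rewrite evZl bv eqxx mulr1n; have /dvdnP[q qE] := kd l.
  have kl : (k l)%:R != 0 :> rat by case: vk => k0 _ _ _; rewrite pnatr_eq0 -lt0n.
  have -> : - (eps k l)^-1 * (1 - eps k l) = 1 - q%:R.
    have q0 : q%:R != 0 :> rat.
      by apply: contraTneq (wsum_gt0 vk) => q0; rewrite qE natrM q0 mul0r ltxx.
    by rewrite /eps qE natrM; field; rewrite kl q0.
  by rewrite rpredB ?rpred1 ?natr_int.
exists U; split; last first.
  apply/seteqP; split=> [_ [[[y _ <-] Cy] /= Uy]|x /= ->].
    have [U0] := cone_normal F1 Cy; apply; have /intrP[z zE] := Uint y.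
    move: U0 Uy; rewrite zE ler0z -[1]/(1%:~R) ltr_int => z0 z1.
    by have -> : z = 0 by apply/eqP; rewrite eq_le -ltzD1 z1.
  split; last by rewrite /= ev0.
  split; first by exists 0 => //; exact: toQ0.
  exists 0%N, (fun=> 0), (fun=> 0); split=> // [[]//|].
  by rewrite big_ord0.
move=> g [Cg g_prim g_ray].
have gE := cone_coordE vk bE l (toQ g).
set gam := cone_coord k b l in gE.
have gam0 x m : cone F x -> 0 <= ev (gam m) x := cone_coord_ge0 vk b0 bE bv m FP F1.
have [m gm] : exists m, 0 < ev (gam m) (toQ g).
  apply: contrapT => ng; suff g0 : g = 0.
    by have := g_prim 0 0; rewrite g0 scaler0 normr0 => /(_ erefl) /esym/eqP; rewrite oner_eq0.
  apply: toQ_inj; rewrite gE toQ0 big1 // => m _.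
  have/eqP -> : ev (gam m) (toQ g) == 0; last by rewrite scale0r.
  by rewrite eq_le gam0 // andbT leNgt; apply/negP => gm; apply: ng; exists m.
have gamF x j : cone F x -> ~ F (toQ (v j)) -> ev (gam j) x = 0.
  move=> [q [p [a [Fp a0 ->]]]] Fj; rewrite ev_sum big1 // => i _.
  by rewrite evZ evDl evZl F1 // (Fz _ _ (Fp i) Fj) mulr1 addNr mulr0.
have Fm : F (toQ (v m)).
  by apply: contrapT => /(gamF _ _ Cg) gm0; rewrite gm0 ltxx in gm.
(* Splitting off the v_m part decomposes g inside the cone, so g lies on the ray of v_m. Then g =
   U(g) v_m with U(g) a non-negative integer, and primitivity gives U(g) = 1. *)
have [|||r r0 rE] := g_ray (ev (gam m) (toQ g) *: toQ (v m))
    (\sum_(j | j != m) ev (gam j) (toQ g) *: toQ (v j)).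
- exists 1%N, (fun=> toQ (v m)), (fun=> ev (gam m) (toQ g)); split=> // [_|]; first exact: ltW.
  by rewrite big_ord1.
(* Coefficients at vertices outside F vanish, so v_m may stand in for those vertices. *)
- pose p j := if pselect (F (toQ (v j))) then toQ (v j) else toQ (v m).
  exists n.+1, p, (fun j => if j != m then ev (gam j) (toQ g) else 0); split.
  + by move=> j; rewrite /p; case: pselect.
  + by move=> j; case: ifP => // _; apply: gam0.
  rewrite big_mkcond; apply: eq_bigr => j _; case: ifP => jm; last by rewrite scale0r.
  by rewrite /p; case: pselect => // Fj; rewrite (gamF _ _ Cg Fj) !scale0r.
- by rewrite [RHS]gE [RHS](bigD1 m).
have Ug : ev (gam m) (toQ g) = r * ev U (toQ g).
  by have := congr1 (ev U) rE; rewrite !evZ (F1 _ Fm) mulr1.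
have Ug0 : ev U (toQ g) != 0.
  by apply: contraTneq gm => Ug0; rewrite Ug Ug0 mulr0 ltxx.
have r_neq0 : r != 0 by apply: contraTneq gm => rz; rewrite Ug rz mul0r ltxx.
have gU : toQ g = ev U (toQ g) *: toQ (v m).
  apply: (scalerI r_neq0); rewrite scalerA -Ug; exact: esym.
have /intrP[z zE] := Uint g; have [U0 _] := cone_normal F1 Cg.
rewrite zE in gU U0 Ug0 *; rewrite ler0z in U0.
have gz : g = z *: v m by apply: toQ_inj; rewrite toQZ.
by rewrite -(ger0_norm U0) (g_prim _ _ gz).
Qed.

(** Each v_i with i <> z generates a ray of the cone opposite v_z, so an admissible functional is 1
    there and its value at [y] is the sum of the c_i. The positive coefficient makes [y] nonzero, as
    these v_i are independent. *)
Lemma noncanonical n (v : 'I_n.+1 -> 'rV[int]_n) k (z : 'I_n.+1) (c : 'I_n.+1 -> rat) y :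
  wvec v k -> fano (simplex v) -> toQ y = \sum_i c i *: toQ (v i) ->
  (forall i, 0 <= c i) -> c z = 0 -> \sum_i c i < 1 -> (exists i, 0 < c i) ->
  ~ canonical (simplex v).
Proof.
move=> vk [_ _ vprim] yE c0 cz c1 [i ci] can; have [b [b0 bE bv]] := wvec_frame vk.
have ez := eps_gt0 vk z.
pose F := simplex v `&` [set x | ev (- b z) x = eps k z].
have evN x : ev (- b z) x = - ev (b z) x by rewrite -scaleN1r evZl mulN1r.
have Fv m : m != z -> F (toQ (v m)).
  move=> mz; split; first exact: simplex_self.
  by rewrite /= evN bv eq_sym (negPf mz) sub0r opprK.
have FP : F `<=` simplex v by move=> x [].
have F1 x : F x -> ev (facet_normal k b z) x = 1.
  by move=> [_ /=]; rewrite evN evZl mulNr -mulrN => ->; rewrite mulVf ?gt_eqF.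
have [|u [u1 uC]] := can (cone F).
- exists F => //; split.
    move=> FE; have : F (toQ (v z)) by rewrite FE; apply: simplex_self.
    move=> [_ /=]; rewrite evN bv eqxx opprB -[RHS]addr0 => /addrI/eqP.
    by rewrite oppr_eq0 oner_eq0.
  exists (- b z), (eps k z); split=> // x /(simplexP vk b0 bE bv)/(_ z).
  by rewrite evN; lra.
have uv m : m != z -> ev u (toQ (v m)) = 1.
  move=> mz; apply: u1; split.
  - by apply: cone_self; apply: Fv.
  - by apply: vprim; apply: vert_simplex vk.
  move=> x x' Cx Cx' xx'; exists (ev (cone_coord k b z m) x).
    exact: (cone_coord_ge0 vk b0 bE bv m FP F1).
  rewrite {1}(cone_coordE vk bE z x) (bigD1 m) //= big1 ?addr0 // => j jm.
  have := cone_coord_ge0 vk b0 bE bv j FP F1 Cx.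
  have := cone_coord_ge0 vk b0 bE bv j FP F1 Cx'.
  have := cone_coord_v vk bv j mz; rewrite -xx' evD (negPf jm) mulr0n.
  move: (ev _ x) (ev _ x') => e e' E e0 e0'; have -> : e = 0 by lra.
  by rewrite scale0r.
have y0 : toQ y = 0.
  suff : (@lattice n `&` cone F `&` [set x | ev u x < 1]) (toQ y) by rewrite uC.
  have iz : i != z by apply: contraTneq ci => ->; rewrite cz ltxx.
  split; [split; first by exists y|].
    exists n.+1, (fun m => if m == z then toQ (v i) else toQ (v m)), c; split=> //.
      by move=> m; case: eqVneq => [_|]; apply: Fv.
    by rewrite yE; apply: eq_bigr => m _; case: eqVneq => // ->; rewrite cz !scale0r.
  rewrite /= yE ev_sum; apply: le_lt_trans c1; apply: ler_sum => m _; rewrite evZ.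
  by have [->|/uv ->] := eqVneq m z; rewrite ?cz ?mul0r ?mulr1.
have := congr1 (ev (cone_coord k b z i)) yE; rewrite y0 ev0 ev_sum.
have iz : i != z by apply: contraTneq ci => ->; rewrite cz ltxx.
rewrite (bigD1 i) //= evZ (cone_coord_v vk bv) // eqxx mulr1 big1 ?addr0.
  by move=> ci0; rewrite -ci0 ltxx in ci.
move=> m mi; rewrite evZ; have [->|mz] := eqVneq m z; first by rewrite cz mul0r.
by rewrite (cone_coord_v vk bv) // eq_sym (negPf mi) mulr0.
Qed.

Lemma sum_bump (n a : nat) (g : nat -> rat) : (a <= n - 2)%N -> (2 <= n)%N ->
  \sum_(j < n - 2) g (bump a j) = \sum_(j < n.-1) g j - g a.
Proof.
case: n => [|[|n]] //; rewrite !subSS subn0 => an _.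
have an' : (a < n.+1)%N by [].
by rewrite (bigD1_ord (Ordinal an')) //= addrAC subrr add0r.
Qed.

Lemma big_ord_wt n (f : nat -> rat) : (2 <= n)%N ->
  \sum_(i < n.+1) f i = f 0%N + f 1%N + f 2%N + \sum_(j < n - 2) f j.+3.
Proof.
case: n => [|[|n]] //; rewrite !subSS subn0 => _.
by rewrite !big_ord_recl /= !addrA.
Qed.

Lemma bwQ n k : (k < n.-1)%N -> (bw n k)%:R = (2 * sylv_t n.-1)%:R / (sylv k)%:R :> rat.
Proof. by move=> kn; rewrite -(bwE kn) natrM mulfK // pnatr_eq0. Qed.

Lemma sum_bw n : \sum_(j < n.-1) (bw n j)%:R = 2 * (sylv_t n.-1)%:R - 2 :> rat.
Proof.
rewrite (eq_bigr (fun j : 'I_n.-1 => (2 * sylv_t n.-1)%:R * (sylv j)%:R^-1)) => [|j _];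
  last exact: bwQ.
rewrite -mulr_sumr sum_inv_sylv natrM.
have : (sylv_t n.-1)%:R != 0 :> rat by rewrite pnatr_eq0 -lt0n sylv_prod_gt0.
rewrite -[sylv_prod _]/(sylv_t n.-1) => ?; by field.
Qed.

Lemma sum_wt n m a : (2 <= n)%N -> (a <= n - 2)%N ->
  (\sum_(i < n.+1) wt n m a i = 2 * sylv_t n.-1 * (xs (bw n a) m * xs (bw n a) m.+1))%N.
Proof.
move=> n2 an; apply/eqP; rewrite -(eqr_nat rat) natr_sum.
rewrite (big_ord_wt (fun i => (wt n m a i)%:R)) //=.
under eq_bigr do rewrite natrM.
rewrite -mulr_sumr (sum_bump (fun j => (bw n j)%:R)) // sum_bw.
have := congr1 (fun p => p%:R : rat) (xs_markov (bw n a) m).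
rewrite !natrD !natrM -!expr2 !natrD => E; apply/eqP; move: E.
set x := (xs _ m)%:R; set y := (xs _ m.+1)%:R; set L := (bw n a)%:R => E.
have -> : x ^+ 2 + L + y ^+ 2 = (L + 2%:R) * (x * y) by rewrite -E; ring.
by ring.
Qed.

Lemma sum_wtX n : (2 <= n)%N -> (\sum_(i < n.+1) wtX n i = 2 * sylv_t n.-1)%N.
Proof.
move=> n2; have [s [s0 s2 s1]] := root_labels n2 (leq0n (n - 2)).
rewrite (reindex_inj (@perm_inj _ s)).
rewrite (eq_bigr _ (fun i _ => wt0_root n2 (leq0n _) s0 s2 s1 i)) sum_wt //.
by rewrite xsS /= muln1.
Qed.

Lemma X_canonical n (P : set 'rV[rat]_n) : (2 <= n)%N -> is_X P -> canonical P.
Proof.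
move=> n2 /(is_XP _ n2)[_ [v -> vk]]; apply: gorenstein_canonical vk _ => i.
rewrite sum_wtX // /wtX; case: ltnP => [_|i2]; first exact: dvd1n.
by rewrite -(@bwE n (n - i)) ?dvdn_mulr //; have := ltn_ord i; lia.
Qed.

(** Subtracting a rational multiple of the weights does not change the point, so integrality is
    needed only modulo that line. *)
Lemma lattice_point n (v : 'I_n.+1 -> 'rV[int]_n) k (c : 'I_n.+1 -> rat) (q : rat) : wvec v k ->
  (forall i, c i - q * (k i)%:R \is a Num.int) -> exists y, toQ y = \sum_i c i *: toQ (v i).
Proof.
move=> vk ci; exists (\sum_i (Num.floor (c i - q * (k i)%:R)) *: v i).
rewrite toQ_sum; under eq_bigr => i _ do rewrite toQZ floorK // scalerBl -scalerA.
by rewrite sumrB -scaler_sumr (sum_wvec vk) scaler0 subr0.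
Qed.

Lemma bw_ge n a : (a < n.-1)%N -> (2 * sylv_prod a <= bw n a)%N.
Proof.
move=> an; rewrite -(leq_pmul2r (_ : 0 < sylv a)%N) // bwE // -mulnA -sylv_prodS leq_mul2l /=.
by apply: dvdn_leq (sylv_prod_gt0 _) (sylv_prod_dvd an).
Qed.

(** * Lattice points below a facet *)

Section Noncanonical.
Variables (n m a : nat).
Hypotheses (n2 : (2 <= n)%N) (an : (a <= n - 2)%N).
Let L : nat := bw n a.
Let x : nat := xs L m.+1.
Let y : nat := xs L m.

Let an' : (a < n.-1)%N. Proof. by move: n2 an; lia. Qed.
Let x0 : x%:R != 0 :> rat. Proof. by rewrite pnatr_eq0 -lt0n xs_gt0. Qed.
Let y0 : y%:R != 0 :> rat. Proof. by rewrite pnatr_eq0 -lt0n xs_gt0. Qed.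

Let markov : y%:R ^+ 2 + x%:R ^+ 2 + L%:R = (L%:R + 2) * (y%:R * x%:R) :> rat.
Proof.
have := congr1 (fun p => p%:R : rat) (xs_markov L m).
by rewrite !natrD !natrM -!expr2 !natrD.
Qed.

(* The lattice points of the cone opposite to the vertex of weight x^2: with
   [u y = 1 + e x^2], the coefficients [f i] below are congruent to
   [u lambda_i / x^2] modulo 1. *)
Lemma wt_noncanonical (v : 'I_n.+1 -> 'rV[int]_n) (f : nat -> rat) :
  wvec v (fun i : 'I_n.+1 => wt n m a i) -> fano (simplex v) ->
  f 0%N = y%:R / x%:R ^+ 2 -> 0 <= f 1%N -> f 2%N = 0 ->
  f 1%N - ((L%:R + 2) * x%:R - y%:R) / x%:R ^+ 2 \is a Num.int ->
  (forall j, (j < n - 2)%N ->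
     0 <= f j.+3 /\ f j.+3 - (bw n (bump a j))%:R / x%:R \is a Num.int) ->
  f 0%N + f 1%N + \sum_(j < n - 2) f j.+3 < 1 -> ~ canonical (simplex v).
Proof.
move=> vk fv f0 f1 f2 f1i fj fsum.
have o2 : (2 < n.+1)%N by move: n2; lia.
have /coprimezP[[u e] /= uE] : coprimez y%:Z (x ^ 2)%N%:Z.
  by rewrite coprimezE /= coprimeXr // coprime_xs.
have {}uE : u%:~R * y%:R = 1 - e%:~R * x%:R ^+ 2 :> rat.
  apply: (addIr (e%:~R * x%:R ^+ 2)); rewrite subrK -natrX.
  by have := congr1 (fun t => t%:~R : rat) uE; rewrite intrD !intrM.
have [i|p pE] := @lattice_point _ v _ (fun i => f i) (u%:~R / x%:R ^+ 2) vk.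
  case: i => [[|[|[|j]]] ji] /=.
  - rewrite f0 natrX -/L -/y.
    have -> : y%:R / x%:R ^+ 2 - u%:~R / x%:R ^+ 2 * y%:R ^+ 2 = y%:R * e%:~R :> rat.
      have -> : u%:~R / x%:R ^+ 2 * y%:R ^+ 2 = (u%:~R * y%:R) * y%:R / x%:R ^+ 2 :> rat by field.
      by rewrite uE; field.
    by rewrite rpredM ?natr_int ?intr_int.
  - suff Di : (((L%:R + 2) * x%:R - y%:R) / x%:R ^+ 2 - u%:~R / x%:R ^+ 2 * L%:R : rat) \is a Num.int.
      by have := rpredD f1i Di; rewrite addrA subrK.
    (* By [markov], y D is a multiple of x^2; since y is invertible modulo x^2 with inverse u, so is
       D. *)
    pose D : rat := (L%:R + 2) * x%:R - y%:R - u%:~R * L%:R.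
    have DE : D / x%:R ^+ 2 = u%:~R * (1 + e%:~R * L%:R) + e%:~R * D.
      have yD : y%:R * D = x%:R ^+ 2 * (1 + e%:~R * L%:R).
        have -> : y%:R * D = (L%:R + 2) * (y%:R * x%:R) - y%:R ^+ 2 - u%:~R * y%:R * L%:R.
          by rewrite /D; ring.
        by rewrite uE -markov; ring.
      have x20 : x%:R ^+ 2 != 0 :> rat by rewrite expf_neq0.
      apply: (mulIf x20); rewrite divfK //.
      have -> : (u%:~R * (1 + e%:~R * L%:R) + e%:~R * D) * x%:R ^+ 2 =
          u%:~R * (x%:R ^+ 2 * (1 + e%:~R * L%:R)) + e%:~R * x%:R ^+ 2 * D by ring.
      by rewrite -yD mulrA uE; ring.
    have -> : ((L%:R + 2) * x%:R - y%:R) / x%:R ^+ 2 - u%:~R / x%:R ^+ 2 * L%:R = D / x%:R ^+ 2 :> rat.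
      by rewrite /D; field.
    have Dint : D \is a Num.int.
      apply: rpredB; [apply: rpredB; [apply: rpredM; [apply: rpredD|]|]|apply: rpredM];
        by first [exact: natr_int | exact: intr_int].
    rewrite DE; apply: rpredD; apply: rpredM => //; try exact: intr_int.
    by apply: rpredD; [exact: rpred1 | apply: rpredM; [exact: intr_int | exact: natr_int]].
  - rewrite f2 -/L -/x natrX sub0r.
    have -> : u%:~R / x%:R ^+ 2 * x%:R ^+ 2 = u%:~R :> rat by field.
    by rewrite rpredN intr_int.
  have jn : (j < n - 2)%N by move: ji; lia.
  have [_ fji] := fj j jn; rewrite -/L -/x -/y.
  suff Di : ((bw n (bump a j))%:R / x%:R -
      u%:~R / x%:R ^+ 2 * (y * x * bw n (bump a j))%:R : rat) \is a Num.int.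
    by have := rpredD fji Di; rewrite addrA subrK.
  have -> : (bw n (bump a j))%:R / x%:R - u%:~R / x%:R ^+ 2 * (y * x * bw n (bump a j))%:R =
      (bw n (bump a j))%:R * e%:~R * x%:R :> rat.
    rewrite !natrM; have -> : u%:~R / x%:R ^+ 2 * (y%:R * x%:R * (bw n (bump a j))%:R) =
       (u%:~R * y%:R) * (bw n (bump a j))%:R / x%:R :> rat by field.
    by rewrite uE; field.
  by rewrite !rpredM ?natr_int ?intr_int.
apply: (@noncanonical _ v _ (Ordinal o2) (fun i => f i) p vk fv pE) => //.
- case=> [[|[|[|j]]] ji] //=; first by rewrite f0 divr_ge0 ?exprn_ge0.
    by rewrite f2.
  by have [] := fj j _; first by move: ji; lia.
- by rewrite (big_ord_wt f) // f2 addr0.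
exists ord0; rewrite f0 divr_gt0 ?exprn_gt0 // ltr0n ?xs_gt0 //.
Qed.

End Noncanonical.

Lemma xs_le L i j : (0 < L)%N -> (i <= j)%N -> (xs L i <= xs L j)%N.
Proof.
move=> L0; elim: j => [|j IHj]; first by rewrite leqn0 => /eqP ->.
rewrite leq_eqVlt ltnS => /predU1P[->//|/IHj ij]; apply: leq_trans ij _.
by rewrite xsS leq_addr.
Qed.

(** From the second step of the branch on, the coefficients need no reduction modulo 1: they add up
    to 2 t_(n-1) / x, and x already exceeds 2 t_(n-1). *)
Lemma wt_noncanonical_gt1 n m a (v : 'I_n.+1 -> 'rV[int]_n) : (2 <= n)%N -> (a <= n - 2)%N ->
  wvec v (fun i : 'I_n.+1 => wt n m.+2 a i) -> fano (simplex v) -> ~ canonical (simplex v).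
Proof.
move=> n2 an vk fv; have an' : (a < n.-1)%N by lia.
set L := bw n a; have L0 : (0 < L)%N := bw_gt0 an'.
pose x := xs L m.+3; pose y := xs L m.+2.
have xgt0 : 0 < x%:R :> rat by rewrite ltr0n xs_gt0.
have x0 : x%:R != 0 :> rat by rewrite gt_eqF.
have yx : y%:R <= x%:R :> rat by rewrite ler_nat xs_le.
(* Here 2 t_(n-1) = L y_a with y_a - 1 at most L / 2, while x is at least L^2 + 3 L + 1. *)
have tx : (2 * sylv_t n.-1 < x)%N.
  apply: leq_trans (_ : xs L 3 <= _)%N; last by rewrite xs_le.
  have -> : xs L 3 = (L * L + 3 * L + 1)%N by rewrite /xs /=; ring.
  have := bw_ge an'; rewrite -(bwE an') -/L /sylv; nia.
pose f i : rat := match i with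
  | 0 => y%:R / x%:R ^+ 2
  | 1 => ((L%:R + 2) * x%:R - y%:R) / x%:R ^+ 2
  | 2 => 0
  | j.+3 => (bw n (bump a j))%:R / x%:R
  end.
apply: (@wt_noncanonical n m.+2 a n2 an v f vk fv); rewrite /f -/L -/x -/y //.
- rewrite divr_ge0 ?exprn_ge0 ?(ltW xgt0) // subr_ge0 (le_trans yx) // ler_peMl ?(ltW xgt0) //.
  by have := ler0n rat L; lra.
- by rewrite subrr rpred0.
- by move=> j jn; rewrite divr_ge0 ?(ltW xgt0) // subrr rpred0.
rewrite -mulr_suml (sum_bump (fun j => (bw n j)%:R)) // sum_bw -/L.
have -> : y%:R / x%:R ^+ 2 + ((L%:R + 2) * x%:R - y%:R) / x%:R ^+ 2 +
   (2 * (sylv_t n.-1)%:R - 2 - L%:R) / x%:R = (2 * sylv_t n.-1)%:R / x%:R :> rat.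
  by rewrite natrM; field.
by rewrite ltr_pdivrMr // mul1r ltr_nat.
Qed.

(** For x = L + 1 the unreduced coefficients add up to L (T + 1) / (L + 1), where T = y_a - 1.
    Taking 1 off the coefficient at index 1 and the integers T / y_i for i < a, whose sum is T - 1,
    off the others leaves (L - T) / (L + 1). The bound L >= 2 T keeps all coefficients
    non-negative. *)
Lemma wt_noncanonical1 n a (v : 'I_n.+1 -> 'rV[int]_n) : (2 <= n)%N -> (a <= n - 2)%N ->
  wvec v (fun i : 'I_n.+1 => wt n 1 a i) -> fano (simplex v) -> ~ canonical (simplex v).
Proof.
move=> n2 an vk fv; have an' : (a < n.-1)%N by lia.
set L := bw n a; pose T : rat := (sylv_prod a)%:R.
have xE : xs L 2 = L.+1 := xs2 L; have yE : xs L 1 = 1%N by rewrite xsS.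
have x_gt0 : 0 < L%:R + 1 :> rat by rewrite ltr_wpDl.
have x0 : L%:R + 1 != 0 :> rat by rewrite gt_eqF.
have TL : 2 * T <= L%:R by rewrite /T -natrM ler_nat bw_ge.
have T0 : 0 < T by rewrite ltr0n sylv_prod_gt0.
have tE : 2 * (sylv_t n.-1)%:R = L%:R * (T + 1) :> rat.
  by rewrite /T natr1 -natrM -(bwE an') natrM.
pose e i : rat := if (i < a)%N then T / (sylv i)%:R else 0.
pose g i : rat := (bw n i)%:R / (L%:R + 1) - e i.
pose f i : rat := match i with
  | 0 => ((L%:R + 1) ^+ 2)^-1
  | 1 => L%:R / (L%:R + 1) ^+ 2
  | 2 => 0
  | j.+3 => g (bump a j)
  end.
have se : \sum_(j < n.-1) e j = T - 1.
  have -> : T - 1 = T * (1 - T^-1) by field; rewrite gt_eqF.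
  rewrite -sum_inv_sylv mulr_sumr (big_ord_widen n.-1 (fun i => T / (sylv i)%:R)) ?(ltnW an') //.
  by rewrite [RHS]big_mkcond.
apply: (@wt_noncanonical n 1 a n2 an v f vk fv); rewrite /f -/L ?xE ?yE -?[L.+1%:R]natr1 //.
- by rewrite mul1r.
- by rewrite divr_ge0 ?exprn_ge0 ?(ltW x_gt0).
- have -> : L%:R / (L%:R + 1) ^+ 2 - ((L%:R + 2) * (L%:R + 1) - 1%:R) / (L%:R + 1) ^+ 2 = -1 :> rat.
    by field.
  by rewrite rpredN rpred1.
- move=> j jn; rewrite /g /e; have bn : (bump a j < n.-1)%N by rewrite /bump; case: leqP => /=; lia.
  split; last first.
    rewrite addrAC subrr add0r rpredN; case: ltnP => [ba|_]; last exact: rpred0.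
    have /dvdnP[q qE] := sylv_dvd_prod ba; rewrite /T qE natrM mulfK ?pnatr_eq0 //.
    exact: natr_int.
  case: ltnP => [ba|_]; last by rewrite subr0 divr_ge0 // ltW.
  have s0 : 0 < (sylv (bump a j))%:R :> rat by rewrite ltr0n.
  rewrite bwQ // natrM tE.
  have -> : L%:R * (T + 1) / (sylv (bump a j))%:R / (L%:R + 1) - T / (sylv (bump a j))%:R =
     (L%:R - T) / (sylv (bump a j))%:R / (L%:R + 1).
    by field; rewrite x0 gt_eqF.
  rewrite divr_ge0 ?(ltW x_gt0) // divr_ge0 ?(ltW s0) // subr_ge0.
  by move: TL T0; lra.
rewrite (sum_bump g) // {1}/g sumrB se -mulr_suml sum_bw tE /g /e ltnn subr0 -/L.
have -> : ((L%:R + 1) ^+ 2)^-1 + L%:R / (L%:R + 1) ^+ 2 +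
   ((L%:R * (T + 1) - 2) / (L%:R + 1) - (T - 1) - L%:R / (L%:R + 1)) = (L%:R - T) / (L%:R + 1) :> rat.
  by field.
by rewrite ltr_pdivrMr // mul1r; move: T0; lra.
Qed.

Lemma Xma_noncanonical n m a (P : set 'rV[rat]_n) : (2 <= n)%N -> (a <= n - 2)%N ->
  (0 < m)%N -> is_Xma m a P -> ~ canonical P.
Proof.
move=> n2 an m0 /(is_XmaP _ _ n2 an)[fP [v PE vk]]; rewrite PE in fP *.
case: m m0 vk => [|[|m]] // _ vk; first exact: (wt_noncanonical1 n2 an vk).
exact: (wt_noncanonical_gt1 n2 an vk).
Qed.

(** * The graph of mutations *)

Lemma is_Xma_perm n m a (v : 'I_n.+1 -> 'rV[int]_n) (k : 'I_n.+1 -> nat) (s : 'S_n.+1) :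
  (2 <= n)%N -> (a <= n - 2)%N -> fano (simplex v) -> wvec v k ->
  (forall i, k (s i) = wt n m a i) -> is_Xma m a (simplex v).
Proof.
move=> n2 an fP vk ks; apply/is_XmaP => //; split=> //; exists (v \o s).
  by rewrite simplex_perm.
have := wvec_perm s vk; congr wvec; exact/funext.
Qed.

Lemma is_wpsP n (P : set 'rV[rat]_n) :
  is_wps P -> fano P /\ exists v k, P = simplex v /\ wvec v k.
Proof. by move=> [l /is_wps_ofP[fP [v [k [PE vk _]]]]]; split=> //; exists v, k. Qed.

Lemma Xma_mutation_source n m a (P Q : set 'rV[rat]_n) : (4 <= n)%N -> (a <= n - 2)%N ->
  is_wps P -> is_Xma m.+1 a Q -> nontrivial_mutation P Q -> is_Xma m a P \/ is_Xma m.+2 a P.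
Proof.
move=> n4 an Pw QX mut; have n2 : (2 <= n)%N by lia.
have Qw : is_wps Q by eexists; exact: QX.
have [fP [v [k [PE vk]]]] := is_wpsP Pw.
have [r [q [QE rq wm]]] := wps_mutation vk PE Qw mut.
have [_ [v' QE' vk']] := (is_XmaP _ _ n2 an).1 QX.
have [s sE] := simplex_weights rq vk' (etrans (esym QE) QE').
have [_ k1 _ _] := wvec_perm s vk.
have wm' : weight_mutation (fun i : 'I_n.+1 => wt n m.+1 a i) (k \o s).
  apply: (weight_mutation_sym k1); have := weight_mutation_perm s wm.
  by congr weight_mutation; apply/funext => i; rewrite sE.
rewrite PE in fP *; have [s' [s'E|s'E]] := wt_neighbors n4 an wm'; [right|left].
  by apply: (is_Xma_perm (s := (s' * s)%g) n2 an fP vk) => i; rewrite permM; exact: s'E.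
by apply: (is_Xma_perm (s := (s' * s)%g) n2 an fP vk) => i; rewrite permM; exact: s'E.
Qed.

Lemma Xma_mutation_target n m a (P Q : set 'rV[rat]_n) : (4 <= n)%N -> (a <= n - 2)%N ->
  is_Xma m.+1 a P -> is_wps Q -> nontrivial_mutation P Q -> is_Xma m a Q \/ is_Xma m.+2 a Q.
Proof.
move=> n4 an PX Qw mut; have n2 : (2 <= n)%N by lia.
have [_ [v PE vk]] := (is_XmaP _ _ n2 an).1 PX.
have [r [q [QE rq wm]]] := wps_mutation vk PE Qw mut.
have [fQ _] := is_wpsP Qw; rewrite QE in fQ *.
by have [s [sE|sE]] := wt_neighbors n4 an wm; [right|left]; apply: is_Xma_perm rq sE.
Qed.

Lemma X_mutation_target n (P Q : set 'rV[rat]_n) : (4 <= n)%N ->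
  is_X P -> is_wps Q -> nontrivial_mutation P Q -> exists2 a, (a <= n - 2)%N & is_Xma 1 a Q.
Proof.
move=> n4 PX Qw mut; have n2 : (2 <= n)%N by lia.
have [_ [v PE vk]] := (is_XP _ n2).1 PX.
have [r [q [QE rq wm]]] := wps_mutation vk PE Qw mut.
have [fQ _] := is_wpsP Qw; rewrite QE in fQ *.
by have [a [an [s sE]]] := wtX_neighbors n4 wm; exists a => //; apply: is_Xma_perm rq sE.
Qed.

Lemma node_step n (x : node n) (P Q : set 'rV[rat]_n) : (4 <= n)%N ->
  node_space x P -> is_wps Q -> nontrivial_mutation P Q ->
  exists2 y, node_space y Q & tree_adj x y.
Proof.
move=> n4; have n2 : (2 <= n)%N by lia.
case: x => [[a m]|] /= PX Qw mut; last first.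
  have [a an QX] := X_mutation_target n4 PX Qw mut.
  have an' : (a < n.-1)%N by lia.
  by exists (Some (Ordinal an', 0%N)).
have an : (a <= n - 2)%N by have := ltn_ord a; lia.
have [QX|QX] := Xma_mutation_target n4 an PX Qw mut; last first.
  by exists (Some (a, m.+1)); rewrite //= !eqxx.
case: m {PX} QX => [QX|m QX]; first by exists None => //; apply/(is_Xma0 _ n2 an).
by exists (Some (a, m)); rewrite //= !eqxx orbT.
Qed.

Lemma xs_prod_inj L i j : (0 < L)%N ->
  (xs L i.+1 * xs L i.+2 = xs L j.+1 * xs L j.+2)%N -> i = j.
Proof.
move=> L0; wlog ij : i j / (i < j)%N.
  move=> H E; have [ij|ji|//] := ltngtP i j; first exact: H.
  exact/esym/H.
move=> /eqP; rewrite ltn_eqF // (leq_ltn_trans (_ : _ <= xs L j.+1 * xs L i.+2)%N) //.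
  by rewrite leq_mul2r xs_le ?orbT // ltnW.
rewrite ltn_mul2l xs_gt0 (leq_ltn_trans (xs_le L0 (_ : i.+2 <= j.+1)%N)) //.
exact: xs_ltS.
Qed.

Lemma Xma_inj n m m' (a a' : nat) (P : set 'rV[rat]_n) : (2 <= n)%N ->
  (a <= n - 2)%N -> (a' <= n - 2)%N ->
  is_Xma m.+1 a P -> is_Xma m'.+1 a' P -> a = a' /\ m = m'.
Proof.
move=> n2 an an'.
move=> /(is_XmaP _ _ n2 an)[_ [v PE vk]] /(is_XmaP _ _ n2 an')[_ [v' PE' vk']].
have [s sE] := simplex_weights vk vk' (etrans (esym PE) PE').
have bn : (a < n.-1)%N by lia. have bn' : (a' < n.-1)%N by lia.
set L := bw n a; set L' := bw n a'.
have L0 : (0 < L)%N := bw_gt0 bn; have L0' : (0 < L')%N := bw_gt0 bn'.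
have S : (xs L m.+1 * xs L m.+2 = xs L' m'.+1 * xs L' m'.+2)%N.
  apply/eqP; rewrite -(@eqn_pmul2l (2 * sylv_t n.-1)) ?muln_gt0 ?sylv_prod_gt0 //.
  rewrite -!sum_wt // (reindex_inj (@perm_inj _ s)); apply/eqP.
  by apply: eq_bigr => i _; rewrite sE.
have o1 : (1 < n.+1)%N by lia.
(* L' must occur among the weights of the first space. Parity excludes the two squares, and size the
   products: their factor x_(m+1) x_(m+2), common to both spaces by [S], exceeds L'. *)
have LL : L = L'.
  have bs := kap_bound n2 an (ltn_ord (s (Ordinal o1)) : s (Ordinal o1) <= n)%N.
  have eL' : ~~ odd L' := bw_even bn'; have eL : ~~ odd L := bw_even bn.
  have := sE (Ordinal o1); rewrite [LHS]/= -/L'.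
  case: (s (Ordinal o1) : nat) bs => [|[|[|j]]] //= bs E.
  - by move: eL'; rewrite E oddX odd_xs.
  - by move: eL'; rewrite E oddX odd_xs.
  have : (L' < L')%N; last by rewrite ltnn.
  rewrite [X in (_ < X)%N]E S.
  have Lx : (L' < xs L' m'.+2)%N by rewrite -[X in (X <= _)%N]xs2 xs_le.
  by apply: leq_trans Lx _; rewrite mulnAC leq_pmull // muln_gt0 xs_gt0 bw_gt0.
split; first exact: bw_inj LL.
by move: S; rewrite -LL; apply: xs_prod_inj.
Qed.

Lemma X_neq_Xma n m a (P : set 'rV[rat]_n) : (2 <= n)%N -> (a <= n - 2)%N ->
  is_X P -> ~ is_Xma m.+1 a P.
Proof.
move=> n2 an /(is_XP _ n2)[_ [v PE vk]] /(is_XmaP _ _ n2 an)[_ [v' PE' vk']].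
have [s sE] := simplex_weights vk vk' (etrans (esym PE) PE').
have bn : (a < n.-1)%N by lia.
have := sum_wtX n2; rewrite (reindex_inj (@perm_inj _ s)).
rewrite (eq_bigr _ (fun i _ => esym (sE i))) sum_wt //.
move/eqP; rewrite -[X in _ == X]muln1 eqn_pmul2l ?muln_gt0 ?sylv_prod_gt0 // gtn_eqF //.
have := xs_gt0 (bw n a) m.+1; have := xs_ltS m (bw_gt0 bn).
by move: (xs _ _) (xs _ _) => p q; nia.
Qed.

Lemma node_uniq n (x y : node n) (P : set 'rV[rat]_n) : (2 <= n)%N ->
  node_space x P -> node_space y P -> x = y.
Proof.
move=> n2; have an (a : 'I_n.-1) : (a <= n - 2)%N by have := ltn_ord a; lia.
case: x => [[a m]|]; case: y => [[a' m']|] //= Px Py.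
- by have [/ord_inj -> ->] := Xma_inj n2 (an a) (an a') Px Py.
- by case: (X_neq_Xma n2 (an a) Py Px).
by case: (X_neq_Xma n2 (an a') Px Py).
Qed.

Lemma node_wps n (x : node n) (P : set 'rV[rat]_n) : node_space x P -> is_wps P.
Proof. by case: x => [[a m]|] /= PX; eexists; exact: PX. Qed.

Lemma node_iso n (x : node n) (P Q : set 'rV[rat]_n) : (2 <= n)%N ->
  node_space x P -> node_space x Q -> poly_iso P Q.
Proof.
move=> n2; case: x => [[a m]|] /=.
  have an : (a <= n - 2)%N by have := ltn_ord a; lia.
  move=> /(is_XmaP _ _ n2 an)[_ [v -> vk]] /(is_XmaP _ _ n2 an)[_ [v' -> vk']].
  exact: simplex_iso vk vk'.
move=> /(is_XP _ n2)[_ [v -> vk]] /(is_XP _ n2)[_ [v' -> vk']].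
exact: simplex_iso vk vk'.
Qed.

Lemma reachable_node n (P : set 'rV[rat]_n) : (4 <= n)%N ->
  reachable P -> exists x, node_space x P.
Proof.
move=> n4; elim=> [{}P PX|{}P Q _ [x Px] Qw mut]; first by exists None.
by have [y] := node_step n4 Px Qw mut; exists y.
Qed.

Theorem proposition7p4 (n : nat) (hn : (2 <= n)%N) :
  (* the lambda_i^(m,a) are integers and X_n^(m,a) is well defined *)
  (forall m a : nat, (a <= n - 2)%N ->
     exists P : set 'rV[rat]_n, is_Xma m a P) /\
  (* (i) *)
  (forall a : nat, (a <= n - 2)%N ->
     forall P : set 'rV[rat]_n, is_Xma 0 a P <-> is_X P) /\
  (* (ii); it fails for n = 2 and n = 3 *)
  ((4 <= n)%N ->
   forall m a : nat, (a <= n - 2)%N -> (0 < m)%N ->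
   forall P Q : set 'rV[rat]_n,
     is_wps P -> is_Xma m a Q -> nontrivial_mutation P Q ->
     is_Xma m.-1 a P \/ is_Xma m.+1 a P) /\
  (* (iii) *)
  (forall m a : nat, (a <= n - 2)%N -> (1 <= m)%N ->
   forall P : set 'rV[rat]_n, is_Xma m a P -> ~ canonical P) /\
  (* the graph of mutations starting at X_n *)
  ((4 <= n)%N ->
   mutation_graph_is_subtree n /\
   (forall P : set 'rV[rat]_n, reachable P -> (canonical P <-> is_X P))).
Proof.
split; first by move=> m a an; apply: Xma_exists.
split; first by move=> a an P; apply: is_Xma0.
split.
  move=> n4 [//|m] a an _ P Q Pw QX mut.
  exact: Xma_mutation_source n4 an Pw QX mut.
split; first by move=> m a an m0 P; apply: Xma_noncanonical.
move=> n4; split; first split.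
- move=> P /(reachable_node n4)[x Px]; exists x; split=> // y.
  exact: node_uniq hn Px.
- by move=> x P Q; apply: node_iso.
- move=> x y P Q _ _ Px Qy mut.
  have [y' Qy' xy'] := node_step n4 Px (node_wps Qy) mut.
  by rewrite (node_uniq hn Qy Qy').
move=> P PR; split=> [can|]; last exact: X_canonical.
have [[[a m]|] Px] := reachable_node n4 PR; last exact: Px.
case: (Xma_noncanonical hn _ (ltn0Sn m) Px can).
by have := ltn_ord a; lia.
Qed.
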